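(* Let $\mathcal{A},\mathcal{B}$ be abelian categories, let $F\colon\mathcal{B}\rightsquigarrow\mathcal{A}$ be a functor, let $n\ge1$, and let $V_n,\ldots,V_1,X$ be objects of $\mathcal{B}$. Then there is a chain homotopy equivalence \[\Delta_nF(V_n,\ldots, V_1;X)\simeq \bigoplus _{ \pi=\{S_1, \ldots, S_k\}}\nabla^{\pi}F(V_n, \ldots, V_1;X),\] where the sum is taken over all partitions $\pi$ of the set $\{1,2,\ldots, n\}$ and, for $\pi=\{S_1,\ldots,S_k\}$, $\nabla^{\pi}F(V_n,\ldots,V_1;X):=\nabla^{k}F(V_{|S_1|},\ldots,V_{|S_k|};X)$.
   Context: Conventions. For an abelian category $\mathcal{A}$, $\mathrm{Ch}\mathcal{A}$ is the category of non-negatively graded chain complexes in $\mathcal{A}$. $F\colon\mathcal{B}\rightsquigarrow\mathcal{A}$ denotes an arbitrary (not necessarily additive or reduced) functor $F\colon\mathcal{B}\to\mathrm{Ch}\mathcal{A}$; functors $\mathcal{B}\to\mathcal{A}$ are included as those concentrated in degree $0$. Direct sums of functors are pointwise. The symbol $\simeq$ (chain homotopy equivalence of functors) means pointwise: for every choice of objects the resulting chain complexes are chain homotopy equivalent. Cross effects. For $F\colon\mathcal{B}\rightsquigarrow\mathcal{A}$, $\mathrm{cr}_1F(X)$ is the complement of $F(0)$ in $F(X)$, i.e. $\ker(F(X)\to F(0))$, so $F(X)\cong F(0)\oplus\mathrm{cr}_1F(X)$; recursively $\mathrm{cr}_nF(X_1,\ldots,X_n)$ is the complement of $\mathrm{cr}_{n-1}F(X_1,X_3,\ldots,X_n)\oplus\mathrm{cr}_{n-1}F(X_2,X_3,\ldots,X_n)$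 in $\mathrm{cr}_{n-1}F(X_1\oplus X_2,X_3,\ldots,X_n)$, i.e. the kernel of the map to this sum induced by the projections. Put $C_2F(X)=\mathrm{cr}_2F(X,X)$, with natural map $\epsilon\colon C_2F\to F$ given by $\mathrm{cr}_2F(X,X)\hookrightarrow \mathrm{cr}_1F(X\oplus X)\to\mathrm{cr}_1F(X)\hookrightarrow F(X)$, the middle map induced by the fold map $X\oplus X\to X$; write $\rho_1\colon C_2F\to\mathrm{cr}_1F$ for the composite of the first two maps. Linearization. $D_1F\colon\mathcal{B}\rightsquigarrow\mathcal{A}$ is the totalization of the chain complex of chain complexes with $(D_1F)_0=\mathrm{cr}_1F$, $(D_1F)_k=C_2^{\times k}F$ ($k$-fold iterate of $C_2$) for $k\ge1$, with $\partial_1=\rho_1$ and $\partial_k=\sum_{i=0}^{k-1}(-1)^iC_2^{\times i}\epsilon$ for $k\ge2$. Directional derivative. $\nabla F\colon\mathcal{B}\times\mathcal{B}\rightsquigarrow\mathcal{A}$ is $\nabla F(V;X)=D_1\bigl(F(X\oplus-)\bigr)(V)$. It applies also to functors on product categories $\mathcal{B}^m$, regarded as abelian categories. Iterated partial directional derivatives. $\nabla^0F(X)=F(X)$, $\nabla^1F(V;X)=\nabla F(V;X)$ and for $n\ge2$, $\nabla^nF(V_n,\ldots,V_1;X)=\nabla\bigl(\nabla^{n-1}F(V_{n-1},\ldots,V_1;-)\bigr)(V_n;X)$ (with $V_{n-1},\ldots,V_1$ held fixed). Up to natural isomorphism $\nabla^nF$ is symmetric in its $n$ direction variables $V_n,\ldots,V_1$,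 so the order of the $V_{|S_i|}$ does not matter. Higher order directional derivatives. $\Delta_0F(X)=F(X)$, $\Delta_1F(V;X)=\nabla F(V;X)$, and for $n\ge2$, regarding $\Delta_{n-1}F$ as a functor $\mathcal{B}^n\rightsquigarrow\mathcal{A}$, $\Delta_nF(V_n,\ldots,V_1;X)=\nabla(\Delta_{n-1}F)\bigl((V_n,\ldots,V_2,V_1);(V_{n-1},\ldots,V_1,X)\bigr)$. $|S|$ denotes the cardinality of a set $S$. *)

(* Defs.v *)
From HB Require Import structures.
From mathcomp Require Import all_boot all_order all_algebra.
From mathcomp Require Import boolp classical_sets.
Set Implicit Arguments.
Unset Strict Implicit.
Unset Printing Implicit Defensive.
Import GRing.Theory.
Local Open Scope ring_scope.

(* Classically every abelian group is a [zmodType], so this puts no restriction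
   on the hom-groups. *)
Record preadd := Preadd {
  ob :> Type;
  hom : ob -> ob -> zmodType;
  idm : forall x, hom x x;
  cmp : forall x y z, hom y z -> hom x y -> hom x z;
  cmpA : forall x y z t (h : hom z t) (g : hom y z) (f : hom x y),
    cmp h (cmp g f) = cmp (cmp h g) f;
  cmp1m : forall x y (f : hom x y), cmp (idm y) f = f;
  cmpm1 : forall x y (f : hom x y), cmp f (idm x) = f;
  cmpDl : forall x y z (g g' : hom y z) (f : hom x y),
    cmp (g + g') f = cmp g f + cmp g' f;
  cmpDr : forall x y z (g : hom y z) (f f' : hom x y),
    cmp g (f + f') = cmp g f + cmp g f' }.

Arguments hom {p} _ _.
Arguments idm {p} x.

Notation "g ∘ f" := (cmp g f) (at level 40, left associativity) : ring_scope.

Section PreaddTheory.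
Variable A : preadd.
Implicit Types x y z : A.

Lemma cmp0m x y z (f : hom x y) : (0 : hom y z) ∘ f = 0.
Proof. by apply: (addrI (0 ∘ f)); rewrite -cmpDl !addr0. Qed.

Lemma cmpm0 x y z (g : hom y z) : g ∘ (0 : hom x y) = 0.
Proof. by apply: (addrI (g ∘ 0)); rewrite -cmpDr !addr0. Qed.

Lemma cmpNm x y z (g : hom y z) (f : hom x y) : (- g) ∘ f = - (g ∘ f).
Proof. by apply: (addrI (g ∘ f)); rewrite -cmpDl !subrr cmp0m. Qed.

Lemma cmpmN x y z (g : hom y z) (f : hom x y) : g ∘ (- f) = - (g ∘ f).
Proof. by apply: (addrI (g ∘ f)); rewrite -cmpDr !subrr cmpm0. Qed.

Lemma cmpMnm x y z (g : hom y z) (f : hom x y) n : (g *+ n) ∘ f = (g ∘ f) *+ n.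
Proof. by elim: n => [|n IH]; rewrite ?cmp0m // !mulrS cmpDl IH. Qed.

Lemma cmpmMn x y z (g : hom y z) (f : hom x y) n : g ∘ (f *+ n) = (g ∘ f) *+ n.
Proof. by elim: n => [|n IH]; rewrite ?cmpm0 // !mulrS cmpDr IH. Qed.

Lemma cmpMzm x y z (g : hom y z) (f : hom x y) (s : int) :
  (g *~ s) ∘ f = (g ∘ f) *~ s.
Proof. by case: s => n; rewrite ?NegzE -?pmulrn ?nmulrn ?cmpNm cmpMnm. Qed.

Lemma cmpmMz x y z (g : hom y z) (f : hom x y) (s : int) :
  g ∘ (f *~ s) = (g ∘ f) *~ s.
Proof. by case: s => n; rewrite ?NegzE -?pmulrn ?nmulrn ?cmpmN cmpmMn. Qed.

Lemma cmp_suml x y z (I : Type) (r : seq I) (P : pred I) (g : I -> hom y z)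
    (f : hom x y) :
  (\sum_(i <- r | P i) g i) ∘ f = \sum_(i <- r | P i) g i ∘ f.
Proof. by apply: (big_morph (fun h => h ∘ f)) => [? ?|]; rewrite (cmpDl, cmp0m). Qed.

Lemma cmp_sumr x y z (I : Type) (r : seq I) (P : pred I) (g : hom y z)
    (f : I -> hom x y) :
  g ∘ (\sum_(i <- r | P i) f i) = \sum_(i <- r | P i) g ∘ f i.
Proof. by apply: (big_morph (cmp g)) => [? ?|]; rewrite (cmpDr, cmpm0). Qed.

Definition mono x y (f : hom x y) : Prop :=
  forall w (u v : hom w x), f ∘ u = f ∘ v -> u = v.

Definition epi x y (f : hom x y) : Prop :=
  forall z (u v : hom y z), u ∘ f = v ∘ f -> u = v.

Definition is_kernel x y (f : hom x y) k (i : hom k x) : Prop :=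
  f ∘ i = 0 /\
  forall w (g : hom w x), f ∘ g = 0 -> exists! u : hom w k, i ∘ u = g.

Definition is_cokernel x y (f : hom x y) c (p : hom y c) : Prop :=
  p ∘ f = 0 /\
  forall z (g : hom y z), g ∘ f = 0 -> exists! u : hom c z, u ∘ p = g.

End PreaddTheory.

(* Additive categories with kernels: the structure needed by the constructions
   below, shared by abelian categories, their powers and their categories of
   chain complexes. Zero object, biproducts and kernels are chosen, so that
   they can be used to define functors. *)
Record kadd := Kadd {
  kbase :> preadd;
  zob : kbase;
  zobP : idm zob = 0;
  bip : kbase -> kbase -> kbase;
  in1 : forall x y, hom x (bip x y);
  in2 : forall x y, hom y (bip x y);
  pr1 : forall x y, hom (bip x y) x;
  pr2 : forall x y, hom (bip x y) y;
  pr1_in1 : forall x y, pr1 x y ∘ in1 x y = idm x;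
  pr2_in2 : forall x y, pr2 x y ∘ in2 x y = idm y;
  pr2_in1 : forall x y, pr2 x y ∘ in1 x y = 0;
  pr1_in2 : forall x y, pr1 x y ∘ in2 x y = 0;
  bipP : forall x y, in1 x y ∘ pr1 x y + in2 x y ∘ pr2 x y = idm (bip x y);
  ker : forall x y : kbase, hom x y -> kbase;
  kin : forall (x y : kbase) (f : hom x y), hom (ker f) x;
  kinP : forall (x y : kbase) (f : hom x y), is_kernel f (kin f) }.

Arguments zob {k}.
Arguments bip {k} _ _.
Arguments in1 {k x y}.
Arguments in2 {k x y}.
Arguments pr1 {k x y}.
Arguments pr2 {k x y}.

Notation "x ⊕ y" := (bip x y) (at level 50, left associativity) : ring_scope.

(* The additive structure of an abelian category is determined by the underlying
   category, so taking it as data loses no generality. *)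
Record abelian := Abelian {
  abase :> kadd;
  has_coker : forall (x y : abase) (f : hom x y),
    exists (c : abase) (p : hom y c), is_cokernel f p;
  mono_normal : forall (x y : abase) (f : hom x y), mono f ->
    exists (z : abase) (g : hom y z), is_kernel g f;
  epi_normal : forall (x y : abase) (f : hom x y), epi f ->
    exists (w : abase) (g : hom w x), is_cokernel g f }.

Section KaddTheory.
Variable A : kadd.
Implicit Types x y z w : A.

Lemma homz_eq x (f g : hom x zob) : f = g.
Proof. by rewrite -[f]cmp1m -[g]cmp1m !zobP !cmp0m. Qed.

Lemma zhom_eq x (f g : hom zob x) : f = g.
Proof. by rewrite -[f]cmpm1 -[g]cmpm1 !zobP !cmpm0. Qed.

Definition bpair x y z (f : hom z x) (g : hom z y) : hom z (x ⊕ y) :=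
  in1 ∘ f + in2 ∘ g.

Definition bcopair x y z (f : hom x z) (g : hom y z) : hom (x ⊕ y) z :=
  f ∘ pr1 + g ∘ pr2.

Definition bfold x : hom (x ⊕ x) x := bcopair (idm x) (idm x).

Definition bimap x y x' y' (f : hom x x') (g : hom y y') :
  hom (x ⊕ y) (x' ⊕ y') := bpair (f ∘ pr1) (g ∘ pr2).

Lemma pr1_pair x y z (f : hom z x) (g : hom z y) : pr1 ∘ bpair f g = f.
Proof. by rewrite cmpDr !cmpA pr1_in1 pr1_in2 cmp1m cmp0m addr0. Qed.

Lemma pr2_pair x y z (f : hom z x) (g : hom z y) : pr2 ∘ bpair f g = g.
Proof. by rewrite cmpDr !cmpA pr2_in1 pr2_in2 cmp1m cmp0m add0r. Qed.

Lemma pair_eta x y z (f : hom z (x ⊕ y)) : bpair (pr1 ∘ f) (pr2 ∘ f) = f.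
Proof. by rewrite /bpair !cmpA -cmpDl bipP cmp1m. Qed.

Lemma bip_eq x y z (f g : hom z (x ⊕ y)) :
  pr1 ∘ f = pr1 ∘ g -> pr2 ∘ f = pr2 ∘ g -> f = g.
Proof. by move=> e1 e2; rewrite -[f]pair_eta -[g]pair_eta e1 e2. Qed.

Lemma copair_in1 x y z (f : hom x z) (g : hom y z) : bcopair f g ∘ in1 = f.
Proof. by rewrite cmpDl -!cmpA pr1_in1 pr2_in1 cmpm1 cmpm0 addr0. Qed.

Lemma copair_in2 x y z (f : hom x z) (g : hom y z) : bcopair f g ∘ in2 = g.
Proof. by rewrite cmpDl -!cmpA pr1_in2 pr2_in2 cmpm1 cmpm0 add0r. Qed.

Lemma cobip_eq x y z (f g : hom (x ⊕ y) z) :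
  f ∘ in1 = g ∘ in1 -> f ∘ in2 = g ∘ in2 -> f = g.
Proof.
by move=> e1 e2; rewrite -[f]cmpm1 -[g]cmpm1 -bipP !cmpDr !cmpA e1 e2.
Qed.

Lemma pair_cmp x y z w (f : hom z x) (g : hom z y) (h : hom w z) :
  bpair f g ∘ h = bpair (f ∘ h) (g ∘ h).
Proof. by rewrite cmpDl -!cmpA. Qed.

Lemma pr1_bimap x y x' y' (f : hom x x') (g : hom y y') :
  pr1 ∘ bimap f g = f ∘ pr1.
Proof. exact: pr1_pair. Qed.

Lemma pr2_bimap x y x' y' (f : hom x x') (g : hom y y') :
  pr2 ∘ bimap f g = g ∘ pr2.
Proof. exact: pr2_pair. Qed.

Lemma bimap_pair x y x' y' z (f : hom x x') (g : hom y y')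
  (h : hom z x) (k : hom z y) : bimap f g ∘ bpair h k = bpair (f ∘ h) (g ∘ k).
Proof. by rewrite pair_cmp -!cmpA pr1_pair pr2_pair. Qed.

Lemma bimap1 x y : bimap (idm x) (idm y) = idm (x ⊕ y).
Proof. by apply: bip_eq; rewrite (pr1_bimap, pr2_bimap) cmp1m cmpm1. Qed.

Lemma bimap_cmp x y x' y' x2 y2 (f' : hom x' x2) (g' : hom y' y2)
    (f : hom x x') (g : hom y y') :
  bimap (f' ∘ f) (g' ∘ g) = bimap f' g' ∘ bimap f g.
Proof. by rewrite bimap_pair !cmpA. Qed.

Lemma fold_nat x y (f : hom x y) : f ∘ bfold x = bfold y ∘ bimap f f.
Proof.
by rewrite /bfold /bcopair !cmp1m cmpDr cmpDl pr1_bimap pr2_bimap.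
Qed.

Lemma kinK x y (f : hom x y) : f ∘ kin f = 0.
Proof. by case: (kinP f). Qed.

(* The factorization of [g] through the kernel of [f]; its value is irrelevant
   unless [f ∘ g = 0]. *)
Definition klift x y w (f : hom x y) (g : hom w x) : hom w (ker f) :=
  xget 0 (fun u : hom w (ker f) => kin f ∘ u = g).

Lemma kin_lift x y w (f : hom x y) (g : hom w x) :
  f ∘ g = 0 -> kin f ∘ klift f g = g.
Proof.
move=> fg0; rewrite /klift; case: xgetP => [u -> //|no].
have [_ /(_ w g fg0) [u [ku _]]] := kinP f.
by case: (no u).
Qed.

Lemma kin_mono x y (f : hom x y) : mono (kin f).
Proof.
move=> w u v e; have [fk0 /(_ w (kin f ∘ u))] := kinP f.
rewrite cmpA fk0 cmp0m => /(_ erefl) [t [_ tP]].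
by rewrite -(tP u) // -(tP v).
Qed.

End KaddTheory.

(* Functors are not required to preserve sums of morphisms. *)
Record functor (B C : preadd) := Functor {
  fob :> B -> C;
  fmor : forall x y, hom x y -> hom (fob x) (fob y);
  fmor1 : forall x, fmor (idm x) = idm (fob x);
  fmorM : forall x y z (g : hom y z) (f : hom x y),
    fmor (g ∘ f) = fmor g ∘ fmor f }.

Record nattr (B C : preadd) (F G : functor B C) := Nattr {
  nt :> forall x, hom (F x) (G x);
  ntP : forall x y (f : hom x y), nt y ∘ fmor F f = fmor G f ∘ nt x }.

Notation "F ⟹ G" := (nattr F G) (at level 70) : type_scope.

Section FunctorOps.
Variables B C D : preadd.

Fact fcomp1 (G : functor C D) (F : functor B C) x :
  fmor G (fmor F (idm x)) = idm (G (F x)).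
Proof. by rewrite !fmor1. Qed.

Fact fcompM (G : functor C D) (F : functor B C) x y z (g : hom y z) (f : hom x y) :
  fmor G (fmor F (g ∘ f)) = fmor G (fmor F g) ∘ fmor G (fmor F f).
Proof. by rewrite !fmorM. Qed.

Definition fcomp (G : functor C D) (F : functor B C) : functor B D :=
  @Functor B D (fun x => G (F x)) (fun x y f => fmor G (fmor F f))
    (fcomp1 G F) (fcompM G F).

Definition idf : functor B B :=
  @Functor B B (fun x => x) (fun x y f => f) (fun=> erefl)
    (fun _ _ _ _ _ => erefl).

Definition constf (c : C) : functor B C :=
  @Functor B C (fun=> c) (fun _ _ _ => idm c) (fun=> erefl)
    (fun _ _ _ _ _ => esym (cmp1m _)).

Definition ntwhisker (G G' : functor C D) (a : G ⟹ G') (F : functor B C) :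
    fcomp G F ⟹ fcomp G' F :=
  @Nattr B D (fcomp G F) (fcomp G' F) (fun x => a (F x))
    (fun x y f => ntP a (fmor F f)).

Fact ntcompP (F G H : functor B C) (b : G ⟹ H) (a : F ⟹ G) x y (f : hom x y) :
  (b y ∘ a y) ∘ fmor F f = fmor H f ∘ (b x ∘ a x).
Proof. by rewrite -cmpA ntP cmpA ntP cmpA. Qed.

Definition ntcomp (F G H : functor B C) (b : G ⟹ H) (a : F ⟹ G) : F ⟹ H :=
  @Nattr B C F H (fun x => b x ∘ a x) (ntcompP b a).

End FunctorOps.

Section Product.

Section Pre.
Variables A B : preadd.
Implicit Types x y z t : (A * B)%type.

Let phom x y : zmodType := (hom x.1 y.1 * hom x.2 y.2)%type.
Let pid x : phom x x := (idm x.1, idm x.2).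
Let pcmp x y z (g : phom y z) (f : phom x y) : phom x z :=
  (g.1 ∘ f.1, g.2 ∘ f.2).

Fact prod_cmpA x y z t (h : phom z t) (g : phom y z) (f : phom x y) :
  pcmp h (pcmp g f) = pcmp (pcmp h g) f.
Proof. by rewrite /pcmp /= !cmpA. Qed.

Fact prod_cmp1m x y (f : phom x y) : pcmp (pid y) f = f.
Proof. by case: f => f1 f2; rewrite /pcmp /= !cmp1m. Qed.

Fact prod_cmpm1 x y (f : phom x y) : pcmp f (pid x) = f.
Proof. by case: f => f1 f2; rewrite /pcmp /= !cmpm1. Qed.

Fact prod_cmpDl x y z (g g' : phom y z) (f : phom x y) :
  pcmp (g + g') f = pcmp g f + pcmp g' f.
Proof. by rewrite /pcmp /= !cmpDl. Qed.

Fact prod_cmpDr x y z (g : phom y z) (f f' : phom x y) :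
  pcmp g (f + f') = pcmp g f + pcmp g f'.
Proof. by rewrite /pcmp /= !cmpDr. Qed.

Definition prod_preadd : preadd :=
  Preadd prod_cmpA prod_cmp1m prod_cmpm1 prod_cmpDl prod_cmpDr.

End Pre.

Variables A B : kadd.
Let P := prod_preadd A B.
Let zP : P := (zob, zob).
Let bP (x y : P) : P := (x.1 ⊕ y.1, x.2 ⊕ y.2).
Let in1P (x y : P) : hom x (bP x y) := (in1, in1).
Let in2P (x y : P) : hom y (bP x y) := (in2, in2).
Let pr1P (x y : P) : hom (bP x y) x := (pr1, pr1).
Let pr2P (x y : P) : hom (bP x y) y := (pr2, pr2).
Let kerP (x y : P) (f : hom x y) : P := (ker f.1, ker f.2).
Let kiP (x y : P) (f : hom x y) : hom (kerP f) x := (kin f.1, kin f.2).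

Fact prod_zobP : idm zP = 0.
Proof. by rewrite /idm /= !zobP. Qed.

Fact prod_pr1_in1 x y : pr1P x y ∘ in1P x y = idm x.
Proof. by rewrite /cmp /idm /= !pr1_in1. Qed.

Fact prod_pr2_in2 x y : pr2P x y ∘ in2P x y = idm y.
Proof. by rewrite /cmp /idm /= !pr2_in2. Qed.

Fact prod_pr2_in1 x y : pr2P x y ∘ in1P x y = 0.
Proof. by rewrite /cmp /= !pr2_in1. Qed.

Fact prod_pr1_in2 x y : pr1P x y ∘ in2P x y = 0.
Proof. by rewrite /cmp /= !pr1_in2. Qed.

Fact prod_bipP x y : in1P x y ∘ pr1P x y + in2P x y ∘ pr2P x y = idm (bP x y).
Proof. by rewrite -[RHS]/(idm _, idm _) -!bipP. Qed.

Fact prod_kinP (x y : P) (f : hom x y) : is_kernel f (kiP f).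
Proof.
case: f => f1 f2; split; first by rewrite /cmp /= !kinK.
move=> w [g1 g2] [e1 e2]; exists (klift f1 g1, klift f2 g2); split.
  by rewrite /cmp /= !kin_lift.
by move=> [u1 u2] [k1 k2]; congr (_, _); apply: kin_mono; rewrite kin_lift.
Qed.

Definition prodc : kadd :=
  Kadd prod_zobP prod_pr1_in1 prod_pr2_in2 prod_pr2_in1 prod_pr1_in2 prod_bipP
    prod_kinP.

Definition fstf : functor prodc A :=
  @Functor prodc A (fun x => x.1) (fun x y f => f.1) (fun=> erefl)
    (fun _ _ _ _ _ => erefl).

Definition sndf : functor prodc B :=
  @Functor prodc B (fun x => x.2) (fun x y f => f.2) (fun=> erefl)
    (fun _ _ _ _ _ => erefl).

Section Pairing.
Variables (D : preadd) (F : functor D A) (G : functor D B).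

Fact fpair1 x : (fmor F (idm x), fmor G (idm x)) = idm ((F x, G x) : prodc).
Proof. by rewrite !fmor1. Qed.

Fact fpairM x y z (g : hom y z) (f : hom x y) :
  (fmor F (g ∘ f), fmor G (g ∘ f)) =
  (fmor F g ∘ fmor F f, fmor G g ∘ fmor G f).
Proof. by rewrite !fmorM. Qed.

Definition fpair : functor D prodc :=
  @Functor D prodc (fun x => (F x, G x)) (fun x y f => (fmor F f, fmor G f))
    fpair1 fpairM.

End Pairing.

End Product.

Section DirectSum.
Variable A : kadd.

Definition diagf : functor A (prodc A A) := fpair (idf A) (idf A).

Definition sumf : functor (prodc A A) A :=
  @Functor (prodc A A) A (fun x => x.1 ⊕ x.2) (fun x y f => bimap f.1 f.2)
    (fun x => bimap1 x.1 x.2) (fun _ _ _ g f => bimap_cmp g.1 g.2 f.1 f.2).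

Definition addf (X : A) : functor A A := fcomp sumf (fpair (constf A X) (idf A)).

Fact addf_mapP (X Y : A) (g : hom X Y) V W (f : hom V W) :
  bimap g (idm W) ∘ fmor (addf X) f = fmor (addf Y) f ∘ bimap g (idm V).
Proof. by rewrite -!bimap_cmp !cmp1m !cmpm1. Qed.

End DirectSum.

Section PointwiseKernel.
Variables (B : preadd) (C : kadd).
Implicit Types F G : functor B C.

Section Kerf.
Variables (F G : functor B C) (a : F ⟹ G).
Let kob x := ker (a x).
Let kmor x y (f : hom x y) : hom (kob x) (kob y) :=
  klift (a y) (fmor F f ∘ kin (a x)).

Fact kerf_kin x y (f : hom x y) : kin (a y) ∘ kmor f = fmor F f ∘ kin (a x).
Proof. by rewrite kin_lift // cmpA ntP -cmpA kinK cmpm0. Qed.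

Fact kerf1 x : kmor (idm x) = idm (kob x).
Proof. by apply: kin_mono; rewrite kerf_kin fmor1 cmp1m cmpm1. Qed.

Fact kerfM x y z (g : hom y z) (f : hom x y) : kmor (g ∘ f) = kmor g ∘ kmor f.
Proof.
by apply: kin_mono; rewrite kerf_kin cmpA kerf_kin -cmpA kerf_kin fmorM cmpA.
Qed.

Definition kerf : functor B C := @Functor B C kob kmor kerf1 kerfM.

Definition kinf : kerf ⟹ F := @Nattr B C kerf F (fun x => kin (a x)) kerf_kin.

End Kerf.

Section KerfMap.
Variables (F G F' G' : functor B C) (a : F ⟹ G) (a' : F' ⟹ G') (b : F ⟹ F').
Hypothesis ab0 : forall x, a' x ∘ (b x ∘ kin (a x)) = 0.

Fact kerf_mapP x y (f : hom x y) :
  klift (a' y) (b y ∘ kin (a y)) ∘ fmor (kerf a) f =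
  fmor (kerf a') f ∘ klift (a' x) (b x ∘ kin (a x)).
Proof.
apply: kin_mono; rewrite cmpA (kin_lift (ab0 y)) -cmpA kerf_kin cmpA ntP.
by rewrite [RHS]cmpA kerf_kin -!cmpA (kin_lift (ab0 x)).
Qed.

Definition kerf_map : kerf a ⟹ kerf a' :=
  @Nattr B C (kerf a) (kerf a') (fun x => klift (a' x) (b x ∘ kin (a x)))
    kerf_mapP.

End KerfMap.

End PointwiseKernel.

Section CrossEffects.
Variables B C : kadd.
Implicit Types F G : functor B C.

Fact to_zeroP F x y (f : hom x y) :
  fmor F (0 : hom y zob) ∘ fmor F f = idm (F zob) ∘ fmor F (0 : hom x zob).
Proof. by rewrite cmp1m -fmorM cmp0m. Qed.

Definition to_zero F : F ⟹ constf B (F zob) :=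
  @Nattr B C F (constf B (F zob)) (fun X => fmor F (0 : hom X zob)) (to_zeroP F).

Definition cr1 F : functor B C := kerf (to_zero F).

Fact cr1_map_ker F G (a : F ⟹ G) x :
  to_zero G x ∘ (a x ∘ kin (to_zero F x)) = 0.
Proof. by rewrite cmpA /= -ntP -cmpA kinK cmpm0. Qed.

Definition cr1_map F G (a : F ⟹ G) : cr1 F ⟹ cr1 G := kerf_map (cr1_map_ker a).

Definition cr1_sum F : functor (prodc B B) C :=
  fcomp (sumf C) (fpair (fcomp (cr1 F) (fstf B B)) (fcomp (cr1 F) (sndf B B))).

Fact cr2_projP F (x y : prodc B B) (f : hom x y) :
  bpair (fmor (cr1 F) pr1) (fmor (cr1 F) pr2) ∘ fmor (cr1 F) (bimap f.1 f.2) =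
  fmor (cr1_sum F) f ∘ bpair (fmor (cr1 F) pr1) (fmor (cr1 F) pr2).
Proof. by rewrite pair_cmp bimap_pair -!fmorM pr1_bimap pr2_bimap. Qed.

Definition cr2_proj F : fcomp (cr1 F) (sumf B) ⟹ cr1_sum F :=
  @Nattr _ _ (fcomp (cr1 F) (sumf B)) (cr1_sum F)
    (fun=> bpair (fmor (cr1 F) pr1) (fmor (cr1 F) pr2)) (@cr2_projP F).

Definition cr2 F : functor (prodc B B) C := kerf (cr2_proj F).

Fact cr2_map_ker F G (a : F ⟹ G) x :
  cr2_proj G x ∘ (ntwhisker (cr1_map a) (sumf B) x ∘ kin (cr2_proj F x)) = 0.
Proof.
have e : cr2_proj G x ∘ cr1_map a (sumf B x) =
    bimap (cr1_map a x.1) (cr1_map a x.2) ∘ cr2_proj F x.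
  rewrite [LHS]pair_cmp [RHS]bimap_pair.
  by congr bpair; apply/esym/(ntP (cr1_map a)).
by rewrite cmpA [X in X ∘ _]e -cmpA kinK cmpm0.
Qed.

Definition cr2_map F G (a : F ⟹ G) : cr2 F ⟹ cr2 G := kerf_map (cr2_map_ker a).

Definition C2 F : functor B C := fcomp (cr2 F) (diagf B).

Definition C2_map F G (a : F ⟹ G) : C2 F ⟹ C2 G := ntwhisker (cr2_map a) (diagf B).

Fact rho1P F x y (f : hom x y) :
  fmor (cr1 F) (bfold y) ∘ kin (cr2_proj F (y, y)) ∘ fmor (C2 F) f =
  fmor (cr1 F) f ∘ (fmor (cr1 F) (bfold x) ∘ kin (cr2_proj F (x, x))).
Proof.
have e := kerf_kin (cr2_proj F) ((f, f) : hom ((x, x) : prodc B B) (y, y)).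
rewrite -cmpA [X in _ ∘ X]e !cmpA; congr (_ ∘ _).
by rewrite -[RHS]fmorM fold_nat fmorM.
Qed.

Definition rho1 F : C2 F ⟹ cr1 F :=
  @Nattr B C (C2 F) (cr1 F)
    (fun X => fmor (cr1 F) (bfold X) ∘ kin (cr2_proj F (X, X))) (@rho1P F).

Definition epsilon F : C2 F ⟹ F := ntcomp (kinf (to_zero F)) (rho1 F).

End CrossEffects.

Section Complexes.
Variable A : preadd.

Record cpx := Cpx {
  cob :> nat -> A;
  cd : forall n, hom (cob n.+1) (cob n);
  cdd : forall n, cd n ∘ cd n.+1 = 0 }.

Record chmap (C D : cpx) := Chmap {
  chm :> forall n, hom (C n) (D n);
  chmP : forall n, cd D n ∘ chm n.+1 = chm n ∘ cd C n }.

Lemma chmap_eq (C D : cpx) (f g : chmap C D) : (forall n, f n = g n) -> f = g.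
Proof.
case: f g => [f fP] [g gP] /= e.
have e' : f = g by apply: functional_extensionality_dep.
by case: _ / e' gP => gP; congr Chmap; apply: Prop_irrelevance.
Qed.

HB.instance Definition _ (C D : cpx) := gen_eqMixin (chmap C D).
HB.instance Definition _ (C D : cpx) := gen_choiceMixin (chmap C D).

Section Zmod.
Variables C D : cpx.
Implicit Types f g h : chmap C D.

Fact chmap0P n : cd D n ∘ (0 : hom (C n.+1) (D n.+1)) = 0 ∘ cd C n.
Proof. by rewrite cmpm0 cmp0m. Qed.

Fact chmapNP f n : cd D n ∘ - f n.+1 = - f n ∘ cd C n.
Proof. by rewrite cmpmN cmpNm chmP. Qed.

Fact chmapDP f g n : cd D n ∘ (f n.+1 + g n.+1) = (f n + g n) ∘ cd C n.
Proof. by rewrite cmpDr cmpDl !chmP. Qed.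

Let ch0 : chmap C D := Chmap chmap0P.
Let chN f : chmap C D := Chmap (chmapNP f).
Let chD f g : chmap C D := Chmap (chmapDP f g).

Fact chmap_addA : associative chD.
Proof. by move=> f g h; apply: chmap_eq => n; apply: addrA. Qed.
Fact chmap_addC : commutative chD.
Proof. by move=> f g; apply: chmap_eq => n; apply: addrC. Qed.
Fact chmap_add0 : left_id ch0 chD.
Proof. by move=> f; apply: chmap_eq => n; apply: add0r. Qed.
Fact chmap_addN : left_inverse ch0 chN chD.
Proof. by move=> f; apply: chmap_eq => n; apply: addNr. Qed.

HB.instance Definition _ :=
  GRing.isZmodule.Build (chmap C D) chmap_addA chmap_addC chmap_add0 chmap_addN.

End Zmod.

Fact chid_P (C : cpx) n : cd C n ∘ idm (C n.+1) = idm (C n) ∘ cd C n.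
Proof. by rewrite cmpm1 cmp1m. Qed.

Definition chid (C : cpx) : chmap C C := Chmap (@chid_P C).

Fact chcmpP (C D E : cpx) (g : chmap D E) (f : chmap C D) n :
  cd E n ∘ (g n.+1 ∘ f n.+1) = g n ∘ f n ∘ cd C n.
Proof. by rewrite cmpA chmP -!cmpA chmP. Qed.

Definition chcmp (C D E : cpx) (g : chmap D E) (f : chmap C D) : chmap C E :=
  Chmap (chcmpP g f).

Fact chcmpA (C D E K : cpx) (h : chmap E K) (g : chmap D E) (f : chmap C D) :
  chcmp h (chcmp g f) = chcmp (chcmp h g) f.
Proof. by apply: chmap_eq => n; apply: cmpA. Qed.
Fact chcmp1m (C D : cpx) (f : chmap C D) : chcmp (chid D) f = f.
Proof. by apply: chmap_eq => n; apply: cmp1m. Qed.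
Fact chcmpm1 (C D : cpx) (f : chmap C D) : chcmp f (chid C) = f.
Proof. by apply: chmap_eq => n; apply: cmpm1. Qed.
Fact chcmpDl (C D E : cpx) (g g' : chmap D E) (f : chmap C D) :
  chcmp (g + g') f = chcmp g f + chcmp g' f.
Proof. by apply: chmap_eq => n; apply: cmpDl. Qed.
Fact chcmpDr (C D E : cpx) (g : chmap D E) (f f' : chmap C D) :
  chcmp g (f + f') = chcmp g f + chcmp g f'.
Proof. by apply: chmap_eq => n; apply: cmpDr. Qed.

Definition Ch_preadd : preadd :=
  @Preadd cpx (fun C D => chmap C D : zmodType) chid chcmp
    chcmpA chcmp1m chcmpm1 chcmpDl chcmpDr.

Definition homotopic (C D : cpx) (f g : chmap C D) : Prop :=
  exists s : forall n, hom (C n) (D n.+1),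
    f 0%N - g 0%N = cd D 0 ∘ s 0%N /\
    forall n, f n.+1 - g n.+1 = cd D n.+1 ∘ s n.+1 + s n ∘ cd C n.

Definition homotopy_equivalent (C D : cpx) : Prop :=
  exists (f : chmap C D) (g : chmap D C),
    homotopic (chcmp g f) (chid C) /\ homotopic (chcmp f g) (chid D).

End Complexes.

Section ChKadd.
Variable A : kadd.
Implicit Types C D E : cpx A.

Fact chzob_dd (n : nat) : (0 : hom (zob : A) zob) ∘ (0 : hom (zob : A) zob) = 0.
Proof. exact: cmp0m. Qed.

Definition chzob : cpx A := @Cpx A (fun=> zob) (fun=> 0) chzob_dd.

Fact chzobP : idm (chzob : Ch_preadd A) = 0.
Proof. by apply: chmap_eq => n; apply: zobP. Qed.

Fact chbip_dd C D n :
  bimap (cd C n) (cd D n) ∘ bimap (cd C n.+1) (cd D n.+1) = 0.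
Proof. by rewrite -bimap_cmp !cdd /bimap !cmp0m /bpair !cmpm0 addr0. Qed.

Definition chbip C D : cpx A :=
  @Cpx A (fun n => C n ⊕ D n) (fun n => bimap (cd C n) (cd D n))
    (@chbip_dd C D).

Fact chin1P C D n : cd (chbip C D) n ∘ in1 = in1 ∘ cd C n.
Proof. by rewrite /= cmpDl -!cmpA pr1_in1 pr2_in1 !cmpm0 cmpm1 addr0. Qed.
Fact chin2P C D n : cd (chbip C D) n ∘ in2 = in2 ∘ cd D n.
Proof. by rewrite /= cmpDl -!cmpA pr1_in2 pr2_in2 !cmpm0 cmpm1 add0r. Qed.
Fact chpr1P C D n : cd C n ∘ pr1 = pr1 ∘ cd (chbip C D) n.
Proof. by rewrite pr1_bimap. Qed.
Fact chpr2P C D n : cd D n ∘ pr2 = pr2 ∘ cd (chbip C D) n.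
Proof. by rewrite pr2_bimap. Qed.

Let chin1 C D : @hom (Ch_preadd A) C (chbip C D) :=
  @Chmap A C (chbip C D) (fun=> in1) (@chin1P C D).
Let chin2 C D : @hom (Ch_preadd A) D (chbip C D) :=
  @Chmap A D (chbip C D) (fun=> in2) (@chin2P C D).
Let chpr1 C D : @hom (Ch_preadd A) (chbip C D) C :=
  @Chmap A (chbip C D) C (fun=> pr1) (@chpr1P C D).
Let chpr2 C D : @hom (Ch_preadd A) (chbip C D) D :=
  @Chmap A (chbip C D) D (fun=> pr2) (@chpr2P C D).

Fact chpr1_in1 C D : chpr1 C D ∘ chin1 C D = idm (C : Ch_preadd A).
Proof. by apply: chmap_eq => n; apply: pr1_in1. Qed.
Fact chpr2_in2 C D : chpr2 C D ∘ chin2 C D = idm (D : Ch_preadd A).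
Proof. by apply: chmap_eq => n; apply: pr2_in2. Qed.
Fact chpr2_in1 C D : chpr2 C D ∘ chin1 C D = 0.
Proof. by apply: chmap_eq => n; apply: pr2_in1. Qed.
Fact chpr1_in2 C D : chpr1 C D ∘ chin2 C D = 0.
Proof. by apply: chmap_eq => n; apply: pr1_in2. Qed.
Fact chbipP C D :
  chin1 C D ∘ chpr1 C D + chin2 C D ∘ chpr2 C D = idm (chbip C D : Ch_preadd A).
Proof. by apply: chmap_eq => n; apply: bipP. Qed.

Section Kernel.
Variables (C D : cpx A) (f : chmap C D).
Let kd n : hom (ker (f n.+1)) (ker (f n)) :=
  klift (f n) (cd C n ∘ kin (f n.+1)).

Fact chker_kin n : kin (f n) ∘ kd n = cd C n ∘ kin (f n.+1).
Proof. by rewrite kin_lift // cmpA -chmP -cmpA kinK cmpm0. Qed.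

Fact chker_dd n : kd n ∘ kd n.+1 = 0.
Proof.
apply: kin_mono; rewrite cmpA chker_kin -cmpA chker_kin cmpA cdd.
by rewrite cmp0m cmpm0.
Qed.

Definition chker : cpx A := @Cpx A (fun n => ker (f n)) kd chker_dd.

Definition chkin : @hom (Ch_preadd A) chker C :=
  @Chmap A chker C (fun n => kin (f n)) (fun n => esym (chker_kin n)).

Fact chkinP : is_kernel (f : @hom (Ch_preadd A) C D) chkin.
Proof.
split; first by apply: chmap_eq => n; apply: kinK.
move=> W g fg0.
have fg n : f n ∘ (g : chmap W C) n = 0.
  exact: (congr1 (fun h : chmap W D => h n) fg0).
have uP n : cd chker n ∘ klift (f n.+1) ((g : chmap W C) n.+1) =
    klift (f n) ((g : chmap W C) n) ∘ cd (W : cpx A) n.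
  apply: kin_mono; rewrite !cmpA kin_lift // chker_kin -cmpA kin_lift //.
  exact: chmP.
exists (Chmap uP); split; first by apply: chmap_eq => n; apply: kin_lift.
move=> v vg; apply: chmap_eq => n; apply: (@kin_mono _ _ _ (f n)).
by rewrite /= kin_lift // -vg.
Qed.

End Kernel.

Definition Ch : kadd :=
  @Kadd (Ch_preadd A) chzob chzobP chbip chin1 chin2 chpr1 chpr2
    chpr1_in1 chpr2_in2 chpr2_in1 chpr1_in2 chbipP chker chkin chkinP.

End ChKadd.

Section C2Theory.
Variables B C : kadd.
Implicit Types F G H : functor B C.

Definition C2in F (X : B) : hom (C2 F X) (F (X ⊕ X)) :=
  kin (to_zero F (X ⊕ X)) ∘ kin (cr2_proj F (X, X)).

Lemma C2in_mono F X : mono (C2in F X).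
Proof.
by move=> w u v e; do 2!apply: kin_mono; rewrite !cmpA.
Qed.

Lemma cr1_mapE F G (a : F ⟹ G) X :
  kin (to_zero G X) ∘ cr1_map a X = a X ∘ kin (to_zero F X).
Proof. by rewrite kin_lift //; apply: cr1_map_ker. Qed.

Lemma C2_mapE F G (a : F ⟹ G) X :
  C2in G X ∘ C2_map a X = a (X ⊕ X) ∘ C2in F X.
Proof.
have e : kin (cr2_proj G (X, X)) ∘ C2_map a X =
    cr1_map a (X ⊕ X) ∘ kin (cr2_proj F (X, X)).
  exact/kin_lift/(cr2_map_ker a (X, X)).
by rewrite -cmpA [X in _ ∘ X]e [LHS]cmpA [X in X ∘ _]cr1_mapE -cmpA.
Qed.

Lemma C2_map1 F (a : F ⟹ F) X :
  (forall Y, a Y = idm (F Y)) -> C2_map a X = idm (C2 F X).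
Proof. by move=> a1; apply: C2in_mono; rewrite C2_mapE a1 cmp1m cmpm1. Qed.

Lemma C2_mapM F G H (b : G ⟹ H) (a : F ⟹ G) (c : F ⟹ H) X :
  (forall Y, c Y = b Y ∘ a Y) -> C2_map c X = C2_map b X ∘ C2_map a X.
Proof.
move=> cE; apply: C2in_mono.
by rewrite C2_mapE cE [RHS]cmpA (C2_mapE b) -[RHS]cmpA (C2_mapE a) cmpA.
Qed.

Lemma C2_map_ext F G (a b : F ⟹ G) X :
  (forall Y, a Y = b Y) -> C2_map a X = C2_map b X.
Proof. by move=> e; apply: C2in_mono; rewrite !C2_mapE e. Qed.

Lemma C2_map_comm F G G' H (b : G ⟹ H) (a : F ⟹ G) (b' : G' ⟹ H) (a' : F ⟹ G') X :
  (forall Y, b Y ∘ a Y = b' Y ∘ a' Y) ->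
  C2_map b X ∘ C2_map a X = C2_map b' X ∘ C2_map a' X.
Proof.
move=> e; rewrite -(C2_mapM (c := ntcomp b a)) //.
exact: C2_mapM.
Qed.

Lemma C2_map_sum F G n (b : 'I_n -> F ⟹ G) (s : 'I_n -> int) (c : F ⟹ G) X :
  (forall Y, c Y = \sum_i b i Y *~ s i) ->
  C2_map c X = \sum_i C2_map (b i) X *~ s i.
Proof.
move=> cE; apply: C2in_mono; rewrite C2_mapE cE cmp_suml cmp_sumr.
by apply: eq_bigr => i _; rewrite cmpMzm cmpmMz C2_mapE.
Qed.

Lemma cr1_map1 F (a : F ⟹ F) X :
  (forall Y, a Y = idm (F Y)) -> cr1_map a X = idm (cr1 F X).
Proof. by move=> a1; apply: kin_mono; rewrite cr1_mapE a1 cmp1m cmpm1. Qed.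

Lemma cr1_mapM F G H (b : G ⟹ H) (a : F ⟹ G) (c : F ⟹ H) X :
  (forall Y, c Y = b Y ∘ a Y) -> cr1_map c X = cr1_map b X ∘ cr1_map a X.
Proof.
move=> cE; apply: kin_mono.
by rewrite cr1_mapE cE [RHS]cmpA (cr1_mapE b) -[RHS]cmpA (cr1_mapE a) cmpA.
Qed.

Lemma epsilonE F X : epsilon F X = fmor F (bfold X) ∘ C2in F X.
Proof.
rewrite [LHS]cmpA (kerf_kin (to_zero F) (bfold X)).
by rewrite -[LHS]cmpA.
Qed.

Lemma rho1E F X : kin (to_zero F X) ∘ rho1 F X = epsilon F X.
Proof. by []. Qed.

Lemma epsilon_nat F G (a : F ⟹ G) X :
  epsilon G X ∘ C2_map a X = a X ∘ epsilon F X.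
Proof. by rewrite !epsilonE -cmpA C2_mapE !cmpA ntP. Qed.

Lemma rho1_nat F G (a : F ⟹ G) X :
  rho1 G X ∘ C2_map a X = cr1_map a X ∘ rho1 F X.
Proof.
apply: kin_mono; rewrite cmpA rho1E epsilon_nat [RHS]cmpA cr1_mapE.
by rewrite -[RHS]cmpA rho1E.
Qed.

Lemma rho1_C2 F X : rho1 F X ∘ C2_map (epsilon F) X = rho1 F X ∘ epsilon (C2 F) X.
Proof.
apply: kin_mono; rewrite [LHS]cmpA [RHS]cmpA rho1E.
exact: epsilon_nat.
Qed.

End C2Theory.

Section D1.
Variables B C : kadd.
Implicit Types F G H : functor B C.

Definition C2n F k : functor B C := iter k (@C2 B C) F.

Fixpoint C2n_map F G (a : F ⟹ G) k : C2n F k ⟹ C2n G k :=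
  if k is k'.+1 then C2_map (C2n_map a k') else a.

(* [face F k i] is [C2^i epsilon], applied to [C2^(k - i) F]; it is only
   meaningful for [i <= k]. *)
Fixpoint face F k : nat -> (C2n F k.+1 ⟹ C2n F k) :=
  match k with
  | 0 => fun=> epsilon F
  | k'.+1 => fun i => if i is i'.+1 then C2_map (face F k' i')
                      else epsilon (C2n F k'.+1)
  end.

Definition D1c_ob F k : functor B C := if k is _.+1 then C2n F k else cr1 F.

Definition D1c_map_ob F G (a : F ⟹ G) k : D1c_ob F k ⟹ D1c_ob G k :=
  if k is k'.+1 then C2n_map a k'.+1 else cr1_map a.

Definition D1c_bd F k (X : B) : hom (D1c_ob F k.+1 X) (D1c_ob F k X) :=
  match k with
  | 0 => rho1 F X
  | k'.+1 => \sum_(i < k'.+2) face F k'.+1 i X *~ (-1) ^+ i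
  end.

Lemma D1c_bd_nat F k X Y (f : hom X Y) :
  D1c_bd F k Y ∘ fmor (D1c_ob F k.+1) f = fmor (D1c_ob F k) f ∘ D1c_bd F k X.
Proof.
case: k => [|k]; first exact: ntP.
rewrite /D1c_bd cmp_suml cmp_sumr; apply: eq_bigr => i _.
by rewrite cmpMzm cmpmMz; congr (_ *~ _); apply: (ntP (face F k.+1 i)).
Qed.

Lemma face_nat F G (a : F ⟹ G) k i X :
  (i <= k)%N -> face G k i X ∘ C2n_map a k.+1 X = C2n_map a k X ∘ face F k i X.
Proof.
elim: k i X => [|k IH] [|i] X //; try by move=> _; apply: epsilon_nat.
by move=> ik; apply: C2_map_comm => Y; apply: IH.
Qed.

Lemma D1c_map_bd F G (a : F ⟹ G) k X :
  D1c_bd G k X ∘ D1c_map_ob a k.+1 X = D1c_map_ob a k X ∘ D1c_bd F k X.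
Proof.
case: k => [|k]; first exact: rho1_nat.
rewrite /D1c_bd cmp_suml cmp_sumr; apply: eq_bigr => i _.
rewrite cmpMzm cmpmMz; congr (_ *~ _).
by apply: (face_nat a); rewrite -ltnS.
Qed.

Let bd F k X : hom (C2n F k.+1 X) (C2n F k X) :=
  \sum_(i < k.+1) face F k i X *~ (-1) ^+ i.

Lemma bd_nat F k X Y (f : hom X Y) :
  bd F k Y ∘ fmor (C2n F k.+1) f = fmor (C2n F k) f ∘ bd F k X.
Proof.
rewrite /bd cmp_suml cmp_sumr; apply: eq_bigr => i _.
by rewrite cmpMzm cmpmMz; congr (_ *~ _); apply: (ntP (face F k i)).
Qed.

Let bdn F k : C2n F k.+1 ⟹ C2n F k := Nattr (@bd_nat F k).

Lemma bdS F k X : bd F k.+1 X = epsilon (C2n F k.+1) X - C2_map (bdn F k) X.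
Proof.
rewrite /bd big_ord_recl expr0 mulr1z; congr (_ + _).
rewrite (@C2_map_sum _ _ _ _ k.+1 (fun i => face F k i) (fun i => (-1) ^+ i) (bdn F k)) //.
by rewrite -sumrN; apply: eq_bigr => i _; rewrite exprS mulN1r mulrNz.
Qed.

Lemma bd_bd F k X : bd F k X ∘ bd F k.+1 X = 0.
Proof.
elim: k X => [|k IH] X; [rewrite [bd F 1 X]bdS | rewrite [bd F k.+2 X]bdS].
  rewrite cmpDr cmpmN; apply/eqP; rewrite subr_eq0; apply/eqP.
  have bd0 Y : bd F 0 Y = epsilon F Y.
    by rewrite /bd big_ord1 expr0 mulr1z.
  rewrite -[LHS]/(bdn F 0 X ∘ epsilon (C2n F 1) X) -(epsilon_nat (bdn F 0)).
  by rewrite bd0.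
have e1 : bd F k.+1 X ∘ epsilon (C2n F k.+2) X =
    epsilon (C2n F k.+1) X ∘ C2_map (bdn F k.+1) X.
  exact/esym/(epsilon_nat (bdn F k.+1)).
have e2 : epsilon (C2n F k.+1) X - bd F k.+1 X = C2_map (bdn F k) X.
  by rewrite bdS opprB addrC subrK.
rewrite cmpDr cmpmN e1 -cmpNm -cmpDl e2.
have bb0 Y : bdn F k Y ∘ bdn F k.+1 Y = 0 by exact: IH.
apply: C2in_mono; rewrite cmpA (C2_mapE (bdn F k)) -cmpA (C2_mapE (bdn F k.+1)).
by rewrite cmpA bb0 cmp0m cmpm0.
Qed.

Lemma D1c_dd F X k : D1c_bd F k X ∘ D1c_bd F k.+1 X = 0.
Proof.
case: k => [|k]; last exact: (bd_bd F k.+1).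
have e : bd F 1 X = epsilon (C2 F) X - C2_map (epsilon F) X.
  rewrite bdS; congr (_ - _); apply: C2_map_ext => Y.
  by rewrite -[LHS]/(bd F 0 Y) /bd big_ord1 expr0 mulr1z.
rewrite -[LHS]/(rho1 F X ∘ bd F 1 X) e cmpDr cmpmN rho1_C2.
exact: subrr.
Qed.

Definition D1c_cpx F (X : B) : cpx C :=
  @Cpx C (fun k => D1c_ob F k X) (fun k => D1c_bd F k X) (D1c_dd F X).

Definition D1c_mor F X Y (f : hom X Y) : @hom (Ch C) (D1c_cpx F X) (D1c_cpx F Y) :=
  @Chmap C (D1c_cpx F X) (D1c_cpx F Y) (fun k => fmor (D1c_ob F k) f)
    (fun k => D1c_bd_nat F k f).

Fact D1c_mor1 F X : D1c_mor F (idm X) = idm (D1c_cpx F X : Ch C).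
Proof. by apply: chmap_eq => k; apply: fmor1. Qed.

Fact D1c_morM F X Y Z (g : hom Y Z) (f : hom X Y) :
  D1c_mor F (g ∘ f) = D1c_mor F g ∘ D1c_mor F f.
Proof. by apply: chmap_eq => k; apply: fmorM. Qed.

Definition D1c F : functor B (Ch C) :=
  @Functor B (Ch C) (D1c_cpx F) (@D1c_mor F) (@D1c_mor1 F) (@D1c_morM F).

Definition D1c_map F G (a : F ⟹ G) (X : B) : hom (D1c F X) (D1c G X) :=
  @Chmap C (D1c_cpx F X) (D1c_cpx G X) (fun k => D1c_map_ob a k X)
    (fun k => D1c_map_bd a k X).

Lemma D1c_map_nat F G (a : F ⟹ G) X Y (f : hom X Y) :
  D1c_map a Y ∘ fmor (D1c F) f = fmor (D1c G) f ∘ D1c_map a X.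
Proof. by apply: chmap_eq => k; apply: (ntP (D1c_map_ob a k)). Qed.

Lemma D1c_map1 F (a : F ⟹ F) X :
  (forall Y, a Y = idm (F Y)) -> D1c_map a X = idm (D1c F X).
Proof.
move=> a1; apply: chmap_eq => -[|k]; [exact: cr1_map1 | apply: C2_map1].
by elim: k => [|k IH] Y; [exact: a1 | apply: C2_map1].
Qed.

Lemma D1c_mapM F G H (b : G ⟹ H) (a : F ⟹ G) (c : F ⟹ H) X :
  (forall Y, c Y = b Y ∘ a Y) -> D1c_map c X = D1c_map b X ∘ D1c_map a X.
Proof.
move=> cE; apply: chmap_eq => -[|k]; [exact: cr1_mapM | apply: C2_mapM].
by elim: k => [|k IH] Y; [exact: cE | apply: C2_mapM].
Qed.

End D1.

Section Totalization.
Variable A : kadd.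
Implicit Types C D E : cpx (Ch A).

Definition bob C p q : A := (C p : cpx A) q.

Definition bh C p q : hom (bob C p.+1 q) (bob C p q) :=
  (cd C p : chmap (C p.+1) (C p)) q.

Definition bv C p q : hom (bob C p q.+1) (bob C p q) := cd (C p : cpx A) q.

Definition bmor C D (f : chmap C D) p q : hom (bob C p q) (bob D p q) :=
  (f p : chmap (C p) (D p)) q.

Lemma bh_bh C p q : bh C p q ∘ bh C p.+1 q = 0.
Proof. exact: (congr1 (fun h : chmap (C p.+2) (C p) => h q) (cdd C p)). Qed.

Lemma bv_bv C p q : bv C p q ∘ bv C p q.+1 = 0.
Proof. exact: cdd. Qed.

Lemma bv_bh C p q : bv C p q ∘ bh C p q.+1 = bh C p q ∘ bv C p.+1 q.
Proof. exact: chmP. Qed.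

Lemma bh_mor C D (f : chmap C D) p q :
  bh D p q ∘ bmor f p.+1 q = bmor f p q ∘ bh C p q.
Proof. exact: (congr1 (fun h : chmap (C p.+1) (D p) => h q) (chmP f p)). Qed.

Lemma bv_mor C D (f : chmap C D) p q :
  bv D p q ∘ bmor f p q.+1 = bmor f p q ∘ bv C p q.
Proof. exact: chmP. Qed.

Definition shift C : cpx (Ch A) :=
  @Cpx (Ch A) (fun p => C p.+1) (fun p => cd C p.+1) (fun p => cdd C p.+1).

Definition shift_map C D (f : chmap C D) : chmap (shift C) (shift D) :=
  @Chmap (Ch A) (shift C) (shift D) (fun p => f p.+1) (fun p => chmP f p.+1).

(* [tot_ob C n] is the direct sum of the [bob C p q] with [p + q = n], bracketed
   as [bob C 0 n ⊕ (bob C 1 (n - 1) ⊕ (... ⊕ bob C n 0))]. *)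
Fixpoint tot_ob C n : A :=
  match n with
  | 0 => bob C 0 0
  | n'.+1 => bob C 0 n'.+1 ⊕ tot_ob (shift C) n'
  end.

Definition tot_hd C n : hom (tot_ob C n) (bob C 0 n) :=
  match n with 0 => idm _ | n'.+1 => pr1 end.

(* [tot_d 0 C] is the differential of the total complex: on the summand
   [bob C p q] it is [bh C (p - 1) q + (-1) ^ p bv C p (q - 1)]. In general [s]
   counts the columns already removed by [shift], which shifts the sign to
   [(-1) ^ (s + p)]. *)
Fixpoint tot_d (s : nat) C n : hom (tot_ob C n.+1) (tot_ob C n) :=
  match n with
  | 0 => (bv C 0 0 *~ (-1) ^+ s) ∘ pr1 + bh C 0 0 ∘ pr2
  | n'.+1 =>
      bpair ((bv C 0 n'.+1 *~ (-1) ^+ s) ∘ pr1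
              + bh C 0 n'.+1 ∘ tot_hd (shift C) n'.+1 ∘ pr2)
            (tot_d s.+1 (shift C) n' ∘ pr2)
  end.

Fixpoint tot_mor C D (f : chmap C D) n : hom (tot_ob C n) (tot_ob D n) :=
  match n with
  | 0 => bmor f 0 0
  | n'.+1 => bimap (bmor f 0 n'.+1) (tot_mor (shift_map f) n')
  end.

Lemma tot_hd_d s C n :
  tot_hd C n ∘ tot_d s C n =
  (bv C 0 n *~ (-1) ^+ s) ∘ pr1 + bh C 0 n ∘ tot_hd (shift C) n ∘ pr2.
Proof.
case: n => [|n] /=; first by rewrite cmp1m cmpm1.
exact: pr1_pair.
Qed.

Lemma tot_dd s C n : tot_d s C n ∘ tot_d s C n.+1 = 0.
Proof.
have hd_dd t D m : ((bv D 0 m *~ (-1) ^+ t) ∘ pr1 +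
    bh D 0 m ∘ tot_hd (shift D) m ∘ pr2) ∘ tot_d t D m.+1 = 0.
  have e1 : pr1 ∘ tot_d t D m.+1 = (bv D 0 m.+1 *~ (-1) ^+ t) ∘ pr1
      + bh D 0 m.+1 ∘ tot_hd (shift D) m.+1 ∘ pr2 by exact: pr1_pair.
  have e2 : pr2 ∘ tot_d t D m.+1 = tot_d t.+1 (shift D) m ∘ pr2.
    exact: pr2_pair.
  have hh : bh D 0 m ∘ bh (shift D) 0 m = 0 by exact: bh_bh.
  have vh : bv D 0 m ∘ bh D 0 m.+1 = bh D 0 m ∘ bv (shift D) 0 m.
    exact: bv_bh.
  rewrite cmpDl -(cmpA _ pr1) e1 -(cmpA _ pr2) e2.
  rewrite -(cmpA (bh D 0 m)) (cmpA (tot_hd (shift D) m)) tot_hd_d.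
  rewrite cmpDl !cmpDr !cmpA hh !cmp0m addr0.
  rewrite !(cmpMzm, cmpmMz) bv_bv !(mul0rz, cmp0m) add0r.
  by rewrite vh exprS mulN1r mulrNz addrN.
elim: n s C => [|n IH] s C.
  rewrite -[RHS](hd_dd s C 0) /=.
  by rewrite cmpm1.
rewrite [LHS]pair_cmp hd_dd -cmpA.
have e2 : pr2 ∘ tot_d s C n.+2 = tot_d s.+1 (shift C) n.+1 ∘ pr2.
  exact: pr2_pair.
by rewrite e2 cmpA IH cmp0m /bpair !cmpm0 addr0.
Qed.

Definition tot_cpx C : cpx A := @Cpx A (tot_ob C) (tot_d 0 C) (tot_dd 0 C).

Lemma tot_hd_mor C D (f : chmap C D) n :
  tot_hd D n ∘ tot_mor f n = bmor f 0 n ∘ tot_hd C n.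
Proof.
by case: n => [|n] /=; [rewrite cmp1m cmpm1 | rewrite pr1_bimap].
Qed.

Lemma tot_mor_d s C D (f : chmap C D) n :
  tot_d s D n ∘ tot_mor f n.+1 = tot_mor f n ∘ tot_d s C n.
Proof.
have hdE t X Y (g : chmap X Y) m : ((bv Y 0 m *~ (-1) ^+ t) ∘ pr1 +
    bh Y 0 m ∘ tot_hd (shift Y) m ∘ pr2) ∘ tot_mor g m.+1 =
    bmor g 0 m ∘ ((bv X 0 m *~ (-1) ^+ t) ∘ pr1 +
    bh X 0 m ∘ tot_hd (shift X) m ∘ pr2).
  have e1 : pr1 ∘ tot_mor g m.+1 = bmor g 0 m.+1 ∘ pr1 by exact: pr1_bimap.
  have e2 : pr2 ∘ tot_mor g m.+1 = tot_mor (shift_map g) m ∘ pr2.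
    exact: pr2_bimap.
  have eh : bh Y 0 m ∘ bmor (shift_map g) 0 m = bmor g 0 m ∘ bh X 0 m.
    exact: bh_mor.
  rewrite cmpDl cmpDr -!cmpA e1 e2; congr (_ + _).
    by rewrite !cmpA !(cmpMzm, cmpmMz) bv_mor.
  by rewrite [X in _ ∘ X]cmpA tot_hd_mor !cmpA eh.
elim: n s C D f => [|n IH] s C D f.
  rewrite -[RHS]/(bmor f 0 0 ∘ _) -[tot_d s C 0]/(_ + _).
  have := hdE s C D f 0; rewrite /= !cmpm1; exact.
rewrite [LHS]pair_cmp hdE [RHS]bimap_pair; congr bpair.
have e2 : pr2 ∘ tot_mor f n.+2 = tot_mor (shift_map f) n.+1 ∘ pr2.
  exact: pr2_bimap.
by rewrite -cmpA e2 !cmpA IH.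
Qed.

Definition tot_map C D (f : chmap C D) : chmap (tot_cpx C) (tot_cpx D) :=
  @Chmap A (tot_cpx C) (tot_cpx D) (tot_mor f) (tot_mor_d 0 f).

Fact tot_map1 C : tot_map (idm (C : Ch (Ch A))) = idm (tot_cpx C : Ch A).
Proof.
apply: chmap_eq => n /=; elim: n C => [|n IH] C //=.
have -> : shift_map (chid C) = chid (shift C) by apply: chmap_eq.
by rewrite IH; apply: bimap1.
Qed.

Fact tot_mapM C D E (g : chmap D E) (f : chmap C D) :
  tot_map (chcmp g f) = chcmp (tot_map g) (tot_map f).
Proof.
apply: chmap_eq => n /=; elim: n C D E g f => [|n IH] C D E g f //=.
have -> : shift_map (chcmp g f) = chcmp (shift_map g) (shift_map f).
  exact: chmap_eq.
by rewrite IH; apply: bimap_cmp.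
Qed.

Definition Tot : functor (Ch (Ch A)) (Ch A) :=
  @Functor (Ch (Ch A)) (Ch A) tot_cpx tot_map tot_map1 tot_mapM.

End Totalization.

Section Derivatives.
Variable A : kadd.

Section Nabla.
Variable B : kadd.
Implicit Types F G : functor B (Ch A).

Definition D1 F : functor B (Ch A) := fcomp (Tot A) (D1c F).

Fact D1_map_nat F G (a : F ⟹ G) X Y (f : hom X Y) :
  fmor (Tot A) (D1c_map a Y) ∘ fmor (D1 F) f =
  fmor (D1 G) f ∘ fmor (Tot A) (D1c_map a X).
Proof.
rewrite -(fmorM (Tot A)) -[RHS](fmorM (Tot A)); congr (fmor (Tot A) _).
exact: D1c_map_nat.
Qed.

Definition D1_map F G (a : F ⟹ G) : D1 F ⟹ D1 G :=
  @Nattr B (Ch A) (D1 F) (D1 G) (fun X => fmor (Tot A) (D1c_map a X))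
    (D1_map_nat a).

Variable F : functor B (Ch A).

Definition addF (X : B) : functor B (Ch A) := fcomp F (addf X).

Fact addF_mapP (X Y : B) (g : hom X Y) V W (f : hom V W) :
  fmor F (bimap g (idm W)) ∘ fmor (addF X) f =
  fmor (addF Y) f ∘ fmor F (bimap g (idm V)).
Proof.
rewrite -(fmorM F) -[RHS](fmorM F); congr (fmor F _).
exact: addf_mapP.
Qed.

Definition addF_map (X Y : B) (g : hom X Y) : addF X ⟹ addF Y :=
  @Nattr B (Ch A) (addF X) (addF Y) (fun V => fmor F (bimap g (idm V)))
    (addF_mapP g).

Let nabla_ob (VX : prodc B B) : Ch A := D1 (addF VX.2) VX.1.

Let nabla_mor (VX WY : prodc B B) (fg : hom VX WY) :
    hom (nabla_ob VX) (nabla_ob WY) :=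
  D1_map (addF_map fg.2) WY.1 ∘ fmor (D1 (addF VX.2)) fg.1.

Fact nabla1 VX : nabla_mor (idm VX) = idm (nabla_ob VX).
Proof.
rewrite /nabla_mor fmor1 cmpm1.
rewrite -[LHS]/(fmor (Tot A) (D1c_map (addF_map (idm VX.2)) VX.1)) D1c_map1.
  exact: (fmor1 (Tot A)).
by move=> Y; rewrite -[LHS]/(fmor F (bimap _ _)) bimap1 fmor1.
Qed.

Fact nablaM VX WY UZ (g : hom WY UZ) (f : hom VX WY) :
  nabla_mor (g ∘ f) = nabla_mor g ∘ nabla_mor f.
Proof.
rewrite /nabla_mor (fmorM (D1 (addF VX.2))) cmpA.
have -> : D1_map (addF_map (g ∘ f).2) UZ.1 =
    D1_map (addF_map g.2) UZ.1 ∘ D1_map (addF_map f.2) UZ.1.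
  rewrite -[RHS](fmorM (Tot A)); congr (fmor (Tot A) _); apply: D1c_mapM => Y.
  by rewrite -[RHS](fmorM F) -bimap_cmp cmp1m.
rewrite -!cmpA; congr (_ ∘ _).
by rewrite !cmpA -(ntP (D1_map (addF_map f.2))).
Qed.

Definition nabla : functor (prodc B B) (Ch A) :=
  @Functor (prodc B B) (Ch A) nabla_ob nabla_mor nabla1 nablaM.

End Nabla.

Variables (B : kadd) (F : functor B (Ch A)).

(* [nabla_iter [:: V_n; ...; V_1]] is the functor
   [X |-> nabla^n F (V_n, ..., V_1; X)]. *)
Fixpoint nabla_iter (Vs : seq B) : functor B (Ch A) :=
  match Vs with
  | [::] => F
  | V :: Vs' => fcomp (nabla (nabla_iter Vs')) (fpair (constf B V) (idf B))
  end.

(* [pow n] is the category of tuples [(V_n, (V_(n-1), ... (V_1, X)))]. *)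
Fixpoint pow (n : nat) : kadd := if n is n'.+1 then prodc B (pow n') else B.

(* [(V_(n+1), ..., V_1, X) |-> (V_(n+1), ..., V_1)] *)
Fixpoint powinit (n : nat) : functor (pow n.+1) (pow n) :=
  match n with
  | 0 => fstf B B
  | n'.+1 => fpair (fstf B (pow n'.+1))
                   (fcomp (powinit n') (sndf B (pow n'.+1)))
  end.

(* [(V_(n+1), ..., V_1, X) |-> (V_n, ..., V_1, X)] *)
Definition powtail (n : nat) : functor (pow n.+1) (pow n) := sndf B (pow n).

Fixpoint Delta (n : nat) : functor (pow n) (Ch A) :=
  match n with
  | 0 => F
  | n'.+1 => fcomp (nabla (Delta n')) (fpair (powinit n') (powtail n'))
  end.

(* The object [(V_n, ..., V_1, X)], where [V k] is [V_k]. *)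
Fixpoint tuple_ob (V : nat -> B) (X : B) (n : nat) : pow n :=
  match n with 0 => X | n'.+1 => (V n'.+1, tuple_ob V X n') end.

End Derivatives.

(* Main.v *)
(* A chain rule drives an induction on n over all base categories: up to reordering
   coordinates, Delta_(n+1) F is Delta_n applied to the functor nabla F on B x B, in
   the directions (V_(k+1), V_k) at the point (V_1, X). By induction this is a sum of
   iterated derivatives of nabla F. As nabla F is linear in its first variable,
   differentiating it in a direction (Y, W) either differentiates F once more in the
   direction W, or replaces the first variable by Y. Over all directions this adds a
   block {1} to a partition of the (shifted) index set or adjoins 1 to one of its
   blocks; so do the partitions of {1, ..., n+1} arise from those of {1, ..., n}.

   For this, nabla is described as a relative version P of D_1 for functors on an
   arbitrary category with a functorial doubling. The map from F to P F is an
   equivalence when F has degree at most 1, P F always has degree at most 1, and P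
   preserves equivalences. Hence the operators P and P' of two commuting doublings
   satisfy P P' ~ P' P, which gives the symmetry of second derivatives. *)
From HB Require Import structures.
From mathcomp Require Import all_boot all_order all_algebra.
From mathcomp Require Import boolp.
Require Import Defs.
Set Implicit Arguments.
Unset Strict Implicit.
Unset Printing Implicit Defensive.
Import GRing.Theory.
Local Open Scope ring_scope.

(** * Quasi-isomorphisms *)

(** The claim is pointwise, but the induction applies [nabla] to equivalences found earlier, and
    [nabla] acts on natural maps only. The inverses built by [weq_section] are not natural, so
    equivalence of functors is kept as a zigzag of natural maps ([zz]) and evaluated at objects at
    the very end.

    Symmetry is not shown by matching two multiple complexes: each order of linearization is a
    universal approximation, up to homotopy, by functors of degree at most 1 in both variables, and
    two such approximations agree. This requires both [peta (P F)] and [P (peta F)] to be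
    equivalences. The first is seen on columns. The second is seen on rows, after splitting each
    degree of the total complex [P F] into its entries. Hence the two separate results [totc_weq]
    and [totc_rows] on totalization. *)

Section Weq.
Variable A : preadd.
Implicit Types C D E : cpx A.

Definition cyc C n T : hom T (C n) -> Prop :=
  match n return hom T (C n) -> Prop with
  | 0 => fun=> True
  | n'.+1 => fun x => cd C n' ∘ x = 0
  end.

Definition acyclic C : Prop :=
  forall n T (x : hom T (C n)), cyc x -> exists y, x = cd C n ∘ y.

(* Homology isomorphism on generalized elements [T -> C n] for every [T]; as
   every exactness is then pointwise split, this amounts to [f] being a chain
   homotopy equivalence, while allowing diagram chases. *)
Record weq C D (f : chmap C D) : Prop := Weq {
  weq_inj : forall n T (x : hom T (C n)) (w : hom T (D n.+1)),
    cyc x -> f n ∘ x = cd D n ∘ w -> exists v, x = cd C n ∘ v;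
  weq_surj : forall n T (y : hom T (D n)), cyc y ->
    exists (x : hom T (C n)) (w : hom T (D n.+1)),
      cyc x /\ y = f n ∘ x + cd D n ∘ w }.

Lemma cyc_cd C n T (y : hom T (C n.+1)) : cyc (cd C n ∘ y).
Proof. by case: n y => [//|n] y; rewrite /= cmpA cdd cmp0m. Qed.

Lemma cycD C n T (x y : hom T (C n)) : cyc x -> cyc y -> cyc (x + y).
Proof. by case: n x y => [//|n] x y /= dx dy; rewrite cmpDr dx dy addr0. Qed.

Lemma cycN C n T (x : hom T (C n)) : cyc x -> cyc (- x).
Proof. by case: n x => [//|n] x /= dx; rewrite cmpmN dx oppr0. Qed.

Lemma cyc_map C D (f : chmap C D) n T (x : hom T (C n)) : cyc x -> cyc (f n ∘ x).
Proof.
by case: n x => [//|n] x /= dx; rewrite cmpA chmP -cmpA dx cmpm0.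
Qed.

Lemma chm_cd C D (f : chmap C D) n T (x : hom T (C n.+1)) :
  f n ∘ (cd C n ∘ x) = cd D n ∘ (f n.+1 ∘ x).
Proof. by rewrite !cmpA chmP. Qed.

Lemma weq_bij C D (f : chmap C D) :
  (forall n T (x : hom T (C n)), f n ∘ x = 0 -> x = 0) ->
  (forall n T (y : hom T (D n)), exists x, f n ∘ x = y) -> weq f.
Proof.
move=> inj surj; split=> [n T x w cx fx|n T y cy].
  have [v fv] := surj _ _ w; exists v; apply/eqP; rewrite -subr_eq0; apply/eqP.
  by apply: (inj n); rewrite cmpDr cmpmN fx chm_cd fv subrr.
have [x fx] := surj _ _ y; exists x, 0; rewrite cmpm0 addr0 fx; split=> //.
case: n x y cy fx => [//|n] x y /= cy fx; apply: (inj n).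
by rewrite chm_cd fx cy.
Qed.

Lemma weq_iso C D (f : chmap C D) (g : forall n, hom (D n) (C n)) :
  (forall n, g n ∘ f n = idm _) -> (forall n, f n ∘ g n = idm _) -> weq f.
Proof.
move=> gf fg; apply: weq_bij => [n T x fx|n T y].
  by rewrite -[x]cmp1m -gf -cmpA fx cmpm0.
by exists (g n ∘ y); rewrite cmpA fg cmp1m.
Qed.

Lemma weq_id C (f : chmap C C) : (forall n, f n = idm _) -> weq f.
Proof. by move=> f1; apply: (@weq_iso _ _ f (fun=> idm _)) => n; rewrite f1 cmp1m. Qed.

Section Compose.
Variables (C D E : cpx A) (g : chmap D E) (f : chmap C D) (h : chmap C E).
Hypothesis hE : forall n, h n = g n ∘ f n.

Lemma weq_comp : weq f -> weq g -> weq h.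
Proof.
move=> wf wg; split=> [n T x w cx|n T y cy].
  rewrite hE -cmpA => e; have [u fu] := weq_inj wg (cyc_map f cx) e.
  exact (weq_inj wf cx fu).
have [x [w [cx ->]]] := weq_surj wg cy.
have [x' [w' [cx' ->]]] := weq_surj wf cx.
exists x', (g n.+1 ∘ w' + w); split => //.
by rewrite hE !cmpDr -chm_cd addrA cmpA.
Qed.

Lemma weq_cancel_l : weq g -> weq h -> weq f.
Proof.
move=> wg wh; split=> [n T x w cx e|n T y cy].
  apply: (weq_inj wh cx (w := g n.+1 ∘ w)).
  by rewrite hE -cmpA e chm_cd.
have [x [w [cx e]]] := weq_surj wh (cyc_map g cy).
have cyx : cyc (y - f n ∘ x) by apply: cycD => //; apply/cycN/cyc_map.
have [] := weq_inj wg (w := w) cyx.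
  by rewrite cmpDr cmpmN e hE -cmpA addrC addKr.
by move=> v ev; exists x, v; split=> //; rewrite -ev addrC subrK.
Qed.

Lemma weq_cancel_r : weq f -> weq h -> weq g.
Proof.
move=> wf wh; split=> [n T y w cy e|n T y cy].
  have [x [w' [cx ey]]] := weq_surj wf cy.
  have [] := weq_inj wh (w := w - g n.+1 ∘ w') cx.
    rewrite hE -cmpA cmpDr cmpmN -chm_cd -e ey cmpDr.
    by rewrite addrK.
  by move=> v ev; exists (f n.+1 ∘ v + w'); rewrite ey ev chm_cd cmpDr.
have [x [w [cx e]]] := weq_surj wh cy.
by exists (f n ∘ x), w; split; [exact: cyc_map | rewrite e hE cmpA].
Qed.

End Compose.

(** On homology [v] is injective because [wv] is, and surjective because [vu] is. So [v] is an
    equivalence, and then [u] is one by cancellation. *)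
Lemma weq_2of6 C D E K (u : chmap C D) (v : chmap D E) (w : chmap E K)
  (vu : chmap C E) (wv : chmap D K) :
  (forall n, vu n = v n ∘ u n) -> (forall n, wv n = w n ∘ v n) ->
  weq vu -> weq wv -> weq u.
Proof.
move=> vuE wvE wvu wwv; apply: (weq_cancel_l vuE) => //; split=> [n T x z cx e|n T y cy].
  apply: (weq_inj wwv cx (w := w n.+1 ∘ z)).
  by rewrite wvE -cmpA e chm_cd.
have [x [z [cx e]]] := weq_surj wvu cy.
by exists (u n ∘ x), z; split; [exact: cyc_map | rewrite e vuE cmpA].
Qed.

(** This is how natural direct summands, such as cross effects and reduced parts, inherit
    equivalences. *)
Lemma weq_retract C D C' D' (f : chmap C D) (f' : chmap C' D')
  (i : chmap C' C) (r : chmap C C') (j : chmap D' D) (s : chmap D D') :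
  (forall n, r n ∘ i n = idm _) -> (forall n, s n ∘ j n = idm _) ->
  (forall n, f n ∘ i n = j n ∘ f' n) -> (forall n, f' n ∘ r n = s n ∘ f n) ->
  weq f -> weq f'.
Proof.
move=> ri sj fi fr wf; split=> [n T x w cx e|n T y cy].
  have [] := weq_inj wf (w := j n.+1 ∘ w) (cyc_map i cx).
    by rewrite cmpA fi -cmpA e chm_cd.
  move=> v ev; exists (r n.+1 ∘ v).
  by rewrite -chm_cd -ev cmpA ri cmp1m.
have [x [w [cx e]]] := weq_surj wf (cyc_map j cy).
exists (r n ∘ x), (s n.+1 ∘ w); split; first exact: cyc_map.
by rewrite cmpA fr -chm_cd -cmpA -cmpDr -e cmpA sj cmp1m.
Qed.

Lemma acyclic_weq C D (f : chmap C D) : acyclic C -> acyclic D -> weq f.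
Proof.
move=> aC aD; split=> [n T x w cx _|n T y cy]; first exact: aC.
have [w ->] := aD _ _ _ cy; exists 0, w; rewrite cmpm0 add0r; split=> //.
by case: n {y cy w} => //= n; rewrite cmpm0.
Qed.

Lemma weq_acyclic_r C D (f : chmap C D) : acyclic C -> weq f -> acyclic D.
Proof.
move=> aC wf n T y /(weq_surj wf)[x [w [/aC[v ->] ->]]].
by exists (f n.+1 ∘ v + w); rewrite cmpDr chm_cd.
Qed.

Lemma weq_acyclic_l C D (f : chmap C D) : acyclic D -> weq f -> acyclic C.
Proof.
move=> aD wf n T x cx; have [w e] := aD _ _ _ (cyc_map f cx).
exact: (weq_inj wf cx e).
Qed.

Lemma homotopic_sym C D (f g : chmap C D) : homotopic f g -> homotopic g f.
Proof.
case=> s [s0 sS]; exists (fun n => - s n); split.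
  by rewrite cmpmN -s0 opprB.
by move=> n; rewrite cmpmN cmpNm -opprD -sS opprB.
Qed.

Lemma homotopic_trans C D (f g h : chmap C D) :
  homotopic f g -> homotopic g h -> homotopic f h.
Proof.
case=> s [s0 sS] [t [t0 tS]]; exists (fun n => s n + t n); split.
  by rewrite cmpDr -s0 -t0 addrA subrK.
move=> n; rewrite cmpDr cmpDl addrACA -sS -tS.
by rewrite addrA subrK.
Qed.

Lemma homotopic_cmp C D D' E (f g : chmap D D') (h : chmap D' E) (k : chmap C D) :
  homotopic f g -> homotopic (chcmp h (chcmp f k)) (chcmp h (chcmp g k)).
Proof.
case=> s [s0 sS]; exists (fun n => h n.+1 ∘ s n ∘ k n).
have e n : (chcmp h (chcmp f k)) n - (chcmp h (chcmp g k)) n =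
    h n ∘ (f n - g n) ∘ k n.
  by rewrite /= !cmpDr cmpDl cmpmN cmpNm !cmpA.
split=> [|n]; rewrite e.
  by rewrite s0 !cmpA chmP.
by rewrite sS cmpDr cmpDl !cmpA chmP -!cmpA chmP.
Qed.

Lemma homotopic_weq C D (f g : chmap C D) : homotopic f g -> weq g -> weq f.
Proof.
case=> s [s0 sS] wg.
have e n T (x : hom T (C n)) : cyc x -> f n ∘ x = g n ∘ x + cd D n ∘ (s n ∘ x).
  case: n x => [|n] x cx.
    by rewrite cmpA -s0 cmpDl cmpNm addrC subrK.
  apply/eqP; rewrite addrC -subr_eq -cmpNm -cmpDl sS cmpDl -(cmpA (s n)).
  by rewrite [cd C n ∘ x]cx cmpm0 addr0 cmpA.
split=> [n T x w cx fx|n T y cy].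
  apply: (weq_inj wg cx (w := w - s n ∘ x)).
  by rewrite cmpDr cmpmN -fx e // addrK.
have [x [w [cx ->]]] := weq_surj wg cy.
exists x, (w - s n ∘ x); split=> //.
by rewrite cmpDr cmpmN e // -addrA; congr (_ + _); rewrite addrC subrK.
Qed.

(* The inverse is built degree by degree: the next component is found by
   evaluating surjectivity and injectivity on homology at the generalized element
   given by the identity. *)
Lemma weq_section C D (f : chmap C D) : weq f ->
  exists g : chmap D C, homotopic (chcmp f g) (chid D).
Proof.
move=> wf.
(* A stage holds the degree [n] components of the inverse and of the homotopy; [ok] says that two
   consecutive stages fit together. *)
pose st n := (hom (D n) (C n) * hom (D n) (D n.+1))%type.
pose ok n (p : st n) (q : st n.+1) :=
  cd C n ∘ q.1 = p.1 ∘ cd D n /\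
  f n.+1 ∘ q.1 - idm _ = cd D n.+1 ∘ q.2 + p.2 ∘ cd D n.
pose good n : st n -> Prop :=
  match n return st n -> Prop with
  | 0 => fun p => f 0%N ∘ p.1 - idm _ = cd D 0 ∘ p.2
  | n'.+1 => fun q => exists p : st n', ok n' p q
  end.
have good_cd n (p : st n) : good n p ->
    f n ∘ p.1 ∘ cd D n = cd D n + cd D n ∘ (p.2 ∘ cd D n) /\ cyc (p.1 ∘ cd D n).
  case: n p => [|n] p /=.
    move=> e; split=> //.
    have -> : f 0%N ∘ p.1 = idm _ + cd D 0 ∘ p.2 by rewrite -e addrC subrK.
    by rewrite cmpDl cmp1m cmpA.
  case=> r [e1 e2]; split; last first.
    by rewrite cmpA e1 -cmpA cdd cmpm0.
  have -> : f n.+1 ∘ p.1 = idm _ + (cd D n.+1 ∘ p.2 + r.2 ∘ cd D n).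
    by rewrite -e2 addrC subrK.
  by rewrite !cmpDl cmp1m -(cmpA r.2) cdd cmpm0 addr0 !cmpA.
have next n (p : st n) : good n p -> exists q, ok n p q.
  move=> /good_cd[fp cp].
  have [] := weq_inj wf (w := idm _ + p.2 ∘ cd D n) cp.
    by rewrite cmpA fp cmpDr cmpm1.
  move=> v ev.
  (* [v] lifts the differential but may miss the homotopy identity, by a cycle. Surjectivity writes
     this defect as the image of a cycle [x] plus a boundary, and [v - x] is the repaired
     component. *)
  have cy : cyc (f n.+1 ∘ v - idm _ - p.2 ∘ cd D n).
    rewrite /= !cmpDr !cmpmN -chm_cd -ev cmpA fp cmpm1.
    by rewrite -addrA -opprD subrr.
  have [x [w [cx e]]] := weq_surj wf cy.
  exists (v - x, w); split=> /=; first by rewrite cmpDr cmpmN [cd C n ∘ x]cx subr0.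
  rewrite cmpDr cmpmN.
  have -> : f n.+1 ∘ v - f n.+1 ∘ x - idm (D n.+1) =
     (f n.+1 ∘ v - idm _ - p.2 ∘ cd D n) - f n.+1 ∘ x + p.2 ∘ cd D n.
    by rewrite [RHS]addrAC subrK addrAC.
  by rewrite e [_ + _ - _]addrAC subrr add0r.
have [p0 gp0] : exists p, good 0%N p.
  have [x [w [cx e]]] := @weq_surj _ _ _ wf 0%N _ (idm (D 0%N)) I.
  exists (x, - w) => /=; rewrite cmpmN {1}e.
  by rewrite opprD addrA subrr add0r.
have nx n (p : {p : st n | good n p}) : {q : {q : st n.+1 | good n.+1 q} |
    ok n (sval p) (sval q)}.
  apply: cid; have [q okq] := next n (sval p) (svalP p).
  have gq : good n.+1 q by exists (sval p).
  by exists (exist _ q gq).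
pose F := fix F n : {p : st n | good n p} :=
  match n with 0 => exist _ p0 gp0 | n'.+1 => sval (nx n' (F n')) end.
have okF n : ok n (sval (F n)) (sval (F n.+1)) by exact: svalP (nx n (F n)).
have gP n : cd C n ∘ (sval (F n.+1)).1 = (sval (F n)).1 ∘ cd D n.
  by case: (okF n).
exists (Chmap gP), (fun n => (sval (F n)).2); split; first exact: gp0.
by move=> n; case: (okF n).
Qed.

Definition wequiv C D : Prop := exists f : chmap C D, weq f.

Lemma wequiv_refl C : wequiv C C.
Proof. by exists (chid C); apply: weq_id. Qed.

Lemma wequiv_trans D C E : wequiv C D -> wequiv D E -> wequiv C E.
Proof.
case=> f wf [g wg]; exists (chcmp g f).
by apply: (@weq_comp _ _ _ g f) => // n.
Qed.

Lemma weq_section_weq C D (f : chmap C D) (g : chmap D C) : weq f ->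
  homotopic (chcmp f g) (chid D) -> weq g.
Proof.
move=> wf h; apply: (@weq_cancel_l _ _ _ f g (chcmp f g)) => //.
by apply: (homotopic_weq h); apply: weq_id.
Qed.

Lemma wequiv_sym C D : wequiv C D -> wequiv D C.
Proof.
case=> f wf; have [g fg] := weq_section wf; exists g.
exact: weq_section_weq wf fg.
Qed.

(** [weq_section] gives inverses on one side only: [f g ~ 1], and [g f' ~ 1] because [g] is again an
    equivalence. Then [g f ~ g f g f' ~ g f' ~ 1]. *)
Lemma wequiv_homotopy_equivalent C D : wequiv C D -> homotopy_equivalent C D.
Proof.
case=> f wf; have [g fg] := weq_section wf.
have [f' gf'] := weq_section (weq_section_weq wf fg).
exists f, g; split=> //.
have h1 := homotopic_cmp g f' fg.
have h2 := homotopic_cmp (chcmp g f) (chid C) gf'.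
apply: homotopic_trans gf'; apply: homotopic_trans (homotopic_sym _) _.
  move: h2; rewrite !chcmpm1; exact.
move: h1; rewrite chcmp1m !chcmpA; exact.
Qed.

End Weq.

(** * Totalization *)

Section TotWeq.
Variable A : kadd.
Implicit Types C D : cpx (Ch A).

Definition totc s C : cpx A := @Cpx A (tot_ob C) (tot_d s C) (tot_dd s C).

Definition totc_map s C D (f : chmap C D) : chmap (totc s C) (totc s D) :=
  @Chmap A (totc s C) (totc s D) (tot_mor f) (tot_mor_d s f).

Definition tot_in C n : hom (bob C 0 n) (tot_ob C n) :=
  match n with 0 => idm _ | n'.+1 => in1 end.

(** The part of the differential that stays to the right of column 0. It vanishes for [n = 0], which
    lets [tot_dE] describe [tot_d] by one formula in all degrees. *)
Definition tot_tl s C n : hom (tot_ob (shift C) n) (tot_ob C n) :=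
  match n with 0 => 0 | n'.+1 => in2 ∘ tot_d s.+1 (shift C) n' end.

Local Notation tp1 C n := (@pr1 A (bob C 0 n.+1) (tot_ob (shift C) n)).
Local Notation tp2 C n := (@pr2 A (bob C 0 n.+1) (tot_ob (shift C) n)).
Local Notation ti1 C n := (@in1 A (bob C 0 n.+1) (tot_ob (shift C) n)).
Local Notation ti2 C n := (@in2 A (bob C 0 n.+1) (tot_ob (shift C) n)).

Lemma signzK T (U : A) s (x : hom T U) : x *~ (-1) ^+ s *~ (-1) ^+ s = x.
Proof. by rewrite -mulrzA -expr2 sqrr_sign mulr1z. Qed.

Lemma tot_hd_in C n : tot_hd C n ∘ tot_in C n = idm _.
Proof. by case: n => [|n] /=; rewrite (cmp1m, pr1_in1). Qed.

Lemma tot_hd_tl s C n : tot_hd C n ∘ tot_tl s C n = 0.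
Proof. by case: n => [|n] /=; rewrite ?cmpm0 // cmpA pr1_in2 cmp0m. Qed.

Lemma tot_dE s C n T (x : hom T (tot_ob C n.+1)) :
  tot_d s C n ∘ x =
  tot_in C n ∘ (bv C 0 n ∘ (tp1 C n ∘ x) *~ (-1) ^+ s +
                bh C 0 n ∘ (tot_hd (shift C) n ∘ (tp2 C n ∘ x))) +
  tot_tl s C n ∘ (tp2 C n ∘ x).
Proof.
case: n x => [|n] x.
  by rewrite /= !cmp1m cmp0m addr0 cmpDl !cmpMzm !cmpA.
rewrite [tot_d s C n.+1]/= [LHS]pair_cmp /bpair; congr (_ + _); last first.
  by rewrite /= !cmpA.
by rewrite /= !cmpDl !cmpMzm !cmpA.
Qed.

Lemma tot_hd_dE s C n T (x : hom T (tot_ob C n.+1)) :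
  tot_hd C n ∘ (tot_d s C n ∘ x) =
  bv C 0 n ∘ (tp1 C n ∘ x) *~ (-1) ^+ s +
  bh C 0 n ∘ (tot_hd (shift C) n ∘ (tp2 C n ∘ x)).
Proof.
by rewrite tot_dE cmpDr (cmpA _ (tot_in C n)) tot_hd_in cmp1m (cmpA _ (tot_tl s C n))
  tot_hd_tl cmp0m addr0.
Qed.

Lemma tot_tl_dE s C n T (x : hom T (tot_ob C n.+2)) :
  tp2 C n ∘ (tot_d s C n.+1 ∘ x) = tot_d s.+1 (shift C) n ∘ (tp2 C n.+1 ∘ x).
Proof. by rewrite tot_dE cmpDr !cmpA pr2_in1 !cmp0m add0r pr2_in2 cmp1m. Qed.

Lemma tot_d_in1 s C n T (a : hom T (bob C 0 n.+1)) :
  tot_d s C n ∘ (ti1 C n ∘ a) = tot_in C n ∘ (bv C 0 n ∘ a *~ (-1) ^+ s).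
Proof.
by rewrite tot_dE !(cmpA _ in1) pr1_in1 pr2_in1 cmp1m cmp0m !cmpm0 !addr0.
Qed.

Lemma tot_d_in2 s C n T (t : hom T (tot_ob (shift C) n)) :
  tot_d s C n ∘ (ti2 C n ∘ t) =
  tot_in C n ∘ (bh C 0 n ∘ (tot_hd (shift C) n ∘ t)) + tot_tl s C n ∘ t.
Proof.
by rewrite tot_dE !(cmpA _ in2) pr1_in2 pr2_in2 cmp1m cmp0m !cmpm0 mul0rz add0r.
Qed.

Lemma cyc_tl s C n T (t : hom T (tot_ob (shift C) n)) :
  @cyc _ (totc s.+1 (shift C)) n T t -> tot_tl s C n ∘ t = 0.
Proof.
by case: n t => [|n] t /= e; rewrite ?cmp0m // -cmpA e cmpm0.
Qed.

Lemma cyc_totS s C n T (x : hom T (tot_ob C n.+1)) :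
  @cyc _ (totc s C) n.+1 T x ->
  bv C 0 n ∘ (tp1 C n ∘ x) *~ (-1) ^+ s +
    bh C 0 n ∘ (tot_hd (shift C) n ∘ (tp2 C n ∘ x)) = 0 /\
  @cyc _ (totc s.+1 (shift C)) n T (tp2 C n ∘ x).
Proof.
move=> cx; split; first by rewrite -tot_hd_dE [X in _ ∘ X]cx cmpm0.
case: n x cx => [//|n] x cx.
by rewrite /cyc -[LHS]tot_tl_dE [X in _ ∘ X]cx cmpm0.
Qed.

(** The horizontal differential kills the horizontal part of a boundary and turns the vertical part
    into a boundary of column 0. *)
Lemma bh_hd_d s C n T (w : hom T (tot_ob (shift C) n.+1)) :
  bh C 0 n ∘ (tot_hd (shift C) n ∘ (tot_d s (shift C) n ∘ w)) =
  bv C 0 n ∘ (bh C 0 n.+1 ∘ (tp1 (shift C) n ∘ w *~ (-1) ^+ s)).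
Proof.
rewrite tot_hd_dE -[bh (shift C) 0 n]/(bh C 1 n) -[bv (shift C) 0 n]/(bv C 1 n).
rewrite cmpDr (cmpA _ (bh C 1 n)) bh_bh cmp0m addr0 !cmpmMz.
by rewrite !cmpA bv_bh.
Qed.

(** The total complex is a cone over the map from the remaining columns to column 0 given by taking
    the head and applying [bh]; this connecting map preserves cycles. *)
Lemma bh_hd_cyc s C n T (t : hom T (tot_ob (shift C) n)) :
  @cyc _ (totc s (shift C)) n T t ->
  @cyc _ (C 0%N : cpx A) n T (bh C 0 n ∘ (tot_hd (shift C) n ∘ t)).
Proof.
case: n t => [//|n] t ct; have [e _] := cyc_totS ct.
rewrite /cyc /= cmpA -[cd _ n]/(bv C 0 n) bv_bh -cmpA.
have -> : bv C 1 n ∘ (tp1 (shift C) n ∘ t) =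
    - (bh C 1 n ∘ (tot_hd (shift (shift C)) n ∘ (tp2 (shift C) n ∘ t))) *~ (-1) ^+ s.
  apply/eqP; rewrite -[bv C 1 n ∘ _](signzK s) -subr_eq0 -mulrzBl.
  by rewrite opprK [X in X *~ _]e mul0rz.
by rewrite cmpmMz cmpmN cmpA bh_bh cmp0m oppr0 mul0rz.
Qed.

Lemma tot_in_mor C D (f : chmap C D) n :
  tot_mor f n ∘ tot_in C n = tot_in D n ∘ bmor f 0 n.
Proof.
case: n => [|n] /=; first by rewrite cmp1m cmpm1.
by rewrite /bimap pair_cmp -!cmpA pr1_in1 pr2_in1 cmpm1 cmpm0 /bpair cmpm0 addr0.
Qed.

Lemma tot_in2_mor C D (f : chmap C D) n :
  tot_mor f n.+1 ∘ ti2 C n = ti2 D n ∘ tot_mor (shift_map f) n.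
Proof.
by rewrite /= /bimap pair_cmp -!cmpA pr1_in2 pr2_in2 cmpm1 cmpm0 /bpair cmpm0 add0r.
Qed.

Lemma tot_tl_mor C D (f : chmap C D) n :
  tp2 D n ∘ tot_mor f n.+1 = tot_mor (shift_map f) n ∘ tp2 C n.
Proof. exact: pr2_bimap. Qed.

Lemma bh_morE C D (f : chmap C D) n T (x : hom T (tot_ob (shift C) n)) :
  bmor f 0 n ∘ (bh C 0 n ∘ (tot_hd (shift C) n ∘ x)) =
  bh D 0 n ∘ (tot_hd (shift D) n ∘ (tot_mor (shift_map f) n ∘ x)).
Proof.
rewrite (cmpA (tot_hd (shift D) n)) tot_hd_mor -(cmpA (bmor (shift_map f) 0 n)).
by rewrite [LHS]cmpA -(bh_mor f 0 n) -cmpA.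
Qed.

Lemma in1_eta (U W : A) T (x : hom T (U ⊕ W)) : pr2 ∘ x = 0 -> x = in1 ∘ (pr1 ∘ x).
Proof. by move=> e; rewrite -{1}[x]pair_eta /bpair e cmpm0 addr0. Qed.

Lemma in2_eta (U W : A) T (x : hom T (U ⊕ W)) : pr1 ∘ x = 0 -> x = in2 ∘ (pr2 ∘ x).
Proof. by move=> e; rewrite -{1}[x]pair_eta /bpair e cmpm0 add0r. Qed.

Lemma cyc_in s C n T (a : hom T (bob C 0 n)) :
  @cyc _ (totc s C) n T (tot_in C n ∘ a) <-> @cyc _ (C 0%N : cpx A) n T a.
Proof.
case: n a => [//|n] a; rewrite /cyc; split=> e; last first.
  by rewrite -[LHS]/(tot_d s C n ∘ (ti1 C n ∘ a)) tot_d_in1 [_ ∘ a]e mul0rz cmpm0.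
have e' : tot_d s C n ∘ (ti1 C n ∘ a) = 0 by [].
rewrite -[LHS](signzK s) -[X in X *~ _](cmp1m) -(tot_hd_in C n) -cmpA.
by rewrite -tot_d_in1 e' cmpm0 mul0rz.
Qed.

(** Column 0 is peeled off. Surjectivity in the remaining columns provides the tail, injectivity in
    column 0 completes it to a cycle, and surjectivity in column 0 absorbs the difference [r], which
    lives there alone. *)
Lemma totc_surj n C D (f : chmap C D) s T (y : hom T (tot_ob D n)) :
  (forall p, weq (f p : chmap (C p) (D p))) -> @cyc _ (totc s D) n T y ->
  exists (x : hom T (tot_ob C n)) (w : hom T (tot_ob D n.+1)),
    @cyc _ (totc s C) n T x /\ y = tot_mor f n ∘ x + tot_d s D n ∘ w.
Proof.
elim: n C D f s y => [|n IH] C D f s y wf cy.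
  have [x [w [_ e]]] := @weq_surj _ _ _ _ (wf 0%N) 0%N _ y I.
  exists x, (ti1 D 0 ∘ (w *~ (-1) ^+ s)); split=> //.
  by rewrite tot_d_in1 !cmpmMz signzK /= !cmp1m.
have [e0 cy'] := cyc_totS cy.
have [x' [w' [cx' ey]]] := IH _ _ (shift_map f) s.+1 _ (fun p => wf p.+1) cy'.
(* The obstruction to completing [x'] to a cycle by an entry in column 0. Its image in [D] bounds,
   because [y] is a cycle there, so it bounds already in [C]. *)
have [|a' ea'] := weq_inj (wf 0%N) (bh_hd_cyc cx')
    (w := - (tp1 D n ∘ y) *~ (-1) ^+ s - bh D 0 n.+1 ∘ (tp1 (shift D) n ∘ w' *~ (-1) ^+ s.+1)).
  rewrite -[f 0%N n]/(bmor f 0 n) bh_morE cmpDr !cmpmN.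
  rewrite -[cd (D 0%N) n]/(bv D 0 n) -bh_hd_d.
  have -> : tot_mor (shift_map f) n ∘ x' = tp2 D n ∘ y - tot_d s.+1 (shift D) n ∘ w'.
    by rewrite ey addrK.
  rewrite !cmpDr !cmpmN; congr (_ + _).
  by move: e0 => /eqP; rewrite addrC addr_eq0 => /eqP ->; rewrite cmpmMz cmpmN mulNrz.
have [x [cx ex]] : exists x : hom T (tot_ob C n.+1),
    @cyc _ (totc s C) n.+1 T x /\ tp2 C n ∘ x = x'.
  exists (bpair (- a' *~ (-1) ^+ s) x'); rewrite pr2_pair; split=> //.
  rewrite /cyc -[LHS]/(tot_d s C n ∘ bpair _ _) tot_dE pr1_pair pr2_pair cyc_tl //.
  by rewrite addr0 ea' cmpmMz signzK cmpmN addNr cmpm0.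
pose r := y - tot_mor f n.+1 ∘ x - tot_d s D n.+1 ∘ (ti2 D n.+1 ∘ w').
have cr : @cyc _ (totc s D) n.+1 T r.
  apply: cycD; last by apply: cycN; apply: (@cyc_cd _ (totc s D)).
  by apply: cycD => //; apply/cycN/(cyc_map (totc_map s f)).
have r2 : tp2 D n ∘ r = 0.
  rewrite /r !cmpDr !cmpmN tot_tl_dE. rewrite (cmpA _ in2) pr2_in2 cmp1m.
  rewrite (cmpA _ (tot_mor f n.+1)) tot_tl_mor -(cmpA _ (tp2 C n)) ex ey.
  by rewrite [X in X - _]addrAC subrr add0r subrr.
have er := in1_eta r2.
have cb : @cyc _ (D 0%N : cpx A) n.+1 T (tp1 D n ∘ r).
  by apply/(cyc_in s); rewrite /= -er.
have [a [c [ca eb]]] := weq_surj (wf 0%N) cb.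
exists (ti1 C n ∘ a + x), (ti1 D n.+1 ∘ (c *~ (-1) ^+ s) + ti2 D n.+1 ∘ w'); split.
  by apply: cycD cx; apply/(cyc_in s).
have -> : y = r + (tot_mor f n.+1 ∘ x + tot_d s D n.+1 ∘ (ti2 D n.+1 ∘ w')).
  by rewrite /r -[y - _ - _]addrA -opprD subrK.
rewrite er eb !cmpDr tot_d_in1 !cmpmMz signzK.
have -> : tot_mor f n.+1 ∘ (ti1 C n ∘ a) = ti1 D n ∘ (f 0%N n.+1 ∘ a).
  by rewrite cmpA (tot_in_mor f n.+1) -cmpA.
by rewrite addrACA.
Qed.

(** The tail of [w] is a cycle of the remaining columns, so [totc_surj] replaces it by an image
    modulo a boundary. The relation then takes place in column 0, where [weq_inj] applies. *)
Lemma totc_inj0 n C D (f : chmap C D) s T (a : hom T (bob C 0 n))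
    (w : hom T (tot_ob D n.+1)) :
  (forall p, weq (f p : chmap (C p) (D p))) -> @cyc _ (C 0%N : cpx A) n T a ->
  @cyc _ (totc s.+1 (shift D)) n T (tp2 D n ∘ w) ->
  tot_mor f n ∘ (tot_in C n ∘ a) = tot_d s D n ∘ w ->
  exists v, tot_in C n ∘ a = tot_d s C n ∘ v.
Proof.
move=> wf ca cw e.
have [x [w' [cx ew]]] := @totc_surj n _ _ (shift_map f) s.+1 _ _ (fun p => wf p.+1) cw.
have e' : bmor f 0 n ∘ a = bv D 0 n ∘ (tp1 D n ∘ w) *~ (-1) ^+ s +
    bh D 0 n ∘ (tot_hd (shift D) n ∘ (tp2 D n ∘ w)).
  by rewrite -tot_hd_dE -e cmpA tot_hd_mor -cmpA (cmpA _ (tot_in _ _)) tot_hd_in cmp1m.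
have [||v ev] := weq_inj (wf 0%N) (x := a - bh C 0 n ∘ (tot_hd (shift C) n ∘ x))
   (w := (tp1 D n ∘ w) *~ (-1) ^+ s + bh D 0 n.+1 ∘ (tp1 (shift D) n ∘ w' *~ (-1) ^+ s.+1)).
- by apply: cycD => //; apply/cycN/bh_hd_cyc/cx.
- rewrite cmpDr cmpmN -[f 0%N n]/(bmor f 0 n) e' bh_morE ew.
  rewrite -[cd (D 0%N) n]/(bv D 0 n) !cmpDr bh_hd_d cmpmMz.
  by rewrite [X in _ + X - _]addrC addrA addrK [X in _ = X + _]cmpmMz.
exists (ti1 C n ∘ (v *~ (-1) ^+ s) + ti2 C n ∘ x).
rewrite cmpDr tot_d_in1 tot_d_in2 cyc_tl // addr0 -cmpDr; congr (_ ∘ _).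
by rewrite cmpmMz signzK -[bv C 0 n ∘ v]ev subrK.
Qed.

(** The induction hypothesis bounds the tail of [x]; subtracting that boundary leaves a cycle in
    column 0 for [totc_inj0]. *)
Lemma totc_inj n C D (f : chmap C D) s T (x : hom T (tot_ob C n))
    (w : hom T (tot_ob D n.+1)) :
  (forall p, weq (f p : chmap (C p) (D p))) -> @cyc _ (totc s C) n T x ->
  tot_mor f n ∘ x = tot_d s D n ∘ w -> exists v, x = tot_d s C n ∘ v.
Proof.
elim: n C D f s x w => [|n IH] C D f s x w wf cx e.
  have [//|||v] := @totc_inj0 0 C D f s T x w wf _ _ _ => //; rewrite /= ?cmp1m //.
  by move=> ->; exists v.
have [e0 cx'] := cyc_totS cx.
have [|v ev] := IH _ _ (shift_map f) s.+1 (tp2 C n ∘ x) (tp2 D n.+1 ∘ w) (fun p => wf p.+1) cx'.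
  by rewrite -tot_tl_dE -e !cmpA tot_tl_mor.
pose r := x - tot_d s C n.+1 ∘ (ti2 C n.+1 ∘ v).
have r2 : tp2 C n ∘ r = 0.
  by rewrite /r cmpDr cmpmN tot_tl_dE (cmpA _ in2) pr2_in2 cmp1m ev subrr.
have er := in1_eta r2.
have cr : @cyc _ (totc s C) n.+1 T r.
  by apply: cycD => //; apply: cycN; apply: (@cyc_cd _ (totc s C)).
have [|||v' ev'] := @totc_inj0 n.+1 C D f s T (tp1 C n ∘ r)
    (w - ti2 D n.+1 ∘ (tot_mor (shift_map f) n.+1 ∘ v)) wf.
- by apply/(cyc_in s); rewrite /= -er.
- rewrite /cyc /= cmpDr cmpmN (cmpA _ in2) pr2_in2 cmp1m cmpDr cmpmN.
  rewrite -[tot_d _ _ _ ∘ (tp2 D n.+1 ∘ w)]tot_tl_dE -e.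
  have := tot_mor_d s.+1 (shift_map f) n => /= h.
  rewrite (cmpA (tot_d _ _ _)) h -cmpA.
  by rewrite (cmpA (tp2 D n)) tot_tl_mor -(cmpA _ (tp2 C n)) ev subrr.
- rewrite -[tot_in C n.+1]/(ti1 C n) -er /r !cmpDr !cmpmN e; congr (_ - _).
  by rewrite cmpA -tot_mor_d -[LHS]cmpA (cmpA (tot_mor f n.+2)) tot_in2_mor -(cmpA (ti2 D n.+1)).
exists (v' + ti2 C n.+1 ∘ v); rewrite cmpDr -ev' -[tot_in C n.+1]/(ti1 C n) -er /r.
by rewrite subrK.
Qed.

Lemma totc_weq s C D (f : chmap C D) :
  (forall p, weq (f p : chmap (C p) (D p))) -> weq (totc_map s f).
Proof.
move=> wf; split=> [n T x w cx e|n T y cy]; last exact: totc_surj.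
exact: totc_inj wf cx e.
Qed.

Lemma tot_ob_0 C n : (forall p q, idm (bob C p q) = 0) -> idm (tot_ob C n) = 0.
Proof.
elim: n C => [|n IH] C C0 /=; first exact: C0.
have e1 : ti1 C n = 0 by rewrite -[LHS]cmpm1 C0 cmpm0.
have e2 : ti2 C n = 0 by rewrite -[LHS]cmpm1 IH ?cmpm0 // => p q; apply: (C0 p.+1).
by rewrite -bipP [X in X ∘ _ + _]e1 [X in _ + X ∘ _]e2 !cmp0m addr0.
Qed.

Lemma hom_0 (U T : A) (x : hom T U) : idm U = 0 -> x = 0.
Proof. by move=> U0; rewrite -[x]cmp1m U0 cmp0m. Qed.

Lemma acyclic_0 (K : cpx A) : (forall n, idm (K n) = 0) -> acyclic K.
Proof. by move=> K0 n T x _; exists 0; rewrite cmpm0; apply: hom_0. Qed.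

Lemma bob_0 p q : idm (bob (zob : Ch (Ch A)) p q) = 0.
Proof. exact: zobP. Qed.

Lemma totc_acyclic s C : (forall p, acyclic (C p)) -> acyclic (totc s C).
Proof.
move=> aC; have f : chmap (zob : Ch (Ch A)) C by exact: (0 : @hom (Ch (Ch A)) zob C).
have a0 : acyclic (totc s (zob : Ch (Ch A))).
  by apply: acyclic_0 => n; apply: tot_ob_0; apply: bob_0.
apply: (weq_acyclic_r a0 (f := totc_map s f)); apply: totc_weq => p.
by apply: acyclic_weq => //; apply: acyclic_0 => q; apply: (bob_0 p q).
Qed.

Fact colP C n : cd (tot_cpx C) n ∘ tot_in C n.+1 = tot_in C n ∘ cd (C 0%N) n.
Proof.
by rewrite -[LHS]cmpm1 -cmpA [LHS]tot_d_in1 expr0 mulr1z cmpm1.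
Qed.

Definition col C : chmap (C 0%N) (tot_cpx C) := @Chmap A (C 0%N) (tot_cpx C) (tot_in C) (colP C).

(** Acyclicity of the other columns removes tails: that of a bounding chain for injectivity, that of
    a cycle for surjectivity. *)
Lemma col_weq C : (forall p, acyclic (C p.+1)) -> weq (col C).
Proof.
move=> aC; have aS : acyclic (totc 1 (shift C)) by apply: totc_acyclic.
split=> [n T a w ca e|n T y cy].
  have ea : a = bv C 0 n ∘ (tp1 C n ∘ w) *~ (-1) ^+ 0 +
      bh C 0 n ∘ (tot_hd (shift C) n ∘ (tp2 C n ∘ w)).
    by rewrite -tot_hd_dE -[tot_d 0 C n ∘ w]e cmpA tot_hd_in cmp1m.
  have cw : @cyc _ (totc 1 (shift C)) n T (tp2 C n ∘ w).
    case: n a w ca e {ea} => [//|n] a w ca e.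
    rewrite /cyc -[LHS](tot_tl_dE 0) -[tot_d 0 C n.+1 ∘ w]e.
    by rewrite [X in pr2 ∘ X]/= cmpA pr2_in1 cmp0m.
  have [w' ew'] := aS _ _ _ cw.
  exists (tp1 C n ∘ w + bh C 0 n.+1 ∘ (tp1 (shift C) n ∘ w' *~ (-1) ^+ 1)).
  by rewrite ea ew' expr0 mulr1z cmpDr -[cd (totc _ _) n]/(tot_d 1 (shift C) n) bh_hd_d.
case: n y cy => [|n] y cy.
  by exists y, 0; rewrite cmpm0 addr0 /= cmp1m.
have [w ew] := aS _ _ _ (cyc_totS cy).2.
pose r := y - tot_d 0 C n.+1 ∘ (ti2 C n.+1 ∘ w).
have r2 : tp2 C n ∘ r = 0.
  by rewrite /r cmpDr cmpmN tot_tl_dE (cmpA _ in2) pr2_in2 cmp1m ew subrr.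
have cr : @cyc _ (totc 0 C) n.+1 T r.
  by apply: cycD => //; apply: cycN; apply: (@cyc_cd _ (totc 0 C)).
exists (tp1 C n ∘ r), (ti2 C n.+1 ∘ w); split.
  by apply/(cyc_in 0); rewrite -[tot_in C n.+1]/(ti1 C n) -(in1_eta r2).
by rewrite -[col C n.+1]/(ti1 C n) -(in1_eta r2) /r subrK.
Qed.

Definition rowc C q : cpx A :=
  @Cpx A (fun p => bob C p q) (fun p => bh C p q) (fun p => bh_bh C p q).

Definition rowmap C D (f : chmap C D) q : chmap (rowc C q) (rowc D q) :=
  @Chmap A (rowc C q) (rowc D q) (fun p => bmor f p q) (fun p => bh_mor f p q).

(* A chain map is [rel_acyclic] when it is a monomorphism with acyclic cokernel. *)
Definition chmono (K L : cpx A) (f : chmap K L) : Prop :=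
  forall n T (x : hom T (K n)), f n ∘ x = 0 -> x = 0.

Definition relcyc (K L : cpx A) (f : chmap K L) n T : hom T (L n) -> Prop :=
  match n return hom T (L n) -> Prop with
  | 0 => fun=> True
  | n'.+1 => fun z => exists a, cd L n' ∘ z = f n' ∘ a
  end.

Definition rel_acyclic (K L : cpx A) (f : chmap K L) : Prop :=
  chmono f /\ forall n T (z : hom T (L n)), relcyc f z ->
    exists w a, z = cd L n ∘ w + f n ∘ a.

Lemma tot_mor_mono n C D (f : chmap C D) T (x : hom T (tot_ob C n)) :
  (forall q, chmono (rowmap f q)) -> tot_mor f n ∘ x = 0 -> x = 0.
Proof.
elim: n C D f x => [|n IH] C D f x mf; first exact: (mf 0%N 0%N).
move=> e; apply: bip_eq; rewrite cmpm0.
  apply: (mf n.+1 0%N); rewrite /= cmpA -(pr1_bimap _ (tot_mor (shift_map f) n)).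
  by rewrite -cmpA [_ ∘ x]e cmpm0.
apply: (IH _ _ (shift_map f)); first by move=> q p; apply: (mf q p.+1).
by rewrite cmpA -tot_tl_mor -cmpA e cmpm0.
Qed.

(* The rows of [shift_map f] are only exact away from column 0, whence the
   separate assumption on the leading entry of [t]. *)
Lemma totc_rel n C D (f : chmap C D) s T (t : hom T (tot_ob D n)) :
  (forall q p (U : A) (z : hom U (bob D p.+1 q)) a,
     bh D p q ∘ z = bmor f p q ∘ a ->
     exists w a', z = bh D p.+1 q ∘ w + bmor f p.+1 q ∘ a') ->
  relcyc (totc_map s f) t ->
  (exists c a, tot_hd D n ∘ t = bh D 0 n ∘ c + bmor f 0 n ∘ a) ->
  exists (y : hom T (tot_ob (shift D) n)) x,
    t = tot_d s D n ∘ (ti2 D n ∘ y) + tot_mor f n ∘ x.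
Proof.
elim: n C D f s t => [|n IH] C D f s t rf rt [c [a e]].
  exists c, a; rewrite -[t]cmp1m [LHS]e tot_d_in2 /= cmp1m cmp1m.
  by rewrite cmp0m addr0.
(* The head of [t] is expressed through [c] and [a]. Subtracting the corresponding boundary and
   image clears the head and passes the problem on to the tail. *)
pose u := t - tot_d s D n.+1 ∘ (ti2 D n.+1 ∘ (tot_in (shift D) n.+1 ∘ c))
            - tot_mor f n.+1 ∘ (ti1 C n ∘ a).
have u1 : tp1 D n ∘ u = 0.
  rewrite -[tp1 D n]/(tot_hd D n.+1) /u !cmpDr !cmpmN e. rewrite (@tot_hd_dE s D n.+1).
  rewrite (cmpA _ (ti2 _ _) (_ ∘ c)) pr1_in2 cmp0m cmpm0 mul0rz add0r.
  rewrite (cmpA _ (ti2 _ _) (_ ∘ c)) pr2_in2 cmp1m (cmpA (tot_hd _ _) (tot_in _ _)).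
  rewrite tot_hd_in cmp1m.
  rewrite (cmpA _ _ (ti1 C n ∘ a)) (tot_hd_mor f n.+1) -cmpA (cmpA _ _ a).
  by rewrite -[ti1 C n]/(tot_in C n.+1) tot_hd_in cmp1m addrAC addrK subrr.
have eu := in2_eta u1.
have [b eb] : exists b, tot_d s D n ∘ u = tot_mor f n ∘ b.
  case: rt => b; rewrite -[LHS]/(tot_d s D n ∘ t) => eb.
  exists (b - tot_d s C n ∘ (ti1 C n ∘ a)).
  rewrite /u !cmpDr !cmpmN eb (cmpA (tot_d s D n)) tot_dd cmp0m subr0.
  by congr (_ - _); rewrite !cmpA tot_mor_d.
have e1 : bh D 0 n ∘ (tot_hd (shift D) n ∘ (tp2 D n ∘ u)) = bmor f 0 n ∘ (tot_hd C n ∘ b).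
  rewrite (cmpA (bmor f 0 n)) -tot_hd_mor -(cmpA _ (tot_mor f n)) -eb tot_hd_dE.
  by rewrite u1 cmpm0 mul0rz add0r.
have [|||y [x ey]] := IH _ _ (shift_map f) s.+1 (tp2 D n ∘ u).
- by move=> q p U z a'; apply: (rf q p.+1).
- case: n {IH} t c a e rt u u1 eu b eb {e1} => [//|n] t c a e rt u u1 eu b eb.
  exists (tp2 C n ∘ b); rewrite -[LHS](tot_tl_dE s) eb.
  by rewrite cmpA tot_tl_mor -cmpA.
- exact: rf e1.
exists (ti2 (shift D) n ∘ y + tot_in (shift D) n.+1 ∘ c), (ti2 C n ∘ x + ti1 C n ∘ a).
have et : t = u + (tot_d s D n.+1 ∘ (ti2 D n.+1 ∘ (tot_in (shift D) n.+1 ∘ c))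
            + tot_mor f n.+1 ∘ (ti1 C n ∘ a)).
  by rewrite /u -[t - _ - _]addrA -opprD subrK.
have e2 : tot_d s D n.+1 ∘ (ti2 D n.+1 ∘ (ti2 (shift D) n ∘ y)) =
    ti2 D n ∘ (tot_d s.+1 (shift D) n ∘ (ti2 (shift D) n ∘ y)).
  rewrite (@tot_d_in2 s D n.+1) [X in bh D 0 n.+1 ∘ X]cmpA pr1_in2.
  by rewrite cmp0m !cmpm0 add0r -[LHS]cmpA.
rewrite et {1}eu ey (cmpDr (ti2 D n)) (cmpA (ti2 D n) (tot_mor _ _)) -tot_in2_mor.
by rewrite (cmpDr (ti2 D n.+1)) (cmpDr (tot_d _ _ _)) e2 (cmpDr (tot_mor _ _)) addrACA
  !cmpA.
Qed.

(** [tot_ob] is bracketed by columns, so no induction on rows is at hand. Instead [totc_rel] clears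
    a relative cycle entry by entry, using exactness of the row through each entry. Together with
    injectivity of [tot_mor f], relative exactness makes [f] an equivalence. *)
Lemma totc_rows s C D (f : chmap C D) :
  (forall q, rel_acyclic (rowmap f q)) -> weq (totc_map s f).
Proof.
move=> rf.
have mono_f n T (x : hom T (tot_ob C n)) : tot_mor f n ∘ x = 0 -> x = 0.
  by apply: tot_mor_mono => q; case: (rf q).
have H n T (t : hom T (tot_ob D n)) : relcyc (totc_map s f) t ->
    exists y x, t = tot_d s D n ∘ y + tot_mor f n ∘ x.
  move=> rt; have [||y [x e]] := totc_rel _ rt.
  - by move=> q p U z a e; apply: (rf q).2; exists a.
  - exact: ((rf n).2 0%N).
  by exists (ti2 D n ∘ y), x.
split=> [n T x w cx e|n T y cy].
  have [|y [x' ew]] := H n.+1 T w; first by exists x.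
  exists x'; apply/eqP; rewrite -subr_eq0; apply/eqP/mono_f.
  rewrite cmpDr cmpmN -[tot_mor f n]/(totc_map s f n) e (chm_cd (totc_map s f)) ew.
  by rewrite cmpDr (cmpA _ (tot_d s D n.+1)) (cdd (totc s D)) cmp0m add0r subrr.
have [|w [x e]] := H n T y.
  by case: n y cy => [//|n] y /= ->; exists 0; rewrite cmpm0.
exists x, w; rewrite addrC; split=> //.
case: n y cy w x e => [//|n] y cy w x e; apply: mono_f.
rewrite -[tot_mor f n]/(totc_map s f n) (chm_cd (totc_map s f)).
by move: cy; rewrite /cyc e cmpDr (cmpA _ (tot_d s D n.+1)) (cdd (totc s D)) cmp0m add0r.
Qed.

Lemma totc_acyclic_rows s C : (forall q, acyclic (rowc C q)) -> acyclic (totc s C).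
Proof.
move=> aC; pose f : chmap (zob : Ch (Ch A)) C := (0 : @hom (Ch (Ch A)) zob C).
have a0 : acyclic (totc s (zob : Ch (Ch A))).
  by apply: acyclic_0 => n; apply: tot_ob_0; apply: bob_0.
apply: (weq_acyclic_r a0 (f := totc_map s f)); apply: totc_rows => q; split.
  by move=> n T x _; apply/hom_0/(bob_0 n q).
move=> n T z rz; have [|w ->] := aC q n T z.
  by case: n z rz => [//|n] z [a]; rewrite /= cmp0m.
by exists w, 0; rewrite cmpm0 addr0.
Qed.

(** Joint kernels of two maps, which is what cross effects are, can be computed entrywise in a total
    complex. *)
Lemma tot_kernel n (R C D E : cpx (Ch A)) (i : chmap R C) (f : chmap C D)
    (g : chmap C E) T (x : hom T (tot_ob C n)) :
  (forall p q (U : A) (z : hom U (bob C p q)), bmor f p q ∘ z = 0 ->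
     bmor g p q ∘ z = 0 -> exists u, bmor i p q ∘ u = z) ->
  tot_mor f n ∘ x = 0 -> tot_mor g n ∘ x = 0 -> exists u, tot_mor i n ∘ u = x.
Proof.
elim: n R C D E i f g x => [|n IH] R C D E i f g x H fx gx; first exact: H.
have h1 K (h : chmap C K) : tot_mor h n.+1 ∘ x = 0 -> bmor h 0 n.+1 ∘ (tp1 C n ∘ x) = 0.
  move=> e; have := tot_hd_mor h n.+1.
  by move=> /(congr1 (fun k => k ∘ x)); rewrite -!cmpA e cmpm0.
have h2 K (h : chmap C K) : tot_mor h n.+1 ∘ x = 0 ->
    tot_mor (shift_map h) n ∘ (tp2 C n ∘ x) = 0.
  by move=> e; rewrite cmpA -tot_tl_mor -cmpA e cmpm0.
have [u eu] := H _ _ _ _ (h1 _ _ fx) (h1 _ _ gx).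
have [|v ev] := IH _ _ _ _ (shift_map i) _ _ _ _ (h2 _ _ fx) (h2 _ _ gx).
  by move=> p q; apply: (H p.+1 q).
exists (bpair u v); rewrite [LHS]bimap_pair eu ev; exact: pair_eta.
Qed.

Lemma tot_morD n C D (f g h : chmap C D) : (forall p q, bmor h p q = bmor f p q + bmor g p q) ->
  tot_mor h n = tot_mor f n + tot_mor g n.
Proof.
elim: n C D f g h => [|n IH] C D f g h E /=; first exact: E.
rewrite E (IH _ _ (shift_map f) (shift_map g)); last by move=> p q; apply: (E p.+1).
by rewrite /bimap /bpair !cmpDl !cmpDr addrACA.
Qed.

End TotWeq.

(** * Linearization with respect to a doubling *)

(* A functorial doubling [dbl] with the structure maps of [V |-> V ⊕ V] applied to
   one coordinate of a product category; [sz] kills that coordinate and [sd] is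
   [in1 ⊕ in2]. *)
Record slot (E : preadd) := Slot {
  dbl : functor E E;
  sp1 : forall X, hom (dbl X) X;
  sp2 : forall X, hom (dbl X) X;
  sm : forall X, hom (dbl X) X;
  si1 : forall X, hom X (dbl X);
  si2 : forall X, hom X (dbl X);
  sz : forall X : E, hom X X;
  sd : forall X, hom (dbl X) (dbl (dbl X));
  sp1N : forall X Y (f : hom X Y), sp1 Y ∘ fmor dbl f = f ∘ sp1 X;
  sp2N : forall X Y (f : hom X Y), sp2 Y ∘ fmor dbl f = f ∘ sp2 X;
  smN : forall X Y (f : hom X Y), sm Y ∘ fmor dbl f = f ∘ sm X;
  si1N : forall X Y (f : hom X Y), si1 Y ∘ f = fmor dbl f ∘ si1 X;
  si2N : forall X Y (f : hom X Y), si2 Y ∘ f = fmor dbl f ∘ si2 X;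
  szN : forall X Y (f : hom X Y), sz Y ∘ f = f ∘ sz X;
  sdN : forall X Y (f : hom X Y),
    sd Y ∘ fmor dbl f = fmor dbl (fmor dbl f) ∘ sd X;
  sp1_i1 : forall X, sp1 X ∘ si1 X = idm X;
  sp2_i2 : forall X, sp2 X ∘ si2 X = idm X;
  sp1_i2 : forall X, sp1 X ∘ si2 X = sz X;
  sp2_i1 : forall X, sp2 X ∘ si1 X = sz X;
  szz : forall X, sz X ∘ sz X = sz X;
  szp : forall X, sz X ∘ sp1 X = sz X ∘ sp2 X;
  dblz : forall X, fmor dbl (sz X) = sz (dbl X);
  sp1_d : forall X, sp1 (dbl X) ∘ sd X = si1 X ∘ sp1 X;
  sp2_d : forall X, sp2 (dbl X) ∘ sd X = si2 X ∘ sp2 X;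
  dblp1_d : forall X, fmor dbl (sp1 X) ∘ sd X = si1 X ∘ sp1 X;
  dblp2_d : forall X, fmor dbl (sp2 X) ∘ sd X = si2 X ∘ sp2 X;
  sm_d : forall X, sm (dbl X) ∘ sd X = idm (dbl X);
  dblm_d : forall X, fmor dbl (sm X) ∘ sd X = idm (dbl X) }.

Fact ntsubP (E C : preadd) (F G : functor E C) (a b : F ⟹ G) X Y (f : hom X Y) :
  (a Y - b Y) ∘ fmor F f = fmor G f ∘ (a X - b X).
Proof. by rewrite cmpDl cmpDr cmpNm cmpmN !ntP. Qed.

Definition ntsub (E C : preadd) (F G : functor E C) (a b : F ⟹ G) : F ⟹ G :=
  @Nattr _ _ F G (fun X => a X - b X) (ntsubP a b).

Section Iterate.
Variables (E C : preadd) (K : functor E C -> functor E C).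
Variable Km : forall F G : functor E C, F ⟹ G -> K F ⟹ K G.
Variable e : forall F, K F ⟹ F.
Implicit Types F G : functor E C.
Arguments Km {F G} _.

Fixpoint itm F G (a : F ⟹ G) k : iter k K F ⟹ iter k K G :=
  match k return iter k K F ⟹ iter k K G with
  | 0 => a
  | k'.+1 => Km (itm a k')
  end.

(** Unfolded, this is the alternating sum of the faces [K^i e]. In the recursive form, naturality of
    [e] does the work of the simplicial identities. *)
Fixpoint itb G k : iter k.+1 K G ⟹ iter k K G :=
  match k return iter k.+1 K G ⟹ iter k K G with
  | 0 => e G
  | k'.+1 => ntsub (e (iter k'.+1 K G)) (Km (itb G k'))
  end.

End Iterate.

Section CrossEffect.
Variables (E : preadd) (S : slot E) (C : kadd).
Implicit Types F G H : functor E C.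

Fact xprojP G X Y (f : hom X Y) :
  bpair (fmor G (sp1 S Y)) (fmor G (sp2 S Y)) ∘ fmor G (fmor (dbl S) f) =
  fmor (fcomp (sumf C) (fpair G G)) f ∘ bpair (fmor G (sp1 S X)) (fmor G (sp2 S X)).
Proof. by rewrite pair_cmp [RHS]bimap_pair -!fmorM sp1N sp2N. Qed.

Definition xproj G : fcomp G (dbl S) ⟹ fcomp (sumf C) (fpair G G) :=
  @Nattr _ _ (fcomp G (dbl S)) (fcomp (sumf C) (fpair G G))
    (fun X => bpair (fmor G (sp1 S X)) (fmor G (sp2 S X))) (@xprojP G).

(* The second cross effect in the coordinate [S]: for a reduced functor, the
   linearization is the comonad resolution attached to [X2 G -> G]. *)
Definition X2 G : functor E C := kerf (xproj G).

Definition xin G X : hom (X2 G X) (G (dbl S X)) := kin (xproj G X).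

Lemma xin_mono G X T (u v : hom T (X2 G X)) : xin G X ∘ u = xin G X ∘ v -> u = v.
Proof. exact: kin_mono. Qed.

Lemma xin_nat G X Y (f : hom X Y) :
  xin G Y ∘ fmor (X2 G) f = fmor G (fmor (dbl S) f) ∘ xin G X.
Proof. exact: (kerf_kin (xproj G)). Qed.

Lemma xin1 G X : fmor G (sp1 S X) ∘ xin G X = 0.
Proof.
have := kinK (xproj G X) => /(congr1 (cmp pr1)).
by rewrite cmpA pr1_pair cmpm0.
Qed.

Lemma xin2 G X : fmor G (sp2 S X) ∘ xin G X = 0.
Proof.
have := kinK (xproj G X) => /(congr1 (cmp pr2)).
by rewrite cmpA pr2_pair cmpm0.
Qed.

Definition xlift G X T (z : hom T (G (dbl S X))) : hom T (X2 G X) := klift (xproj G X) z.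

Lemma xliftE G X T (z : hom T (G (dbl S X))) :
  fmor G (sp1 S X) ∘ z = 0 -> fmor G (sp2 S X) ∘ z = 0 -> xin G X ∘ xlift z = z.
Proof.
move=> z1 z2; apply: kin_lift; rewrite /= pair_cmp z1 z2.
by rewrite /bpair !cmpm0 addr0.
Qed.

Fact X2_map_ker F G (a : F ⟹ G) X :
  xproj G X ∘ (ntwhisker a (dbl S) X ∘ kin (xproj F X)) = 0.
Proof.
have e : xproj G X ∘ a (dbl S X) = bimap (a X) (a X) ∘ xproj F X.
  by rewrite [LHS]pair_cmp [RHS]bimap_pair -!ntP.
by rewrite cmpA [X in X ∘ _]e -cmpA kinK cmpm0.
Qed.

Definition X2_map F G (a : F ⟹ G) : X2 F ⟹ X2 G := kerf_map (X2_map_ker a).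

Lemma X2_mapE F G (a : F ⟹ G) X : xin G X ∘ X2_map a X = a (dbl S X) ∘ xin F X.
Proof. exact: (kin_lift (X2_map_ker a X)). Qed.

Lemma X2_map1 F (a : F ⟹ F) X :
  (forall Y, a Y = idm (F Y)) -> X2_map a X = idm (X2 F X).
Proof. by move=> a1; apply: xin_mono; rewrite X2_mapE a1 cmp1m cmpm1. Qed.

Lemma X2_mapM F G H (b : G ⟹ H) (a : F ⟹ G) (c : F ⟹ H) X :
  (forall Y, c Y = b Y ∘ a Y) -> X2_map c X = X2_map b X ∘ X2_map a X.
Proof.
move=> cE; apply: xin_mono.
by rewrite X2_mapE cE [RHS]cmpA X2_mapE -[RHS]cmpA X2_mapE cmpA.
Qed.

Lemma X2_mapD F G (a b c : F ⟹ G) X :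
  (forall Y, c Y = a Y + b Y) -> X2_map c X = X2_map a X + X2_map b X.
Proof. by move=> cE; apply: xin_mono; rewrite cmpDr !X2_mapE cE cmpDl. Qed.

Lemma X2_map_comm F G G' H (b : G ⟹ H) (a : F ⟹ G) (b' : G' ⟹ H) (a' : F ⟹ G') X :
  (forall Y, b Y ∘ a Y = b' Y ∘ a' Y) ->
  X2_map b X ∘ X2_map a X = X2_map b' X ∘ X2_map a' X.
Proof. by move=> e; rewrite -(X2_mapM (c := ntcomp b a)) //; apply: X2_mapM. Qed.

(** The idempotent onto the cross effect. Both subtracted terms contain the value with the
    coordinate killed, since [G] need not be reduced; the last term adds one copy back. *)
Definition xidem G X : hom (G (dbl S X)) (G (dbl S X)) :=
  idm _ - fmor G (si1 S X ∘ sp1 S X) - fmor G (si2 S X ∘ sp2 S X)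
  + fmor G (si1 S X ∘ sz S X ∘ sp2 S X).

Definition xret G X : hom (G (dbl S X)) (X2 G X) := xlift (xidem G X).

Lemma xretE G X : xin G X ∘ xret G X = xidem G X.
Proof.
apply: xliftE; rewrite /xidem !cmpDr !cmpmN cmpm1 -!fmorM !cmpA.
  by rewrite sp1_i1 sp1_i2 !cmp1m subrr add0r addNr.
rewrite sp2_i1 sp2_i2 szz szp !cmp1m.
by rewrite addrAC subrK subrr.
Qed.

Lemma xidem_in G X : xidem G X ∘ xin G X = xin G X.
Proof.
by rewrite /xidem !cmpDl !cmpNm !fmorM -!cmpA xin1 xin2 !cmpm0 cmp1m !subr0 addr0.
Qed.

Lemma xretK G X : xret G X ∘ xin G X = idm _.
Proof. by apply: xin_mono; rewrite cmpA xretE xidem_in cmpm1. Qed.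

Lemma xret_nat F G (a : F ⟹ G) X : X2_map a X ∘ xret F X = xret G X ∘ a (dbl S X).
Proof.
apply: xin_mono; rewrite !cmpA X2_mapE xretE -cmpA xretE /xidem.
by rewrite !cmpDr !cmpDl !cmpmN !cmpNm !ntP cmpm1 cmp1m.
Qed.

Fact xepsP G X Y (f : hom X Y) :
  fmor G (sm S Y) ∘ xin G Y ∘ fmor (X2 G) f = fmor G f ∘ (fmor G (sm S X) ∘ xin G X).
Proof. by rewrite -cmpA xin_nat !cmpA -!fmorM smN. Qed.

Definition xeps G : X2 G ⟹ G :=
  @Nattr _ _ (X2 G) G (fun X => fmor G (sm S X) ∘ xin G X) (@xepsP G).

Lemma xeps_nat F G (a : F ⟹ G) X : xeps G X ∘ X2_map a X = a X ∘ xeps F X.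
Proof. by rewrite /= -cmpA X2_mapE !cmpA ntP. Qed.

(** The comultiplication of the comonad [X2]. It comes from [sd], which all four projections of the
    fourfold sum reduce to one of the summands, so that the value lies in both nested kernels. *)
Definition xdelta_at G X : hom (X2 G X) (X2 (X2 G) X) :=
  xlift (xlift (fmor G (sd S X) ∘ xin G X)).

Lemma xdeltaE G X :
  xin G (dbl S X) ∘ (xin (X2 G) X ∘ xdelta_at G X) = fmor G (sd S X) ∘ xin G X.
Proof.
have e : xin G (dbl S X) ∘ xlift (fmor G (sd S X) ∘ xin G X) = fmor G (sd S X) ∘ xin G X.
  by apply: xliftE; rewrite cmpA -fmorM ?sp1_d ?sp2_d fmorM -cmpA ?xin1 ?xin2 cmpm0.
rewrite /xdelta_at xliftE //; apply: xin_mono; rewrite cmpm0 cmpA xin_nat -cmpA e.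
  by rewrite cmpA -fmorM dblp1_d fmorM -cmpA xin1 cmpm0.
by rewrite cmpA -fmorM dblp2_d fmorM -cmpA xin2 cmpm0.
Qed.

Fact xdeltaP G X Y (f : hom X Y) :
  xdelta_at G Y ∘ fmor (X2 G) f = fmor (X2 (X2 G)) f ∘ xdelta_at G X.
Proof.
do 2!apply: xin_mono.
rewrite (cmpA _ _ (fmor (X2 G) f)) (cmpA _ _ (fmor (X2 G) f)) xdeltaE -cmpA xin_nat.
rewrite (cmpA (xin (X2 G) Y)) xin_nat -(cmpA _ _ (xdelta_at G X)) [RHS]cmpA xin_nat.
by rewrite -[RHS]cmpA xdeltaE !cmpA -!fmorM sdN.
Qed.

Definition xdelta G : X2 G ⟹ X2 (X2 G) :=
  @Nattr _ _ (X2 G) (X2 (X2 G)) (xdelta_at G) (@xdeltaP G).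

Lemma xdelta_nat F G (a : F ⟹ G) X :
  X2_map (X2_map a) X ∘ xdelta F X = xdelta G X ∘ X2_map a X.
Proof.
do 2!apply: xin_mono.
rewrite (cmpA (xin (X2 G) X)) X2_mapE -(cmpA _ (xin (X2 F) X)) [LHS]cmpA X2_mapE.
rewrite -[LHS]cmpA xdeltaE (cmpA (xin (X2 G) X)) [RHS]cmpA xdeltaE -[RHS]cmpA X2_mapE.
by rewrite !cmpA ntP.
Qed.

Lemma xeps_X2_delta G X : xeps (X2 G) X ∘ xdelta G X = idm _.
Proof.
apply: xin_mono; rewrite -[xeps (X2 G) X]/(fmor (X2 G) (sm S X) ∘ xin (X2 G) X).
rewrite -(cmpA _ _ (xdelta G X)) [LHS]cmpA xin_nat -[LHS]cmpA xdeltaE cmpm1.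
by rewrite cmpA -fmorM dblm_d fmor1 cmp1m.
Qed.

Lemma X2_eps_delta G X : X2_map (xeps G) X ∘ xdelta G X = idm _.
Proof.
apply: xin_mono; rewrite cmpA X2_mapE /= cmpm1 -!cmpA xdeltaE.
by rewrite cmpA -fmorM sm_d fmor1 cmp1m.
Qed.

Definition X2n G k : functor E C := iter k X2 G.

Definition X2n_map := itm X2_map.

Definition xb := itb X2_map xeps.

Lemma xbS G k X : xb G k.+1 X = xeps (X2n G k.+1) X - X2_map (xb G k) X.
Proof. by []. Qed.

Lemma X2_mapB F G (a b c : F ⟹ G) X :
  (forall Y, c Y = a Y - b Y) -> X2_map c X = X2_map a X - X2_map b X.
Proof. by move=> cE; apply: xin_mono; rewrite cmpDr cmpmN !X2_mapE cE cmpDl cmpNm. Qed.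

Lemma X2_map0 F G (a : F ⟹ G) X : (forall Y, a Y = 0) -> X2_map a X = 0.
Proof. by move=> a0; apply: xin_mono; rewrite X2_mapE a0 cmp0m cmpm0. Qed.

Lemma xb_xb G k X : xb G k X ∘ xb G k.+1 X = 0.
Proof.
elim: k X => [|k IH] X.
  by rewrite xbS cmpDr cmpmN (xeps_nat (xb G 0)) subrr.
rewrite [xb G k.+2 X]xbS cmpDr cmpmN -(xeps_nat (xb G k.+1)) -cmpNm -cmpDl.
have -> : xeps (X2n G k.+1) X - xb G k.+1 X = X2_map (xb G k) X.
  by rewrite xbS opprB addrC subrK.
rewrite -(X2_mapM (c := ntcomp (xb G k) (xb G k.+1))) //.
by rewrite X2_map0 // => Y; apply: IH.
Qed.

Lemma xb_map F G (a : F ⟹ G) k X :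
  xb G k X ∘ X2n_map a k.+1 X = X2n_map a k X ∘ xb F k X.
Proof.
elim: k X => [|k IH] X; first exact: xeps_nat.
rewrite !xbS cmpDl cmpDr cmpNm cmpmN (xeps_nat (X2n_map a k.+1)); congr (_ - _).
exact: X2_map_comm.
Qed.

Lemma X2n_mapM F G H (b : G ⟹ H) (a : F ⟹ G) (c : F ⟹ H) k X :
  (forall Y, c Y = b Y ∘ a Y) -> X2n_map c k X = X2n_map b k X ∘ X2n_map a k X.
Proof. by move=> cE; elim: k X => [|k IH] X; [exact: cE|apply: X2_mapM]. Qed.

Lemma X2n_map1 F (a : F ⟹ F) k X :
  (forall Y, a Y = idm (F Y)) -> X2n_map a k X = idm _.
Proof. by move=> a1; elim: k X => [|k IH] X; [exact: a1|apply: X2_map1]. Qed.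

Lemma X2n_mapD F G (a b c : F ⟹ G) k X :
  (forall Y, c Y = a Y + b Y) -> X2n_map c k X = X2n_map a k X + X2n_map b k X.
Proof. by move=> cE; elim: k X => [|k IH] X; [exact: cE|apply: X2_mapD]. Qed.

Definition Pc_cpx G X : cpx C :=
  @Cpx C (fun k => X2n G k X) (fun k => xb G k X) (fun k => xb_xb G k X).

Definition Pc_mor G X Y (f : hom X Y) : @hom (Ch C) (Pc_cpx G X) (Pc_cpx G Y) :=
  @Chmap C (Pc_cpx G X) (Pc_cpx G Y) (fun k => fmor (X2n G k) f)
    (fun k => ntP (xb G k) f).

Fact Pc_mor1 G X : Pc_mor G (idm X) = idm (Pc_cpx G X : Ch C).
Proof. by apply: chmap_eq => k; apply: fmor1. Qed.

Fact Pc_morM G X Y Z (g : hom Y Z) (f : hom X Y) :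
  Pc_mor G (g ∘ f) = Pc_mor G g ∘ Pc_mor G f.
Proof. by apply: chmap_eq => k; apply: fmorM. Qed.

Definition Pc G : functor E (Ch C) :=
  @Functor E (Ch C) (Pc_cpx G) (@Pc_mor G) (@Pc_mor1 G) (@Pc_morM G).

Definition Pc_map_at F G (a : F ⟹ G) X : @hom (Ch C) (Pc F X) (Pc G X) :=
  @Chmap C (Pc_cpx F X) (Pc_cpx G X) (fun k => X2n_map a k X)
    (fun k => xb_map a k X).

Fact Pc_map_nat F G (a : F ⟹ G) X Y (f : hom X Y) :
  Pc_map_at a Y ∘ fmor (Pc F) f = fmor (Pc G) f ∘ Pc_map_at a X.
Proof. by apply: chmap_eq => k; apply: (ntP (X2n_map a k)). Qed.

Definition Pc_map F G (a : F ⟹ G) : Pc F ⟹ Pc G :=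
  @Nattr E (Ch C) (Pc F) (Pc G) (Pc_map_at a) (Pc_map_nat a).

(* The comultiplication contracts the complex [Pc (X2 G)]. *)
Fixpoint xs G k : X2n (X2 G) k ⟹ X2n (X2 G) k.+1 :=
  match k return X2n (X2 G) k ⟹ X2n (X2 G) k.+1 with
  | 0 => xdelta G
  | k'.+1 => X2_map (xs G k')
  end.

Lemma xb_xs0 G X : xb (X2 G) 0 X ∘ xs G 0 X = idm _.
Proof. exact: xeps_X2_delta. Qed.

(** [xs] inserts the comultiplication at the innermost place. All faces but the last pass it by
    naturality; the last one cancels it by the counit law and carries the sign. *)
Lemma xb_xsS G k X : xb (X2 G) k.+1 X ∘ xs G k.+1 X =
  xs G k X ∘ xb (X2 G) k X + idm _ *~ (-1) ^+ k.+1.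
Proof.
have xsS j Y : xs G j.+1 Y = X2_map (xs G j) Y by [].
elim: k X => [|k IH] X; rewrite xbS xsS cmpDl cmpNm.
  rewrite (xeps_nat (xs G 0)) expr1 mulrN1z; congr (_ - _).
  rewrite -(X2_mapM (c := ntcomp (xb (X2 G) 0) (xs G 0))) //.
  by apply: X2_map1 => Y; apply: xb_xs0.
rewrite (xeps_nat (xs G k.+1)).
rewrite -(X2_mapM (c := ntcomp (xb (X2 G) k.+1) (xs G k.+1))) //.
have -> : X2_map (ntcomp (xb (X2 G) k.+1) (xs G k.+1)) X =
    X2_map (xs G k) X ∘ X2_map (xb (X2 G) k) X + idm _ *~ (-1) ^+ k.+1.
  apply: xin_mono; rewrite X2_mapE [ntcomp _ _ _]IH cmpDl cmpDr cmpMzm cmpmMz cmpm1 cmp1m.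
  congr (_ + _); rewrite [RHS]cmpA (X2_mapE (xs G k)) -[RHS]cmpA (X2_mapE (xb _ k)).
  by rewrite cmpA.
by rewrite [xb _ k.+1 X]xbS opprD addrA cmpDr cmpmN [(-1) ^+ k.+2]exprS mulN1r mulrNz.
Qed.

Lemma Pc_X2_acyclic G X : acyclic (Pc (X2 G) X).
Proof.
move=> [|k] T z; first by exists (xs G 0 X ∘ z); rewrite cmpA [X in X ∘ z](xb_xs0 G X) cmp1m.
move=> cz; exists (xs G k.+1 X ∘ z *~ (-1) ^+ k.+1).
rewrite cmpmMz cmpA [X in X ∘ _](xb_xsS G k X) cmpDl -cmpA [_ ∘ z]cz cmpm0 add0r.
by rewrite cmpMzm cmp1m -mulrzA -expr2 sqrr_sign mulr1z.
Qed.

End CrossEffect.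

Section Bijective.
Variables (E C : preadd).

Definition nbij (F G : functor E C) (a : F ⟹ G) : Prop := forall X T,
  (forall x : hom T (F X), a X ∘ x = 0 -> x = 0) /\
  (forall y : hom T (G X), exists x, a X ∘ x = y).

Lemma nbij_comp (F G H : functor E C) (b : G ⟹ H) (a : F ⟹ G) :
  nbij a -> nbij b -> nbij (ntcomp b a).
Proof.
move=> ba bb X T; split=> [x|y].
  by rewrite /= -cmpA => /(proj1 (bb X T))/(proj1 (ba X T)).
have [z <-] := (bb X T).2 y; have [x <-] := (ba X T).2 z.
by exists x; rewrite /= cmpA.
Qed.

End Bijective.

Lemma X2_nbij (E : preadd) (S : slot E) (C : kadd) (F G : functor E C) (a : F ⟹ G) :
  nbij a -> nbij (X2_map S a).
Proof.
move=> ba X T; split=> [x e|y].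
  apply: xin_mono; rewrite cmpm0; apply: (ba _ T).1.
  by rewrite cmpA -X2_mapE -cmpA e cmpm0.
have [x ex] := (ba _ T).2 (xin S G X ∘ y).
have [u eu] : exists u, xin S F X ∘ u = x.
  exists (xlift x); apply: xliftE; apply: (ba _ T).1.
    by rewrite cmpA ntP -cmpA ex cmpA xin1 cmp0m.
  by rewrite cmpA ntP -cmpA ex cmpA xin2 cmp0m.
by exists u; apply: xin_mono; rewrite cmpA X2_mapE -cmpA eu.
Qed.

(* Comparison of the iterates of [X2 S] with those of another operator [K] along
   an operator [T] on functors, given a comparison [t] of [K (T F)] and
   [T (X2 S F)]. *)
Section Compare.
Variables (E : preadd) (S : slot E) (C : kadd) (E' : preadd) (C' : preadd).
Variable K : functor E' C' -> functor E' C'.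
Variable Km : forall F G : functor E' C', F ⟹ G -> K F ⟹ K G.
Variable e : forall F, K F ⟹ F.
Arguments Km {F G} _.
Hypothesis Km_comm : forall (F G G' H : functor E' C') (b : G ⟹ H) (a : F ⟹ G)
  (b' : G' ⟹ H) (a' : F ⟹ G') X, (forall Y, b Y ∘ a Y = b' Y ∘ a' Y) ->
  Km b X ∘ Km a X = Km b' X ∘ Km a' X.
Hypothesis e_nat : forall (F G : functor E' C') (a : F ⟹ G) X,
  e G X ∘ Km a X = a X ∘ e F X.
Hypothesis Km_bij : forall (F G : functor E' C') (a : F ⟹ G), nbij a -> nbij (Km a).
Variable T : functor E C -> functor E' C'.
Variable Tm : forall F G : functor E C, F ⟹ G -> T F ⟹ T G.
Arguments Tm {F G} _.
Hypothesis Tm_sub : forall (F G : functor E C) (a b : F ⟹ G) X,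
  Tm (ntsub a b) X = Tm a X - Tm b X.
Variable t : forall F, K (T F) ⟹ T (X2 S F).
Hypothesis t_eps : forall F X, Tm (xeps S F) X ∘ t F X = e (T F) X.
Hypothesis t_nat : forall (F G : functor E C) (a : F ⟹ G) X,
  Tm (X2_map S a) X ∘ t F X = t G X ∘ Km (Tm a) X.
Hypothesis t_bij : forall F, nbij (t F).

Fixpoint itt G k : iter k K (T G) ⟹ T (X2n S G k) :=
  match k return iter k K (T G) ⟹ T (X2n S G k) with
  | 0 => @Nattr _ _ (T G) (T G) (fun X => idm _)
           (fun X Y f => etrans (cmp1m _) (esym (cmpm1 _)))
  | k'.+1 => ntcomp (t (X2n S G k')) (Km (itt G k'))
  end.

Lemma itt_b G k X :
  Tm (xb S G k) X ∘ itt G k.+1 X = itt G k X ∘ itb (@Km) e (T G) k X.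
Proof.
have st j Y : itt G j.+1 Y = t (X2n S G j) Y ∘ Km (itt G j) Y by [].
have eps_t j Y : Tm (xeps S (X2n S G j)) Y ∘ itt G j.+1 Y =
    itt G j Y ∘ e (iter j K (T G)) Y.
  by rewrite st cmpA t_eps e_nat.
elim: k X => [|k IH] X; first exact: eps_t.
rewrite [xb S G k.+1]/(ntsub (xeps S (X2n S G k.+1)) (X2_map S (xb S G k))) Tm_sub.
rewrite cmpDl cmpNm eps_t.
rewrite [itb _ _ _ k.+1 X]/(e (iter k.+1 K (T G)) X - Km (itb (@Km) e (T G) k) X).
rewrite cmpDr cmpmN; congr (_ - _).
rewrite [in LHS]st cmpA t_nat -cmpA [in RHS]st -[RHS]cmpA; congr (_ ∘ _).
exact: Km_comm.
Qed.

Lemma itt_map F G (a : F ⟹ G) k X :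
  Tm (X2n_map S a k) X ∘ itt F k X = itt G k X ∘ itm (@Km) (Tm a) k X.
Proof.
elim: k X => [|k IH] X; first by rewrite /= cmp1m cmpm1.
have st H j Y : itt H j.+1 Y = t (X2n S H j) Y ∘ Km (itt H j) Y by [].
rewrite -[X2n_map S a k.+1]/(X2_map S (X2n_map S a k)) !st cmpA t_nat.
rewrite -[LHS]cmpA -[RHS]cmpA; congr (_ ∘ _).
exact: Km_comm.
Qed.

Lemma itt_bij G k : nbij (itt G k).
Proof.
elim: k => [|k IH]; last by apply: nbij_comp; [exact: Km_bij | exact: t_bij].
move=> X U; split=> [x|y]; first by rewrite /= cmp1m.
by exists y; rewrite /= cmp1m.
Qed.

End Compare.

Definition ev (A : preadd) n : functor (Ch_preadd A) A :=
  @Functor (Ch_preadd A) A (fun D => (D : cpx A) n) (fun D K (f : chmap D K) => f n)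
    (fun=> erefl) (fun _ _ _ _ _ => erefl).

Lemma chE (A : preadd) (C D : cpx A) (f g : chmap C D) : f = g -> forall n, f n = g n.
Proof. by move=> ->. Qed.

(** * The operator [P] and its unit *)

Section Linearization.
Variables (E : preadd) (S : slot E) (A : kadd).
Implicit Types F G H : functor E (Ch A).

Definition nweq F G (a : F ⟹ G) : Prop := forall X, weq (a X : chmap (F X) (G X)).

Definition nacyclic F : Prop := forall X, acyclic (F X).

Lemma X2_nweq F G (a : F ⟹ G) : nweq a -> nweq (X2_map S a).
Proof.
move=> wa X; apply: (weq_retract (f := a (dbl S X)) (i := xin S F X) (r := xret S F X)
  (j := xin S G X) (s := xret S G X)) => // n.
- exact: (chE (xretK S F X) n).
- exact: (chE (xretK S G X) n).
- exact: (chE (esym (X2_mapE S a X)) n).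
- exact: (chE (xret_nat S a X) n).
Qed.

Lemma X2_nacyclic F : nacyclic F -> nacyclic (X2 S F).
Proof.
move=> aF X n T x cx; have [y e] := aF _ _ _ _ (cyc_map (xin S F X) cx).
exists ((xret S F X : chmap _ _) n.+1 ∘ y); rewrite -chm_cd -e cmpA.
by rewrite [X in X ∘ _](chE (xretK S F X) n) [RHS]cmp1m.
Qed.

Lemma X2n_nweq F G (a : F ⟹ G) k : nweq a -> nweq (X2n_map S a k).
Proof. by move=> wa; elim: k => [//|k IH]; apply: X2_nweq. Qed.

Definition P F : functor E (Ch A) := fcomp (Tot A) (Pc S F).

Fact P_map_nat F G (a : F ⟹ G) X Y (f : hom X Y) :
  fmor (Tot A) (Pc_map S a Y) ∘ fmor (P F) f = fmor (P G) f ∘ fmor (Tot A) (Pc_map S a X).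
Proof.
rewrite -(fmorM (Tot A)) -[RHS](fmorM (Tot A)); congr (fmor (Tot A) _).
exact: (ntP (Pc_map S a)).
Qed.

Definition P_map F G (a : F ⟹ G) : P F ⟹ P G :=
  @Nattr E (Ch A) (P F) (P G) (fun X => fmor (Tot A) (Pc_map S a X)) (P_map_nat a).

Lemma P_nweq F G (a : F ⟹ G) : nweq a -> nweq (P_map a).
Proof.
by move=> wa X; apply: (@totc_weq _ 0) => p; apply: X2n_nweq.
Qed.

Lemma P_nacyclic F : nacyclic F -> nacyclic (P F).
Proof.
move=> aF X; apply: (@totc_acyclic _ 0) => p.
by elim: p X => [|p IH] X; [exact: aF | apply: X2_nacyclic].
Qed.

Lemma P_mapM F G H (b : G ⟹ H) (a : F ⟹ G) (c : F ⟹ H) X :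
  (forall Y, c Y = b Y ∘ a Y) -> P_map c X = P_map b X ∘ P_map a X.
Proof.
move=> cE; rewrite -[RHS](fmorM (Tot A)); congr (fmor (Tot A) _).
by apply: chmap_eq => k; apply: X2n_mapM.
Qed.

Lemma P_map1 F (a : F ⟹ F) X : (forall Y, a Y = idm _) -> P_map a X = idm _.
Proof.
move=> a1; rewrite -[RHS](fmor1 (Tot A)); congr (fmor (Tot A) _).
by apply: chmap_eq => k; apply: X2n_map1.
Qed.

Lemma P_mapD F G (a b c : F ⟹ G) X :
  (forall Y, c Y = a Y + b Y) -> P_map c X = P_map a X + P_map b X.
Proof.
move=> cE; apply: chmap_eq => n; apply: tot_morD => p q.
exact: (chE (X2n_mapD S p X cE) q).
Qed.

Lemma P_map0 F G (a : F ⟹ G) X : (forall Y, a Y = 0) -> P_map a X = 0.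
Proof.
move=> a0; apply: (addrI (P_map a X)).
by rewrite -(P_mapD (c := a)) ?addr0 // => Y; rewrite a0 addr0.
Qed.

Lemma P_mapB F G (a b c : F ⟹ G) X :
  (forall Y, c Y = a Y - b Y) -> P_map c X = P_map a X - P_map b X.
Proof.
move=> cE; apply/eqP; rewrite eq_sym subr_eq; apply/eqP.
by apply: P_mapD => Y; rewrite cE subrK.
Qed.

Fact peta_nat F X Y (f : hom X Y) :
  (col (Pc S F Y) : @hom (Ch A) (F Y) (P F Y)) ∘ fmor F f =
  fmor (P F) f ∘ (col (Pc S F X) : @hom (Ch A) (F X) (P F X)).
Proof. by apply: chmap_eq => n; symmetry; apply: (tot_in_mor (fmor (Pc S F) f)). Qed.

Definition peta F : F ⟹ P F :=
  @Nattr E (Ch A) F (P F) (fun X => col (Pc S F X)) (peta_nat F).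

Lemma peta_map F G (a : F ⟹ G) X : peta G X ∘ a X = P_map a X ∘ peta F X.
Proof. by apply: chmap_eq => n; symmetry; apply: (tot_in_mor (Pc_map S a X)). Qed.

(* [F] is of degree at most 1 in the coordinate [S]. *)
Definition affine F : Prop := nacyclic (X2 S F).

(** All columns of [Pc S F] after column 0 are iterated cross effects of [F], hence acyclic. *)
Lemma peta_nweq F : affine F -> nweq (peta F).
Proof.
move=> aF X; suff w : weq (col (Pc S F X)) by exact: w.
apply: col_weq => p.
by elim: p X => [|p IH] X; [exact: aF | apply: X2_nacyclic].
Qed.

Lemma affine_nweq F G (a : F ⟹ G) : nweq a -> affine F <-> affine G.
Proof.
move=> wa; split=> h X.
  exact: weq_acyclic_r (h X) (X2_nweq wa X).
exact: weq_acyclic_l (h X) (X2_nweq wa X).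
Qed.

End Linearization.

(** * [P F] has degree at most 1 *)

Section AffineApproximation.
Variables (E : preadd) (S : slot E).

Lemma X2_xb_delta0 (C : kadd) (G : functor E C) X :
  X2_map S (xb S G 0) X ∘ xdelta S G X = idm _.
Proof. exact: X2_eps_delta. Qed.

(** A contraction of the resolution after applying [X2], now with the comultiplication at the
    outermost place: the counit law gives the identity, naturality of [xdelta] the other term. *)
Lemma X2_xb_deltaS (C : kadd) (G : functor E C) k X :
  X2_map S (xb S G k.+1) X ∘ xdelta S (X2n S G k.+1) X =
  idm _ - xdelta S (X2n S G k) X ∘ X2_map S (xb S G k) X.
Proof.
rewrite (@X2_mapB _ S _ _ _ (xeps S (X2n S G k.+1)) (X2_map S (xb S G k))) //.
by rewrite cmpDl cmpNm X2_eps_delta (xdelta_nat S (xb S G k)).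
Qed.

Variable A : kadd.
Implicit Types F G H : functor E (Ch A).

Lemma xlift_ch F X q (U : A) (z : hom U ((F (dbl S X) : cpx A) q)) :
  (fmor F (sp1 S X) : chmap _ _) q ∘ z = 0 -> (fmor F (sp2 S X) : chmap _ _) q ∘ z = 0 ->
  exists u : hom U ((X2 S F X : cpx A) q), (xin S F X : chmap _ _) q ∘ u = z.
Proof.
move=> z1 z2; exists (klift ((xproj S F X : chmap _ _) q) z); apply: kin_lift.
rewrite -[LHS]/(bpair _ _ ∘ z) pair_cmp.
by rewrite [X in bpair X _]z1 [X in bpair _ X]z2 /bpair !cmpm0 addr0.
Qed.

Lemma tot_mor_0 (C D : cpx (Ch A)) n (f : chmap C D) :
  (forall p q, bmor f p q = 0) -> tot_mor f n = 0.
Proof.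
move=> f0; apply: (addrI (tot_mor f n)).
by rewrite -(tot_morD n (h := f)) ?addr0 // => p q; rewrite f0 addr0.
Qed.

Fact X2_Pc_dd F X k : X2_map S (xb S F k) X ∘ X2_map S (xb S F k.+1) X = 0.
Proof.
rewrite -(X2_mapM S (c := ntcomp (xb S F k) (xb S F k.+1))) //.
by apply: X2_map0 => Y; apply: xb_xb.
Qed.

Definition X2_Pc F X : cpx (Ch A) :=
  @Cpx (Ch A) (fun k => X2 S (X2n S F k) X) (fun k => X2_map S (xb S F k) X) (X2_Pc_dd F X).

Definition X2_Pc_in F X : chmap (X2_Pc F X) (Pc S F (dbl S X)) :=
  @Chmap (Ch A) (X2_Pc F X) (Pc S F (dbl S X)) (fun k => xin S (X2n S F k) X)
    (fun k => esym (X2_mapE S (xb S F k) X)).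

Lemma X2_Pc_rows F X q : acyclic (rowc (X2_Pc F X) q).
Proof.
have bhE p : bh (X2_Pc F X) p q = (X2_map S (xb S F p) X : chmap _ _) q by [].
move=> [|p] U z cz.
  exists ((xdelta S F X : chmap _ _) q ∘ z).
  by rewrite [cd _ 0]bhE cmpA [X in X ∘ _](chE (X2_xb_delta0 F X) q) [RHS]cmp1m.
exists ((xdelta S (X2n S F p.+1) X : chmap _ _) q ∘ z).
rewrite [cd _ p.+1]bhE cmpA [X in X ∘ _](chE (X2_xb_deltaS F p X) q).
rewrite -[X in X ∘ z]/(idm _ - (xdelta S (X2n S F p) X : chmap _ _) q ∘
  (X2_map S (xb S F p) X : chmap _ _) q) -bhE cmpDl cmpNm -cmpA.
by rewrite [bh (X2_Pc F X) p q ∘ z]cz cmpm0 subr0 cmp1m.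
Qed.

(** The cross effect of a total complex is the total complex of the cross effects, here of [X2_Pc].
    The rows of that double complex are contracted by the comultiplication. *)
Lemma P_affine F : affine S (P S F).
Proof.
move=> X n T x cx.
pose R := X2_Pc F X.
pose i := X2_Pc_in F X.
pose f1 : chmap (Pc S F (dbl S X)) (Pc S F X) := fmor (Pc S F) (sp1 S X).
pose f2 : chmap (Pc S F (dbl S X)) (Pc S F X) := fmor (Pc S F) (sp2 S X).
have aR : acyclic (totc 0 R) by apply: totc_acyclic_rows => q; apply: X2_Pc_rows.
pose xi : @hom (Ch A) _ _ := xin S (P S F) X.
have xiE m : cd (P S F (dbl S X) : cpx A) m ∘ (xi : chmap _ _) m.+1 =
   (xi : chmap _ _) m ∘ cd (X2 S (P S F) X : cpx A) m by exact: chmP.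
have f1x m T' (z : hom T' ((X2 S (P S F) X : cpx A) m)) :
    tot_mor f1 m ∘ ((xi : chmap _ _) m ∘ z) = 0.
  by rewrite cmpA [X in X ∘ z](chE (xin1 S (P S F) X) m) [LHS]cmp0m.
have f2x m T' (z : hom T' ((X2 S (P S F) X : cpx A) m)) :
    tot_mor f2 m ∘ ((xi : chmap _ _) m ∘ z) = 0.
  by rewrite cmpA [X in X ∘ z](chE (xin2 S (P S F) X) m) [LHS]cmp0m.
have fi m : tot_mor f1 m ∘ tot_mor i m = 0 /\ tot_mor f2 m ∘ tot_mor i m = 0.
  split.
    rewrite -[LHS](chE (tot_mapM f1 i) m) /=; apply: tot_mor_0 => p q.
    exact: (chE (xin1 S (X2n S F p) X) q).
  rewrite -[LHS](chE (tot_mapM f2 i) m) /=; apply: tot_mor_0 => p q.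
  exact: (chE (xin2 S (X2n S F p) X) q).
have mi m T' (z : hom T' (tot_ob R m)) : tot_mor i m ∘ z = 0 -> z = 0.
  apply: tot_mor_mono => q p T'' y e; apply: (@kin_mono _ _ _ ((xproj S (X2n S F p) X : chmap _ _) q)).
  by rewrite cmpm0.
(* An element of the cross effect of [P F] is killed by both projections in each entry, so it comes
   from the total complex of [X2_Pc]. *)
have [u eu] : exists u, tot_mor i n ∘ u = (xi : chmap _ _) n ∘ x.
  apply: (tot_kernel _ (f1x _ _ _) (f2x _ _ _)) => p q U z z1 z2.
  exact: (@xlift_ch (X2n S F p) X q U z z1 z2).
have cu : @cyc _ (totc 0 R) n T u.
  case: n u x cx eu => [//|n] u x cx eu; apply: mi.
  rewrite cmpA -[tot_mor i n ∘ _](tot_mor_d 0 i n) -cmpA eu cmpA.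
  by rewrite [X in X ∘ x]xiE -cmpA [_ ∘ x]cx cmpm0.
have [y ey] := aR _ _ _ cu.
have [w ew] : exists w : hom T ((X2 S (P S F) X : cpx A) n.+1),
    (xi : chmap _ _) n.+1 ∘ w = tot_mor i n.+1 ∘ y.
  apply: xlift_ch; rewrite [LHS]cmpA; have [h1 h2] := fi n.+1.
    by rewrite [X in X ∘ y]h1 cmp0m.
  by rewrite [X in X ∘ y]h2 cmp0m.
exists w; apply: (@kin_mono _ _ _ ((xproj S (P S F) X : chmap _ _) n)).
rewrite -[LHS]eu ey cmpA -[tot_mor i n ∘ _](tot_mor_d 0 i n) -cmpA -ew cmpA.
by rewrite [X in X ∘ w]xiE -cmpA.
Qed.

End AffineApproximation.

(** * Rows of the resolution *)

Section RelAcyclic.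
Variable A : kadd.
Implicit Types C D : cpx A.

Lemma rel_acyclic_acyclic C D (f : chmap C D) : rel_acyclic f -> acyclic C -> acyclic D.
Proof.
move=> [mf ef] aC n T z cz; have [|w [a ez]] := ef n T z.
  by case: n z cz => [//|n] z /= ->; exists 0; rewrite cmpm0.
have ca : cyc a.
  case: n z cz w a ez => [//|n] z cz w a ez; apply: (mf n).
  by rewrite chm_cd; move: cz; rewrite /cyc ez cmpDr (cmpA (cd D n)) cdd cmp0m add0r.
have [v ev] := aC _ _ _ ca.
by exists (w + f n.+1 ∘ v); rewrite cmpDr -chm_cd -ev.
Qed.

Lemma rel_acyclic_bij C D C' D' (f : chmap C D) (f' : chmap C' D')
    (a : chmap C' C) (b : chmap D' D) :
  (forall n T, (forall x : hom T (C' n), a n ∘ x = 0 -> x = 0) /\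
               (forall y : hom T (C n), exists x, a n ∘ x = y)) ->
  (forall n T, (forall x : hom T (D' n), b n ∘ x = 0 -> x = 0) /\
               (forall y : hom T (D n), exists x, b n ∘ x = y)) ->
  (forall n, f n ∘ a n = b n ∘ f' n) -> rel_acyclic f' -> rel_acyclic f.
Proof.
move=> ba bb e [mf ef]; split=> [n T x fx|n T z rz].
  have [x' ex] := (ba n T).2 x; rewrite -ex [x'](mf n) ?cmpm0 //.
  by apply: (bb n T).1; rewrite cmpA -e -cmpA ex.
have [z' ez] := (bb n T).2 z; have [|w [c ec]] := ef n T z'.
  case: n z rz z' ez => [//|n] z [c ec] z' ez.
  have [c' ec'] := (ba n T).2 c; exists c'.
  apply/eqP; rewrite -subr_eq0; apply/eqP/(bb n T).1.
  by rewrite cmpDr cmpmN chm_cd ez ec -ec' !cmpA e subrr.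
exists (b n.+1 ∘ w), (a n ∘ c).
by rewrite -ez ec cmpDr chm_cd !cmpA e.
Qed.

End RelAcyclic.

Section Rows.
Variables (E : preadd) (S : slot E) (A : kadd).
Implicit Types (U V G Q : functor E A).

Lemma X2n_nbij U V (a : U ⟹ V) k : nbij a -> nbij (X2n_map S a k).
Proof. by move=> ba; elim: k => [//|k IH]; apply: X2_nbij. Qed.

Lemma Pc_nbij_weq U V (a : U ⟹ V) X : nbij a -> weq (Pc_map_at S a X).
Proof.
move=> ba; apply: weq_bij => [n T x|n T y]; first exact: (X2n_nbij n ba X T).1.
exact: (X2n_nbij n ba X T).2.
Qed.

Lemma Pc_nbij_acyclic U V (a : U ⟹ V) X : nbij a -> acyclic (Pc S U X) ->
  acyclic (Pc S V X).
Proof. by move=> ba aU; apply: weq_acyclic_r aU (Pc_nbij_weq X ba). Qed.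

(** [Pc] is additive in natural transformations. Hence [t], which kills [G], sends relative cycles
    to cycles of [Pc S Q]; these bound, and [s] carries the bounding chain back, the remaining
    component [b r] lying in the image of [b]. *)
Lemma Pc_split U G Q (b : G ⟹ U) (r : U ⟹ G) (s : Q ⟹ U) (t : U ⟹ Q) X :
  (forall Y, r Y ∘ b Y = idm _) -> (forall Y, t Y ∘ b Y = 0) ->
  (forall Y, b Y ∘ r Y + s Y ∘ t Y = idm _) -> acyclic (Pc S Q X) ->
  rel_acyclic (Pc_map_at S b X).
Proof.
move=> rb tb brst aQ.
have rbn k Y : X2n_map S r k Y ∘ X2n_map S b k Y = idm _.
  by rewrite -(X2n_mapM S k (c := ntcomp r b)) // X2n_map1.
have tbn k Y : X2n_map S t k Y ∘ X2n_map S b k Y = 0.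
  rewrite -(X2n_mapM S k (c := ntcomp t b)) //.
  by elim: k Y => [|k IH] Y; [exact: tb | apply: X2_map0].
have brstn k Y : X2n_map S b k Y ∘ X2n_map S r k Y +
    X2n_map S s k Y ∘ X2n_map S t k Y = idm _.
  rewrite -(X2n_mapM S k (c := ntcomp b r)) // -(X2n_mapM S k (c := ntcomp s t)) //.
  pose c : U ⟹ U := @Nattr _ _ U U (fun X => idm _)
           (fun X Y f => etrans (cmp1m _) (esym (cmpm1 _))).
  by rewrite -(X2n_mapD S k (c := c)) ?X2n_map1 // => Z; rewrite [RHS]brst.
split=> [n T x|n T z rz].
  by move=> /(congr1 (cmp (X2n_map S r n X))); rewrite cmpA rbn cmp1m cmpm0.
have [|w ew] := aQ n T (X2n_map S t n X ∘ z).
  case: n z rz => [//|n] z [a ea]; rewrite /cyc [LHS]cmpA.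
  rewrite [X in X ∘ z](xb_map S t) -cmpA [_ ∘ z]ea cmpA.
  by rewrite [X in X ∘ a]tbn cmp0m.
exists (X2n_map S s n.+1 X ∘ w), (X2n_map S r n X ∘ z).
rewrite -{1}[z]cmp1m -[idm _](brstn n X) cmpDl -!cmpA addrC; congr (_ + _).
rewrite ew cmpA -[X in X ∘ w](xb_map S s); exact: esym (cmpA _ _ _).
Qed.

End Rows.

Section Evaluation.
Variables (E : preadd) (S : slot E) (A : kadd) (q : nat).
Implicit Types F G : functor E (Ch A).

(** Fixing the internal degree [q] identifies a row of [Pc S F], up to the isomorphism [ev_row],
    with [Pc] of a functor to [A] itself. There the degrees of a total complex split as direct sums,
    although the complex does not. *)
Definition evf F : functor E A := fcomp (ev A q) F.

Definition evm F G (a : F ⟹ G) : evf F ⟹ evf G :=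
  @Nattr _ _ (evf F) (evf G) (fun X => (a X : chmap _ _) q)
    (fun X Y f => chE (ntP a f) q).

Definition ev_at F X : hom (X2 S (evf F) X) ((X2 S F X : cpx A) q) :=
  klift ((xproj S F X : chmap _ _) q) (xin S (evf F) X).

Lemma ev_atE F X : (xin S F X : chmap _ _) q ∘ ev_at F X = xin S (evf F) X.
Proof.
have [u eu] := xlift_ch (xin1 S (evf F) X) (xin2 S (evf F) X).
apply: kin_lift; rewrite -eu cmpA.
by rewrite [X in X ∘ u](chE (kinK (xproj S F X)) q) [LHS]cmp0m.
Qed.

Lemma ev_mono F X T (u v : hom T ((X2 S F X : cpx A) q)) :
  (xin S F X : chmap _ _) q ∘ u = (xin S F X : chmap _ _) q ∘ v -> u = v.
Proof. exact: kin_mono. Qed.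

Fact ev_atP F X Y (f : hom X Y) :
  ev_at F Y ∘ fmor (X2 S (evf F)) f = fmor (evf (X2 S F)) f ∘ ev_at F X.
Proof.
apply: ev_mono; rewrite cmpA ev_atE xin_nat [RHS]cmpA.
rewrite [X in _ = X ∘ _](chE (xin_nat S F f) q) -[RHS]cmpA.
by congr (_ ∘ _); rewrite ev_atE.
Qed.

Definition evt F : X2 S (evf F) ⟹ evf (X2 S F) :=
  @Nattr _ _ (X2 S (evf F)) (evf (X2 S F)) (ev_at F) (@ev_atP F).

Lemma evt_eps F X : evm (xeps S F) X ∘ evt F X = xeps S (evf F) X.
Proof. by rewrite -[LHS]cmpA; congr (_ ∘ _); apply: ev_atE. Qed.

Lemma evt_nat F G (a : F ⟹ G) X :
  evm (X2_map S a) X ∘ evt F X = evt G X ∘ X2_map S (evm a) X.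
Proof.
have e : (xin S G X : chmap _ _) q ∘ (X2_map S a X : chmap _ _) q =
    (a (dbl S X) : chmap _ _) q ∘ (xin S F X : chmap _ _) q := chE (X2_mapE S a X) q.
apply: ev_mono; rewrite [RHS]cmpA -[X in _ = X ∘ _]/(_ ∘ ev_at G X) ev_atE X2_mapE.
rewrite [LHS]cmpA -[X in X ∘ _ = _]/(_ ∘ (X2_map S a X : chmap _ _) q) e.
by rewrite -[LHS]cmpA -[X in _ ∘ X]/(_ ∘ ev_at F X) ev_atE.
Qed.

Lemma evt_bij F : nbij (evt F).
Proof.
move=> X T; split=> [x e|y].
  by apply: xin_mono; rewrite -ev_atE -cmpA [ev_at F X ∘ x]e !cmpm0.
exists (@xlift E S A (evf F) X T ((xin S F X : chmap _ _) q ∘ y)); apply: ev_mono.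
rewrite cmpA [X in X ∘ _]ev_atE; apply: (@xliftE E S A (evf F) X T).
  by rewrite cmpA [X in X ∘ y](chE (xin1 S F X) q) [LHS]cmp0m.
by rewrite cmpA [X in X ∘ y](chE (xin2 S F X) q) [LHS]cmp0m.
Qed.

Fact evm_sub F G (a b : F ⟹ G) X : evm (ntsub a b) X = evm a X - evm b X.
Proof. by []. Qed.

Definition evn := @itt E S (Ch A) E A (@X2 E S A) (@X2_map E S A) evf evt.

Fact ev_rowP F X k :
  cd (rowc (Pc S F X) q) k ∘ evn F k.+1 X = evn F k X ∘ cd (Pc S (evf F) X) k.
Proof.
refine (@itt_b E S (Ch A) E A (@X2 E S A) (@X2_map E S A) (@xeps E S A)
  _ _ evf (@evm) _ evt _ _ F k X).
- by move=> *; apply: X2_map_comm.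
- by move=> *; apply: xeps_nat.
- exact: evm_sub.
- exact: evt_eps.
- exact: evt_nat.
Qed.

Definition ev_row F X : chmap (Pc S (evf F) X) (rowc (Pc S F X) q) :=
  @Chmap A (Pc S (evf F) X) (rowc (Pc S F X) q) (fun k => evn F k X) (ev_rowP F X).

Lemma ev_row_bij F X n T :
  (forall x : hom T (Pc S (evf F) X n), ev_row F X n ∘ x = 0 -> x = 0) /\
  (forall y, exists x : hom T (Pc S (evf F) X n), ev_row F X n ∘ x = y).
Proof.
refine (@itt_bij E S (Ch A) E A (@X2 E S A) (@X2_map E S A) _ evf evt _ F n X T).
- by move=> *; apply: X2_nbij.
- exact: evt_bij.
Qed.

Lemma ev_row_map F G (a : F ⟹ G) X n :
  rowmap (Pc_map_at S a X) q n ∘ ev_row F X n = ev_row G X n ∘ Pc_map_at S (evm a) X n.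
Proof.
refine (@itt_map E S (Ch A) E A (@X2 E S A) (@X2_map E S A) _ evf (@evm) evt _ F G a n X).
- by move=> *; apply: X2_map_comm.
- exact: evt_nat.
Qed.

End Evaluation.

(** * [P] inverts its unit *)

Section Idempotence.
Variables (E : preadd) (S : slot E) (A : kadd).
Implicit Types F G : functor E (Ch A).

Fact shift_map1 (C : cpx (Ch A)) :
  (shift_map (chid C) : @hom (Ch (Ch A)) (shift C) (shift C)) = idm (shift C : Ch (Ch A)).
Proof. exact: chmap_eq. Qed.

Fact shift_mapM (C D K : cpx (Ch A)) (g : chmap D K) (f : chmap C D) :
  shift_map (chcmp g f) = chcmp (shift_map g) (shift_map f).
Proof. exact: chmap_eq. Qed.

Definition shiftf : functor (Ch (Ch A)) (Ch (Ch A)) :=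
  @Functor (Ch (Ch A)) (Ch (Ch A)) (@shift A) (@shift_map A) shift_map1 shift_mapM.

Definition totq n : functor (Ch (Ch A)) A := fcomp (ev A n) (Tot A).

Fact bobq1 p q (C : cpx (Ch A)) : bmor (chid C) p q = idm (bob C p q).
Proof. by []. Qed.

Fact bobqM p q (C D K : cpx (Ch A)) (g : chmap D K) (f : chmap C D) :
  bmor (chcmp g f) p q = bmor g p q ∘ bmor f p q.
Proof. by []. Qed.

Definition bobq p q : functor (Ch (Ch A)) A :=
  @Functor (Ch (Ch A)) A (fun C => bob C p q) (fun C D f => bmor f p q)
    (bobq1 p q) (bobqM p q).

(** A degree of a total complex is a finite natural direct sum of entries, so acyclicity of [Pc] may
    be checked on the entries; [Pc_split] removes the entry in column 0. *)
Lemma totq_acyclic n (K : functor E (Ch (Ch A))) X :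
  (forall p q, acyclic (Pc S (fcomp (bobq p q) K) X)) ->
  acyclic (Pc S (fcomp (totq n) K) X).
Proof.
elim: n K => [|n IH] K aK.
  pose V := fcomp (bobq 0 0) K; pose W := fcomp (totq 0) K.
  have aN Y Z (f : hom Y Z) : idm (V Z) ∘ fmor V f = fmor W f ∘ idm (V Y).
    by rewrite cmp1m cmpm1.
  apply: (Pc_nbij_acyclic (a := @Nattr E A V W (fun X => idm (V X)) aN)) (aK 0%N 0%N).
  by move=> Y T; split=> [x|y]; [rewrite /= cmp1m | exists y; rewrite /= cmp1m].
pose U := fcomp (totq n.+1) K; pose G := fcomp (bobq 0 n.+1) K.
pose Q := fcomp (totq n) (fcomp shiftf K).
have aQ : acyclic (Pc S Q X).
  apply: IH => p q.
  pose V := fcomp (bobq p.+1 q) K; pose W := fcomp (bobq p q) (fcomp shiftf K).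
  have aN Y Z (f : hom Y Z) : idm (V Z) ∘ fmor V f = fmor W f ∘ idm (V Y).
    by rewrite cmp1m cmpm1.
  apply: (Pc_nbij_acyclic (a := @Nattr E A V W (fun X => idm (V X)) aN)) (aK p.+1 q).
  by move=> Y T; split=> [x|y]; [rewrite /= cmp1m | exists y; rewrite /= cmp1m].
have bN Y Z (f : hom Y Z) : in1 ∘ fmor G f = fmor U f ∘ in1.
  by rewrite /= /bimap pair_cmp -!cmpA pr1_in1 pr2_in1 cmpm1 cmpm0 /bpair cmpm0 addr0.
have sN Y Z (f : hom Y Z) : in2 ∘ fmor Q f = fmor U f ∘ in2.
  by rewrite /= /bimap pair_cmp -!cmpA pr1_in2 pr2_in2 cmpm1 cmpm0 /bpair cmpm0 add0r.
have rN Y Z (f : hom Y Z) : pr1 ∘ fmor U f = fmor G f ∘ pr1 by exact: pr1_bimap.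
have tN Y Z (f : hom Y Z) : pr2 ∘ fmor U f = fmor Q f ∘ pr2 by exact: pr2_bimap.
pose b : G ⟹ U := @Nattr _ _ G U (fun X => in1) bN.
pose s : Q ⟹ U := @Nattr _ _ Q U (fun X => in2) sN.
pose r : U ⟹ G := @Nattr _ _ U G (fun X => pr1) rN.
pose t : U ⟹ Q := @Nattr _ _ U Q (fun X => pr2) tN.
apply: (@rel_acyclic_acyclic _ (Pc S G X) (Pc S U X) (Pc_map_at S b X));
  last exact: (aK 0%N n.+1).
by apply: (@Pc_split _ _ _ U G Q b r s t) => // Y;
  rewrite /= ?pr1_in1 ?pr2_in1 ?bipP.
Qed.

(** In a fixed degree, [P F] is [F] plus entries of cross effects [X2 (X2^p F)]. On the latter [Pc]
    is contracted by the comultiplication, so [peta] adds only an acyclic complement to each row. *)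
Lemma peta_rel_acyclic F X q : rel_acyclic (rowmap (Pc_map_at S (peta S F) X) q).
Proof.
apply: (rel_acyclic_bij (@ev_row_bij _ S A q F X) (@ev_row_bij _ S A q (P S F) X)
  (@ev_row_map _ S A q F (P S F) (peta S F) X)).
pose b := evm q (peta S F); pose U := evf q (P S F); pose G := evf q F.
case: q @b @U @G => [|q] b U G.
  have rN Y Z (f : hom Y Z) : idm (G Z) ∘ fmor U f = fmor G f ∘ idm (U Y).
    by rewrite cmp1m cmpm1.
  pose r : U ⟹ G := @Nattr E A U G (fun X => idm (U X)) rN.
  have zN (V W : functor E A) Y Z (f : hom Y Z) :
      (0 : hom (V Z) (W Z)) ∘ fmor V f = fmor W f ∘ 0 by rewrite cmpm0 cmp0m.
  (* In degree 0 nothing is added to [F]: the complement is reached only by zero maps, and [X2 S G]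
     is merely a functor with acyclic [Pc]. *)
  pose Q : functor E A := X2 S G.
  apply: (@Pc_split _ _ _ U G Q b r (Nattr (@zN Q U)) (Nattr (@zN U Q))) => [Y|Y|Y|].
  - by rewrite /= cmp1m.
  - by rewrite /= cmp0m.
  - by rewrite /= cmp1m cmp0m addr0.
  - exact: Pc_X2_acyclic.
pose Q := fcomp (totq q) (fcomp shiftf (Pc S F)).
have sN Y Z (f : hom Y Z) : in2 ∘ fmor Q f = fmor U f ∘ in2.
  by rewrite /= /bimap pair_cmp -!cmpA pr1_in2 pr2_in2 cmpm1 cmpm0 /bpair cmpm0 add0r.
have rN Y Z (f : hom Y Z) : pr1 ∘ fmor U f = fmor G f ∘ pr1 by exact: pr1_bimap.
have tN Y Z (f : hom Y Z) : pr2 ∘ fmor U f = fmor Q f ∘ pr2 by exact: pr2_bimap.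
pose s : Q ⟹ U := @Nattr _ _ Q U (fun X => in2) sN.
pose r : U ⟹ G := @Nattr _ _ U G (fun X => pr1) rN.
pose t : U ⟹ Q := @Nattr _ _ U Q (fun X => pr2) tN.
apply: (@Pc_split _ _ _ U G Q b r s t) => [Y|Y|Y|].
- exact: pr1_in1.
- exact: pr2_in1.
- exact: bipP.
apply: totq_acyclic => p j.
pose V := evf j (X2 S (X2n S F p)); pose W := fcomp (bobq p j) (fcomp shiftf (Pc S F)).
have aN Y Z (f : hom Y Z) : idm (V Z) ∘ fmor V f = fmor W f ∘ idm (V Y).
  by rewrite cmp1m cmpm1.
have aV : acyclic (Pc S V X).
  by apply: (Pc_nbij_acyclic (evt_bij S j (X2n S F p))); apply: Pc_X2_acyclic.
apply: (Pc_nbij_acyclic (a := @Nattr E A V W (fun X => idm (V X)) aN)) aV.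
by move=> Y T; split=> [x|y]; [rewrite /= cmp1m | exists y; rewrite /= cmp1m].
Qed.

Lemma P_peta_nweq F : nweq (P_map S (peta S F)).
Proof.
by move=> X; apply: (@totc_rows _ 0) => q; apply: peta_rel_acyclic.
Qed.

End Idempotence.

Section NaturalWeq.
Variables (E : preadd) (A : kadd).
Implicit Types F G H : functor E (Ch A).

Lemma nweq_comp F G H (b : G ⟹ H) (a : F ⟹ G) (c : F ⟹ H) :
  (forall X, c X = b X ∘ a X) -> nweq a -> nweq b -> nweq c.
Proof.
move=> cE wa wb X; apply: (weq_comp _ (wa X) (wb X)) => n.
exact: (chE (cE X) n).
Qed.

Lemma nweq_cancel_r F G H (b : G ⟹ H) (a : F ⟹ G) (c : F ⟹ H) :
  (forall X, c X = b X ∘ a X) -> nweq a -> nweq c -> nweq b.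
Proof.
move=> cE wa wc X; apply: (weq_cancel_r _ (wa X) (wc X)) => n.
exact: (chE (cE X) n).
Qed.

(** A natural equivalence has homotopy inverses at each object, but they need not be natural.
    Zigzags restore symmetry and can still be fed to operators on functors ([zz_map]). *)
Inductive zz : functor E (Ch A) -> functor E (Ch A) -> Prop :=
| zz_nweq F G (a : F ⟹ G) : nweq a -> zz F G
| zz_sym F G : zz F G -> zz G F
| zz_trans F G H : zz F G -> zz G H -> zz F H.

End NaturalWeq.

(** A substitution [L] that carries one doubling to the other up to isomorphism. Linearizing then
    commutes with precomposing by [L], which is how parameters are inserted into derivatives. *)
Record smor (E' E : preadd) (S' : slot E') (S : slot E) (L : functor E' E) := Smor {
  lam : forall X, hom (L (dbl S' X)) (dbl S (L X));
  mu : forall X, hom (dbl S (L X)) (L (dbl S' X));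
  lamN : forall X Y (f : hom X Y),
    lam Y ∘ fmor L (fmor (dbl S') f) = fmor (dbl S) (fmor L f) ∘ lam X;
  lamK : forall X, mu X ∘ lam X = idm _;
  muK : forall X, lam X ∘ mu X = idm _;
  lam1 : forall X, sp1 S (L X) ∘ lam X = fmor L (sp1 S' X);
  lam2 : forall X, sp2 S (L X) ∘ lam X = fmor L (sp2 S' X);
  lamm : forall X, sm S (L X) ∘ lam X = fmor L (sm S' X);
  lamz : forall X, sz S (L X) = fmor L (sz S' X) }.

(** * Change of doubling *)

Section SlotMorphism.
Variables (E' E : preadd) (S' : slot E') (S : slot E) (L : functor E' E).
Variable l : smor S' S L.

Section Target.
Variable C : kadd.
Implicit Types F G : functor E C.

Definition xl_at F X : hom (X2 S' (fcomp F L) X) (X2 S F (L X)) :=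
  xlift (fmor F (lam l X) ∘ xin S' (fcomp F L) X).

Lemma xl_atE F X : xin S F (L X) ∘ xl_at F X = fmor F (lam l X) ∘ xin S' (fcomp F L) X.
Proof.
apply: xliftE; rewrite cmpA -fmorM ?lam1 ?lam2; first exact: (xin1 S' (fcomp F L)).
exact: (xin2 S' (fcomp F L)).
Qed.

Fact xlP F X Y (f : hom X Y) :
  xl_at F Y ∘ fmor (X2 S' (fcomp F L)) f = fmor (fcomp (X2 S F) L) f ∘ xl_at F X.
Proof.
apply: xin_mono; rewrite cmpA xl_atE -cmpA xin_nat [RHS]cmpA xin_nat -[RHS]cmpA xl_atE.
rewrite [LHS]cmpA [RHS]cmpA; congr (_ ∘ _).
by rewrite -[LHS](fmorM F) -[RHS](fmorM F) lamN.
Qed.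

Definition xl F : X2 S' (fcomp F L) ⟹ fcomp (X2 S F) L :=
  @Nattr _ _ (X2 S' (fcomp F L)) (fcomp (X2 S F) L) (xl_at F) (@xlP F).

Lemma xl_eps F X : ntwhisker (xeps S F) L X ∘ xl F X = xeps S' (fcomp F L) X.
Proof.
rewrite -[LHS]/(fmor F (sm S (L X)) ∘ xin S F (L X) ∘ xl_at F X) -cmpA xl_atE.
by rewrite cmpA -(fmorM F) lamm.
Qed.

Lemma xl_nat F G (a : F ⟹ G) X :
  ntwhisker (X2_map S a) L X ∘ xl F X = xl G X ∘ X2_map S' (ntwhisker a L) X.
Proof.
apply: xin_mono; rewrite -[ntwhisker _ L X]/(X2_map S a (L X)).
rewrite -[nt (xl F) X]/(xl_at F X) -[nt (xl G) X]/(xl_at G X).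
rewrite cmpA X2_mapE -cmpA xl_atE [RHS]cmpA xl_atE -[RHS]cmpA X2_mapE.
by rewrite !cmpA; congr (_ ∘ _); apply: ntP.
Qed.

Lemma xl_bij F : nbij (xl F).
Proof.
move=> X T; split=> [x e|y].
  apply: xin_mono; rewrite cmpm0 -[xin _ _ _]cmp1m.
  rewrite -(fmor1 F) -(lamK l X) fmorM -[X in X ∘ _]cmpA -xl_atE -!cmpA.
  by rewrite [xl_at F X ∘ x]e !cmpm0.
exists (@xlift E' S' C (fcomp F L) X T (fmor F (mu l X) ∘ (xin S F (L X) ∘ y))).
apply: xin_mono; rewrite -[nt (xl F) X]/(xl_at F X) [LHS]cmpA. rewrite xl_atE -cmpA.
rewrite (@xliftE E' S' C (fcomp F L) X T).
- by rewrite cmpA -fmorM muK fmor1 cmp1m.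
- rewrite /= -(lam1 l) cmpA -fmorM -cmpA muK cmpm1.
  by rewrite cmpA xin1 cmp0m.
- rewrite /= -(lam2 l) cmpA -fmorM -cmpA muK cmpm1.
  by rewrite cmpA xin2 cmp0m.
Qed.

Definition xln :=
  @itt E S C E' C (@X2 E' S' C) (@X2_map E' S' C) (fun F => fcomp F L) xl.

Fact xln_b F X k :
  cd (Pc S F (L X)) k ∘ xln F k.+1 X = xln F k X ∘ cd (Pc S' (fcomp F L) X) k.
Proof.
refine (@itt_b E S C E' C (@X2 E' S' C) (@X2_map E' S' C) (@xeps E' S' C)
  _ _ (fun F => fcomp F L) (fun F G a => ntwhisker a L) _ xl _ _ F k X).
- by move=> *; apply: X2_map_comm.
- by move=> *; apply: xeps_nat.
- by [].
- exact: xl_eps.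
- exact: xl_nat.
Qed.

Lemma xln_bij F k : nbij (xln F k).
Proof.
refine (@itt_bij E S C E' C (@X2 E' S' C) (@X2_map E' S' C) _
  (fun F => fcomp F L) xl _ F k).
- by move=> *; apply: X2_nbij.
- exact: xl_bij.
Qed.

Definition Pcl_at F X : @hom (Ch C) (Pc S' (fcomp F L) X) (Pc S F (L X)) :=
  @Chmap C (Pc S' (fcomp F L) X) (Pc S F (L X)) (fun k => xln F k X) (fun k => xln_b F X k).

End Target.

Variable A : kadd.
Implicit Types F G : functor E (Ch A).

Fact Pl_nat F X Y (f : hom X Y) :
  fmor (Tot A) (Pcl_at F Y) ∘ fmor (P S' (fcomp F L)) f =
  fmor (fcomp (P S F) L) f ∘ fmor (Tot A) (Pcl_at F X).
Proof.
rewrite -(fmorM (Tot A)) -[RHS](fmorM (Tot A)); congr (fmor (Tot A) _).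
by apply: chmap_eq => k; apply: (ntP (xln F k)).
Qed.

Definition Pl F : P S' (fcomp F L) ⟹ fcomp (P S F) L :=
  @Nattr _ _ (P S' (fcomp F L)) (fcomp (P S F) L) (fun X => fmor (Tot A) (Pcl_at F X))
    (Pl_nat F).

Lemma tot_mor_surj n (C D : cpx (Ch A)) (f : chmap C D) T (y : hom T (tot_ob D n)) :
  (forall p q (y : hom T (bob D p q)), exists x, bmor f p q ∘ x = y) ->
  exists x, tot_mor f n ∘ x = y.
Proof.
elim: n C D f y => [|n IH] C D f y H; first exact: H.
have [a ea] := H _ _ (pr1 ∘ y).
have [|b eb] := IH _ _ (shift_map f) (pr2 ∘ y); first by move=> p; apply: (H p.+1).
by exists (bpair a b); rewrite [LHS]bimap_pair ea eb; apply: pair_eta.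
Qed.

Lemma nbij_inv (D D' : preadd) (U V : functor D D') (a : U ⟹ V) X : nbij a ->
  exists i, i ∘ a X = idm _ /\ a X ∘ i = idm _.
Proof.
move=> ba; have [i ai] := (ba X _).2 (idm _); exists i; split=> //.
apply/eqP; rewrite -subr_eq0; apply/eqP/(ba X _).1.
by rewrite cmpDr cmpmN cmpA ai cmp1m cmpm1 subrr.
Qed.

Lemma Pl_bij F X n T :
  (forall x : hom T (P S' (fcomp F L) X n), (Pl F X : chmap _ _) n ∘ x = 0 -> x = 0) /\
  (forall y, exists x : hom T (P S' (fcomp F L) X n), (Pl F X : chmap _ _) n ∘ x = y).
Proof.
have inv p q : exists i, i ∘ bmor (Pcl_at F X) p q = idm _ /\ bmor (Pcl_at F X) p q ∘ i = idm _.
  have [i [e1 e2]] := nbij_inv X (xln_bij F p).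
  exists ((i : chmap _ _) q); split; first exact: (chE e1 q).
  exact: (chE e2 q).
split=> [x|y].
  apply: tot_mor_mono => q p U z e; have [i [e1 _]] := inv p q.
  by rewrite -[z]cmp1m -[idm _]e1 -cmpA [_ ∘ z]e cmpm0.
apply: tot_mor_surj => p q z; have [i [_ e2]] := inv p q.
by exists (i ∘ z); rewrite cmpA e2 cmp1m.
Qed.

Lemma Pl_nweq F : nweq (Pl F).
Proof. by move=> X; apply: weq_bij => n T; case: (Pl_bij F X n T). Qed.

End SlotMorphism.

Section Projection.
Variables (E : preadd) (S : slot E) (L : functor E E) (l : smor S S L).
Variable q : forall X, hom (L X) X.
Hypothesis qN : forall X Y (f : hom X Y), q Y ∘ fmor L f = f ∘ q X.
Hypothesis ql : forall X, fmor (dbl S) (q X) ∘ lam l X = q (dbl S X).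

Fact nqP (C : preadd) (F : functor E C) X Y (f : hom X Y) :
  fmor F (q Y) ∘ fmor (fcomp F L) f = fmor F f ∘ fmor F (q X).
Proof. by rewrite -[LHS](fmorM F) qN fmorM. Qed.

Definition nq (C : preadd) (F : functor E C) : fcomp F L ⟹ F :=
  @Nattr _ _ (fcomp F L) F (fun X => fmor F (q X)) (nqP F).

Lemma xln_nq (C : kadd) (F : functor E C) k X :
  fmor (X2n S F k) (q X) ∘ xln l F k X = X2n_map S (nq F) k X.
Proof.
elim: k X => [|k IH] X; first by rewrite cmpm1.
have -> : xln l F k.+1 X = xl_at l (X2n S F k) X ∘ X2_map S (xln l F k) X by [].
rewrite -[X2n_map S _ _]/(X2_map S (X2n_map S (nq F) k)) -[X2n S F k.+1]/(X2 S (X2n S F k)).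
apply: xin_mono; rewrite [LHS]cmpA xin_nat X2_mapE.
rewrite -[LHS]cmpA (cmpA _ (xl_at _ _ _)) xl_atE -(cmpA _ _ (X2_map _ _ _)) X2_mapE.
rewrite [LHS]cmpA -fmorM ql cmpA; congr (_ ∘ _); exact: IH.
Qed.

Lemma Pl_nq (A : kadd) (F : functor E (Ch A)) X :
  fmor (P S F) (q X) ∘ Pl l F X = P_map S (nq F) X.
Proof.
rewrite -[LHS](fmorM (Tot A)); congr (fmor (Tot A) _).
by apply: chmap_eq => k; apply: xln_nq.
Qed.

End Projection.

Fact znP (E C : preadd) (S : slot E) (F : functor E C) X Y (f : hom X Y) :
  fmor F (sz S Y) ∘ fmor F f = fmor F f ∘ fmor F (sz S X).
Proof. by rewrite -(fmorM F) szN fmorM. Qed.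

Definition zn (E C : preadd) (S : slot E) (F : functor E C) : F ⟹ F :=
  @Nattr _ _ F F (fun X => fmor F (sz S X)) (znP S F).

Lemma P_sz (E : preadd) (S S' : slot E) (A : kadd) (F : functor E (Ch A)) X :
  (forall X, fmor (dbl S) (sz S' X) = sz S' (dbl S X)) ->
  fmor (P S F) (sz S' X) = P_map S (zn S' F) X.
Proof.
move=> h; congr (fmor (Tot A) _); apply: chmap_eq => k.
rewrite -[LHS]/(fmor (X2n S F k) (sz S' X)) -[RHS]/(X2n_map S (zn S' F) k X).
elim: k X => [//|k IH] X; apply: xin_mono.
by rewrite [RHS]X2_mapE -IH [LHS]xin_nat h.
Qed.

(** Commutation of two doublings, phrased as: doubling in [S'] is a substitution compatible with
    [S]. The laws say that the maps of [S'] may be applied before or after doubling in [S]. *)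
Record com (E : preadd) (S S' : slot E) := Com {
  com_mor :> smor S S (dbl S');
  com1 : forall X, fmor (dbl S) (sp1 S' X) ∘ lam com_mor X = sp1 S' (dbl S X);
  com2 : forall X, fmor (dbl S) (sp2 S' X) ∘ lam com_mor X = sp2 S' (dbl S X);
  comz : forall X, fmor (dbl S) (sz S' X) = sz S' (dbl S X) }.

Section Commute.
Variables (E : preadd) (S S' : slot E) (c : com S S') (A : kadd).
Implicit Types F G H : functor E (Ch A).

(** [P S] is additive in natural transformations, so it preserves the splitting of
    [fcomp F (dbl S')] into its cross effect and the rest. An element of the cross effect of [P S F]
    thus comes from [P S (X2 S' F)], which is acyclic because [P] preserves acyclicity. *)
Lemma P_preserves_affine F : affine S' F -> affine S' (P S F).
Proof.
move=> aF X n T x cx.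
pose G := fcomp F (dbl S').
pose q1 := nq (sp1N S') F; pose q2 := nq (sp2N S') F.
pose K := X2 S' F.
have aPK : nacyclic (P S K) by apply: P_nacyclic.
pose k : K ⟹ G := kinf (xproj S' F).
have i1N Y Z (f : hom Y Z) : fmor F (si1 S' Z) ∘ fmor F f = fmor G f ∘ fmor F (si1 S' Y).
  by rewrite -(fmorM F) si1N fmorM.
have i2N Y Z (f : hom Y Z) : fmor F (si2 S' Z) ∘ fmor F f = fmor G f ∘ fmor F (si2 S' Y).
  by rewrite -(fmorM F) si2N fmorM.
pose j1 : F ⟹ G := @Nattr _ _ F G (fun X => fmor F (si1 S' X)) i1N.
pose j2 : F ⟹ G := @Nattr _ _ F G (fun X => fmor F (si2 S' X)) i2N.
have zN Y Z (f : hom Y Z) : fmor F (sz S' Z) ∘ fmor F f = fmor F f ∘ fmor F (sz S' Y).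
  by rewrite -(fmorM F) szN fmorM.
pose z : F ⟹ F := @Nattr _ _ F F (fun X => fmor F (sz S' X)) zN.
have idN Y Z (f : hom Y Z) : idm (G Z) ∘ fmor G f = fmor G f ∘ idm (G Y).
  by rewrite cmp1m cmpm1.
pose i : G ⟹ G := @Nattr _ _ G G (fun X => idm (G X)) idN.
have rN Y Z (f : hom Y Z) : xret S' F Z ∘ fmor G f = fmor K f ∘ xret S' F Y.
  have h1 : si1 S' Z ∘ sp1 S' Z ∘ fmor (dbl S') f = fmor (dbl S') f ∘ (si1 S' Y ∘ sp1 S' Y).
    by rewrite -cmpA sp1N !cmpA si1N.
  have h2 : si2 S' Z ∘ sp2 S' Z ∘ fmor (dbl S') f = fmor (dbl S') f ∘ (si2 S' Y ∘ sp2 S' Y).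
    by rewrite -cmpA sp2N !cmpA si2N.
  have h3 : si1 S' Z ∘ sz S' Z ∘ sp2 S' Z ∘ fmor (dbl S') f =
      fmor (dbl S') f ∘ (si1 S' Y ∘ sz S' Y ∘ sp2 S' Y).
    by rewrite -!cmpA sp2N (cmpA (sz _ _)) szN -cmpA (cmpA (si1 _ _)) si1N !cmpA.
  rewrite -[fmor G f]/(fmor F (fmor (dbl S') f)).
  apply: xin_mono; rewrite !cmpA xretE xin_nat -[RHS]cmpA xretE /xidem.
  rewrite !cmpDl !cmpDr !cmpNm !cmpmN cmp1m cmpm1.
  by rewrite -!(fmorM F) h1 h2 h3.
pose r : G ⟹ K := @Nattr _ _ G K (xret S' F) rN.
(* The defining formula of [xidem], solved for the identity: every term except [k r] factors through
   [q1] or [q2], and so vanishes on elements killed by both projections. *)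
have kr Y : i Y = ntcomp k r Y + ntcomp j1 q1 Y + ntsub (ntcomp j2 q2) (ntcomp j1 (ntcomp z q2)) Y.
  have alg (V : zmodType) (e a b d : V) : e = e - a - b + d + a + (b - d).
    have -> : e - a - b + d = e - a - (b - d) by rewrite opprB addrA addrAC.
    by rewrite addrAC subrK subrK.
  rewrite -[ntcomp k r Y]/(xin S' F Y ∘ xret S' F Y) xretE /xidem !fmorM -!cmpA.
  exact: alg.
have [_ /(_ (((xin S' (P S F) X : chmap _ _) n) ∘ x))[x1 ex1]] := Pl_bij c F X n T.
have qx (q : forall X, hom (dbl S' X) X) (qN : forall X Y (f : hom X Y), q Y ∘ fmor (dbl S') f = f ∘ q X)
    (ql : forall X, fmor (dbl S) (q X) ∘ lam c X = q (dbl S X)) m U (y : hom U (P S G X m)) :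
    (fmor (P S F) (q X) : chmap _ _) m ∘ ((Pl c F X : chmap _ _) m ∘ y) =
    (P_map S (nq qN F) X : chmap _ _) m ∘ y.
  by rewrite cmpA [X in X ∘ y](chE (Pl_nq qN ql F X) m).
have e1 : (P_map S q1 X : chmap _ _) n ∘ x1 = 0.
  rewrite -(qx _ _ (com1 c)) ex1 cmpA.
  by rewrite [X in X ∘ x](chE (xin1 S' (P S F) X) n) [LHS]cmp0m.
have e2 : (P_map S q2 X : chmap _ _) n ∘ x1 = 0.
  rewrite -(qx _ _ (com2 c)) ex1 cmpA.
  by rewrite [X in X ∘ x](chE (xin2 S' (P S F) X) n) [LHS]cmp0m.
have Pi : P_map S k X ∘ P_map S r X + P_map S j1 X ∘ P_map S q1 X +
    (P_map S j2 X ∘ P_map S q2 X - P_map S j1 X ∘ (P_map S z X ∘ P_map S q2 X)) = idm _.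
  rewrite -(P_mapM S (c := ntcomp k r)) // -(P_mapM S (c := ntcomp j1 q1)) //.
  rewrite -(P_mapM S (c := ntcomp j2 q2)) // -(P_mapM S (c := ntcomp z q2)) //.
  rewrite -(P_mapM S (c := ntcomp j1 (ntcomp z q2))) //.
  rewrite -(P_mapB S (c := ntsub (ntcomp j2 q2) (ntcomp j1 (ntcomp z q2)))) //.
  pose s : G ⟹ G := ntsub i (ntsub (ntcomp j2 q2) (ntcomp j1 (ntcomp z q2))).
  rewrite -(P_mapD S (c := s)); last first.
    by move=> Y; rewrite -[s Y]/(i Y - ntsub _ _ Y) {1}kr addrK.
  rewrite -(P_mapD S (c := i)); first exact: P_map1.
  by move=> Y; rewrite -[s Y]/(i Y - ntsub _ _ Y) subrK.
have ex : (P_map S k X : chmap _ _) n ∘ ((P_map S r X : chmap _ _) n ∘ x1) = x1.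
  have := chE Pi n => /(congr1 (fun h => h ∘ x1)); rewrite [X in _ = X]cmp1m => h.
  rewrite -[RHS]h [RHS]cmpDl [X in _ = X + _]cmpDl -!cmpA e1 cmpm0 addr0.
  rewrite [X in _ = _ + X]cmpDl [X in _ + (_ + X)]cmpNm.
  by rewrite -!cmpA e2 !cmpm0 subr0 addr0.
have cx1 : cyc x1.
  case: n x cx x1 ex1 {e1 e2 ex} => [//|n] x cx x1 ex1; apply: (Pl_bij c F X n T).1.
  by rewrite chm_cd ex1 -chm_cd [_ ∘ x]cx cmpm0.
have [w ew] := aPK X _ _ _ (cyc_map (P_map S r X) cx1).
have kq (q : G ⟹ F) m U (y : hom U (P S K X m)) : (forall Y, q Y ∘ k Y = 0) ->
    (P_map S q X : chmap _ _) m ∘ ((P_map S k X : chmap _ _) m ∘ y) = 0.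
  move=> qk; have e : P_map S q X ∘ P_map S k X = 0.
    by rewrite -(P_mapM S (c := ntcomp q k)) ?P_map0.
  by rewrite cmpA [X in X ∘ y](chE e m) [LHS]cmp0m.
have [u eu] := @xlift_ch _ S' A (P S F) X n.+1 T
    ((Pl c F X : chmap _ _) n.+1 ∘ ((P_map S k X : chmap _ _) n.+1 ∘ w))
    (etrans (qx _ (sp1N S') (com1 c) _ _ _) (kq q1 _ _ _ (xin1 S' F)))
    (etrans (qx _ (sp2N S') (com2 c) _ _ _) (kq q2 _ _ _ (xin2 S' F))).
exists u; apply: ev_mono; rewrite chm_cd eu -ex1 -ex ew.
by rewrite 2!chm_cd.
Qed.

End Commute.

(** * Commuting linearizations *)

Section Symmetry.
Variables (E : preadd) (A : kadd).
Implicit Types (S : slot E) (F G H : functor E (Ch A)).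

Definition PP S S' F := P S (P S' F).

Definition PP_map S S' F G (a : F ⟹ G) : PP S S' F ⟹ PP S S' G := P_map S (P_map S' a).

Definition PP_eta S S' F : F ⟹ PP S S' F := ntcomp (peta S (P S' F)) (peta S' F).

Lemma PP_eta_map S S' F G (a : F ⟹ G) X :
  PP_eta S S' G X ∘ a X = PP_map S S' a X ∘ PP_eta S S' F X.
Proof.
rewrite -[PP_eta S S' G X]/(peta S (P S' G) X ∘ peta S' G X).
rewrite -[PP_eta S S' F X]/(peta S (P S' F) X ∘ peta S' F X).
by rewrite -cmpA peta_map cmpA (peta_map S (P_map S' a)) -cmpA.
Qed.

Lemma PP_mapM S S' F G H (b : G ⟹ H) (a : F ⟹ G) (c : F ⟹ H) X :
  (forall Y, c Y = b Y ∘ a Y) -> PP_map S S' c X = PP_map S S' b X ∘ PP_map S S' a X.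
Proof. by move=> cE; apply: P_mapM => Y; apply: P_mapM. Qed.

Lemma PP_nweq S S' F G (a : F ⟹ G) : nweq a -> nweq (PP_map S S' a).
Proof. by move=> wa; apply/P_nweq/P_nweq. Qed.

Section Idem.
Variables (S S' : slot E) (c : com S S') (c' : com S' S).

Lemma PP_eta_nweq F : affine S F -> affine S' F -> nweq (PP_eta S S' F).
Proof.
move=> aF aF'; apply: (nweq_comp (b := peta S (P S' F)) (a := peta S' F)) => //.
  exact: peta_nweq.
by apply: peta_nweq; apply: P_preserves_affine.
Qed.

Lemma PP_affine F : affine S (PP S S' F) /\ affine S' (PP S S' F).
Proof.
split; first exact: P_affine.
by apply: (P_preserves_affine c); apply: P_affine.
Qed.

(** The inner half of the unit is inverted by [P S']. The outer half [peta S K] is moved out of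
    [P S'] by naturality of [peta S'], whose components at [K] and at [P S K] are equivalences, both
    functors being affine in [S']. *)
Lemma PP_eta_idem F : nweq (PP_map S S' (PP_eta S S' F)).
Proof.
pose K := P S' F.
have aK : affine S' K by apply: P_affine.
apply: (nweq_comp (b := PP_map S S' (peta S K)) (a := PP_map S S' (peta S' F))).
- by move=> X; apply: PP_mapM.
- by apply: P_nweq; apply: P_peta_nweq.
apply: (nweq_cancel_r (a := P_map S (peta S' K))
  (c := ntcomp (P_map S (peta S' (P S K))) (P_map S (peta S K)))) => [X||].
- rewrite -[RHS](P_mapM S (c := ntcomp (peta S' (P S K)) (peta S K))).
    by symmetry; apply: P_mapM.
  by move=> Y; apply: peta_map.
- by apply: P_nweq; apply: peta_nweq.
apply: (nweq_comp (b := P_map S (peta S' (P S K))) (a := P_map S (peta S K))) => //.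
  exact: P_peta_nweq.
by apply: P_nweq; apply: peta_nweq; apply: (P_preserves_affine c).
Qed.

End Idem.

(** [L F] and [L' F] both map to [L (L' F)]. The map from [L' F] is a unit at a functor already
    affine in both coordinates. The map [u] from [L F] is handled by two-out-of-six: by naturality
    of units, [v u] and [w v] are composites of maps covered by [PP_eta_idem] and [PP_eta_nweq]. *)
Lemma PP_comm S S' (c : com S S') (c' : com S' S) F :
  zz (PP S S' F) (PP S' S F).
Proof.
pose L := PP S S'; pose L' := PP S' S.
pose u := PP_map S S' (PP_eta S' S F).
have wu : nweq u.
  pose v := PP_map S S' (PP_map S' S (PP_eta S S' F)).
  pose w := PP_map S S' (PP_map S' S (PP_map S S' (PP_eta S' S F))).
  have wvu : nweq (ntcomp v u).
    apply: (nweq_comp (b := PP_map S S' (PP_eta S' S (L F))) (a := PP_map S S' (PP_eta S S' F))).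
    - move=> X; rewrite -[RHS](PP_mapM S S' (c := ntcomp (PP_eta S' S (L F)) (PP_eta S S' F))) //.
      by symmetry; apply: PP_mapM => Y; apply: PP_eta_map.
    - exact: PP_eta_idem.
    apply: PP_nweq; have [a1 a2] := PP_affine c F; exact: PP_eta_nweq.
  have wwv : nweq (ntcomp w v).
    apply: (nweq_comp (b := PP_map S S' (PP_map S' S (PP_eta S S' (L' F))))
      (a := PP_map S S' (PP_map S' S (PP_eta S' S F)))).
    - move=> X.
      rewrite -[RHS](PP_mapM S S' (c := PP_map S' S (ntcomp (PP_eta S S' (L' F)) (PP_eta S' S F)))).
        symmetry; apply: PP_mapM => Y.
        by apply: PP_mapM => Z; apply: PP_eta_map.
      by move=> Y; apply: PP_mapM.
    - by apply: PP_nweq; apply: PP_eta_idem.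
    do 2!apply: PP_nweq; have [a1 a2] := PP_affine c' F; exact: PP_eta_nweq.
  move=> X; apply: (weq_2of6 _ _ (wvu X) (wwv X)) => n.
    exact: (chE (erefl : ntcomp v u X = v X ∘ u X) n).
  exact: (chE (erefl : ntcomp w v X = w X ∘ v X) n).
apply: zz_trans (zz_nweq wu) (zz_sym _).
apply: (zz_nweq (a := PP_eta S S' (L' F))).
have [a1 a2] := PP_affine c' F; exact: PP_eta_nweq.
Qed.

End Symmetry.

(** * Natural zigzags of equivalences *)

Section Zigzag.
Variables (E : preadd) (A : kadd).
Implicit Types F G H : functor E (Ch A).

Lemma zz_refl F : zz F F.
Proof.
have iN X Y (f : hom X Y) : idm (F Y) ∘ fmor F f = fmor F f ∘ idm (F X).
  by rewrite cmp1m cmpm1.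
by apply: (zz_nweq (a := Nattr iN)) => X; apply: weq_id.
Qed.

Lemma zz_map (E' : preadd) (A' : kadd) (O : functor E (Ch A) -> functor E' (Ch A')) F G :
  (forall F G (a : F ⟹ G), nweq a -> exists b : O F ⟹ O G, nweq b) ->
  zz F G -> zz (O F) (O G).
Proof.
move=> H; elim=> [F' G' a wa|F' G' _|F' G' H' _ h1 _ h2]; last exact: zz_trans h1 h2.
  by have [b wb] := H _ _ _ wa; apply: zz_nweq wb.
exact: zz_sym.
Qed.

Lemma zz_pt F G X : zz F G -> wequiv (F X) (G X).
Proof.
elim=> [F' G' a wa|F' G' _|F' G' H' _ h1 _ h2]; first by exists (a X).
  exact: wequiv_sym.
exact: wequiv_trans h1 h2.
Qed.

Lemma zz_pre (E' : preadd) (L : functor E' E) F G : zz F G -> zz (fcomp F L) (fcomp G L).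
Proof.
apply: (zz_map (O := fun F => fcomp F L)) => F' G' a wa.
by exists (ntwhisker a L) => X; apply: wa.
Qed.

Lemma zz_iso F G (a : F ⟹ G) (i : forall X, hom (G X) (F X)) :
  (forall X, i X ∘ a X = idm _) -> (forall X, a X ∘ i X = idm _) -> zz F G.
Proof.
move=> ia ai; apply: (zz_nweq (a := a)) => X.
apply: (weq_iso (g := fun n => (i X : chmap _ _) n)) => n.
  exact: (chE (ia X) n).
exact: (chE (ai X) n).
Qed.

Lemma zz_sub F1 F2 G (i1 : F1 ⟹ G) (i2 : F2 ⟹ G) :
  (forall X, mono (i1 X)) -> (forall X, mono (i2 X)) ->
  (forall X, exists f, i2 X ∘ f = i1 X) -> (forall X, exists g, i1 X ∘ g = i2 X) ->
  zz F1 F2.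
Proof.
move=> m1 m2 f12 f21; pose f X := sval (cid (f12 X)); pose g X := sval (cid (f21 X)).
have fE X : i2 X ∘ f X = i1 X by exact: svalP (cid (f12 X)).
have gE X : i1 X ∘ g X = i2 X by exact: svalP (cid (f21 X)).
have fN X Y (h : hom X Y) : f Y ∘ fmor F1 h = fmor F2 h ∘ f X.
  by apply: m2; rewrite !cmpA fE !ntP -cmpA fE.
apply: (zz_iso (a := Nattr fN) (i := g)) => X /=.
  by apply: m1; rewrite cmpA gE fE cmpm1.
by apply: m2; rewrite cmpA fE gE cmpm1.
Qed.

Definition fbip F G : functor E (Ch A) := fcomp (sumf (Ch A)) (fpair F G).

Lemma cyc_bip (C D : cpx A) n T (x : hom T (C n ⊕ D n)) :
  @cyc _ (chbip C D) n T x <-> cyc (pr1 ∘ x) /\ cyc (pr2 ∘ x).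
Proof.
case: n x => [//|n] x; rewrite /cyc -[cd (chbip C D) n]/(bimap (cd C n) (cd D n)) !cmpA.
rewrite -(pr1_bimap (cd C n) (cd D n)) -(pr2_bimap (cd C n) (cd D n)) -!cmpA.
split=> [e|[e1 e2]]; first by rewrite [_ ∘ x]e !cmpm0.
by apply: bip_eq; rewrite cmpm0.
Qed.

Lemma weq_bimap (C D C' D' : cpx A) (f : chmap C C') (g : chmap D D')
    (h : chmap (chbip C D) (chbip C' D')) :
  (forall n, h n = bimap (f n) (g n)) -> weq f -> weq g -> weq h.
Proof.
move=> hE wf wg; split=> [n T x w /cyc_bip[c1 c2] e|n T y /cyc_bip[c1 c2]].
  have [|v1 e1] := weq_inj wf (w := pr1 ∘ w) c1.
    rewrite !cmpA -(pr1_bimap _ (g n)) -(pr1_bimap _ (cd D' n)) -!cmpA.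
    by rewrite -hE e.
  have [|v2 e2] := weq_inj wg (w := pr2 ∘ w) c2.
    rewrite !cmpA -(pr2_bimap (f n)) -(pr2_bimap (cd C' n)) -!cmpA.
    by rewrite -hE e.
  by exists (bpair v1 v2); rewrite [RHS]bimap_pair -e1 -e2 pair_eta.
have [x1 [w1 [cx1 e1]]] := weq_surj wf c1.
have [x2 [w2 [cx2 e2]]] := weq_surj wg c2.
exists (bpair x1 x2), (bpair w1 w2); split.
  by apply/cyc_bip; rewrite pr1_pair pr2_pair.
rewrite hE bimap_pair [X in _ + X]bimap_pair -[y]pair_eta e1 e2.
by rewrite /bpair !cmpDr addrACA.
Qed.

Lemma zz_fbip F F' G G' : zz F F' -> zz G G' -> zz (fbip F G) (fbip F' G').
Proof.
move=> zF zG; apply: (zz_trans (G := fbip F' G)).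
  apply: (zz_map (O := fun F => fbip F G)) zF => F1 F2 a wa.
  have bN X Y (f : hom X Y) : bimap (a Y) (idm (G Y)) ∘ fmor (fbip F1 G) f =
      fmor (fbip F2 G) f ∘ bimap (a X) (idm (G X)).
    by rewrite -[LHS]bimap_cmp -[RHS]bimap_cmp ntP cmp1m cmpm1.
  exists (@Nattr _ _ (fbip F1 G) (fbip F2 G) (fun X => bimap (a X) (idm (G X))) bN) => X.
  apply: (weq_bimap (f := a X) (g := chid (G X))) => //.
  exact: weq_id.
apply: (zz_map (O := fbip F')) zG => G1 G2 a wa.
have bN X Y (f : hom X Y) : bimap (idm (F' Y)) (a Y) ∘ fmor (fbip F' G1) f =
    fmor (fbip F' G2) f ∘ bimap (idm (F' X)) (a X).
  by rewrite -[LHS]bimap_cmp -[RHS]bimap_cmp ntP cmp1m cmpm1.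
exists (@Nattr _ _ (fbip F' G1) (fbip F' G2) (fun X => bimap (idm (F' X)) (a X)) bN) => X.
apply: (weq_bimap (f := chid (F' X)) (g := a X)) => //.
exact: weq_id.
Qed.

Lemma acyclic_bip_pr2 (C D : cpx A) (h : chmap (chbip C D) D) :
  (forall n, h n = pr2) -> acyclic C -> weq h.
Proof.
move=> hE aC; split=> [n T x w /cyc_bip[c1 c2]|n T y cy].
  rewrite hE => e; have [v ev] := aC _ _ _ c1.
  by exists (bpair v w); rewrite [RHS]bimap_pair -ev -e pair_eta.
exists (in2 ∘ y), 0; rewrite cmpm0 addr0 hE cmpA pr2_in2 cmp1m; split=> //.
apply/cyc_bip; rewrite !cmpA pr1_in2 pr2_in2 cmp0m cmp1m; split=> //.
by case: n {y cy} => // n; rewrite /cyc cmpm0.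
Qed.

Lemma zz_fbip0 F G : nacyclic F -> zz (fbip F G) G.
Proof.
move=> aF; have pN X Y (f : hom X Y) : pr2 ∘ fmor (fbip F G) f = fmor G f ∘ pr2.
  exact: pr2_bimap.
apply: (zz_nweq (a := @Nattr _ _ (fbip F G) G (fun X => pr2) pN)) => X.
by apply: (acyclic_bip_pr2 (C := F X)) (aF X) => n.
Qed.

End Zigzag.

(** * Reduced parts and linearization in one coordinate *)

Section Reduced.
Variables (E : preadd) (S : slot E) (C : kadd).
Implicit Types F G : functor E C.

(** The first cross effect in the coordinate [S], the other coordinates acting as parameters. As
    [sz] is a natural idempotent, this is a natural direct summand with retraction [redret]. *)
Definition red G : functor E C := kerf (zn S G).

Definition redin G : red G ⟹ G := kinf (zn S G).

Lemma redin_mono G X : mono (redin G X).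
Proof. exact: kin_mono. Qed.

Lemma redinK G X : fmor G (sz S X) ∘ redin G X = 0.
Proof. exact: kinK. Qed.

Lemma red_lift G X T (x : hom T (G X)) : fmor G (sz S X) ∘ x = 0 ->
  exists u, redin G X ∘ u = x.
Proof. by move=> e; exists (klift (zn S G X) x); apply: kin_lift. Qed.

Fact red_map_ker F G (a : F ⟹ G) X : zn S G X ∘ (a X ∘ kin (zn S F X)) = 0.
Proof. by rewrite cmpA -[zn S G X]/(fmor G (sz S X)) -ntP -cmpA kinK cmpm0. Qed.

Definition red_map F G (a : F ⟹ G) : red F ⟹ red G := kerf_map (red_map_ker a).

Lemma red_mapE F G (a : F ⟹ G) X : redin G X ∘ red_map a X = a X ∘ redin F X.
Proof. exact: (kin_lift (red_map_ker a X)). Qed.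

Definition redret_at G X : hom (G X) (red G X) := klift (zn S G X) (idm _ - fmor G (sz S X)).

Lemma redretE G X : redin G X ∘ redret_at G X = idm _ - fmor G (sz S X).
Proof. by apply: kin_lift; rewrite cmpDr cmpmN cmpm1 -(fmorM G) szz subrr. Qed.

Lemma redretK G X : redret_at G X ∘ redin G X = idm _.
Proof.
by apply: redin_mono; rewrite cmpA redretE cmpDl cmpNm redinK subr0 cmp1m cmpm1.
Qed.

Fact redretP G X Y (f : hom X Y) :
  redret_at G Y ∘ fmor G f = fmor (red G) f ∘ redret_at G X.
Proof.
apply: redin_mono; rewrite [LHS]cmpA redretE [RHS]cmpA (ntP (redin G)) -[RHS]cmpA redretE.
by rewrite cmpDl cmpDr cmpNm cmpmN -!(fmorM G) szN cmp1m cmpm1.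
Qed.

Definition redret G : G ⟹ red G := @Nattr _ _ G (red G) (redret_at G) (@redretP G).

Lemma redret_nat F G (a : F ⟹ G) X : red_map a X ∘ redret F X = redret G X ∘ a X.
Proof.
apply: redin_mono; rewrite [LHS]cmpA red_mapE -[LHS]cmpA redretE [RHS]cmpA redretE.
by rewrite cmpDl cmpDr cmpNm cmpmN ntP cmp1m cmpm1.
Qed.

Definition reduced G : Prop := forall X, fmor G (sz S X) = 0.

Lemma red_reduced G : reduced (red G).
Proof. by move=> X; apply: redin_mono; rewrite (ntP (redin G)) redinK cmpm0. Qed.

End Reduced.

Fact ntid_nat (E C : preadd) (F : functor E C) X Y (f : hom X Y) :
  idm (F Y) ∘ fmor F f = fmor F f ∘ idm (F X).
Proof. by rewrite cmp1m cmpm1. Qed.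

Definition ntid (E C : preadd) (F : functor E C) : F ⟹ F :=
  @Nattr _ _ F F (fun X => idm (F X)) (@ntid_nat E C F).

Lemma bimap_in1 (A : kadd) (x y x' y' : A) (f : hom x x') (g : hom y y') :
  bimap f g ∘ in1 = in1 ∘ f.
Proof.
by rewrite /bimap pair_cmp -!cmpA pr1_in1 pr2_in1 cmpm1 cmpm0 /bpair cmpm0 addr0.
Qed.

Lemma bimap_in2 (A : kadd) (x y x' y' : A) (f : hom x x') (g : hom y y') :
  bimap f g ∘ in2 = in2 ∘ g.
Proof.
by rewrite /bimap pair_cmp -!cmpA pr1_in2 pr2_in2 cmpm1 cmpm0 /bpair cmpm0 add0r.
Qed.

Section Lin.
Variables (E : preadd) (S : slot E) (A : kadd).
Implicit Types F G H : functor E (Ch A).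

(** The analogue of [D_1] in the coordinate [S]: reduction makes the result vanish at zero, and [P]
    makes it of degree at most 1. *)
Definition lin G : functor E (Ch A) := P S (red S G).

Definition lin_map F G (a : F ⟹ G) : lin F ⟹ lin G := P_map S (red_map S a).

Lemma red_nweq F G (a : F ⟹ G) : nweq a -> nweq (red_map S a).
Proof.
move=> wa X; apply: (weq_retract (f := a X) (i := redin S F X) (r := redret S F X)
  (j := redin S G X) (s := redret S G X)) => // n.
- exact: (chE (redretK S F X) n).
- exact: (chE (redretK S G X) n).
- exact: (chE (esym (red_mapE S a X)) n).
- exact: (chE (redret_nat S a X) n).
Qed.

Lemma zz_P F G : zz F G -> zz (P S F) (P S G).
Proof. by apply: zz_map => F' G' a wa; exists (P_map S a); apply: P_nweq. Qed.

Lemma zz_red F G : zz F G -> zz (red S F) (red S G).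
Proof. by apply: zz_map => F' G' a wa; exists (red_map S a); apply: red_nweq. Qed.

Lemma zz_lin F G : zz F G -> zz (lin F) (lin G).
Proof. by move=> z; apply/zz_P/zz_red. Qed.

Lemma reduced_redin G : reduced S G -> nweq (redin S G).
Proof.
move=> rG X; apply: (weq_iso (g := fun n => (redret S G X : chmap _ _) n)) => n.
  exact: (chE (redretK S G X) n).
have e : redin S G X ∘ redret S G X = idm _ by rewrite [LHS]redretE rG subr0.
exact: (chE e n).
Qed.

Lemma P_reduced G : reduced S G -> reduced S (P S G).
Proof. by move=> rG X; rewrite (P_sz _ _ (dblz S)) P_map0. Qed.

Lemma lin_reduced G : reduced S (lin G).
Proof. exact/P_reduced/red_reduced. Qed.

Lemma lin_affine G : affine S (lin G).
Proof. exact: P_affine. Qed.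

Lemma lin_id G : reduced S G -> affine S G -> zz (lin G) G.
Proof.
move=> rG aG; have w := reduced_redin rG.
have aR : affine S (red S G) by apply/(affine_nweq S w).
apply: zz_trans (zz_nweq w); apply: zz_sym; apply: (zz_nweq (a := peta S (red S G))).
exact: peta_nweq.
Qed.

Lemma lin_lin G : zz (lin (lin G)) (lin G).
Proof. apply: lin_id; [exact: lin_reduced | exact: lin_affine]. Qed.

Lemma lin_const G : (forall X, fmor G (sz S X) = idm _) -> nacyclic (lin G).
Proof.
move=> cG; apply: P_nacyclic => X; apply: acyclic_0 => n.
have e : idm (red S G X) = 0.
  apply: (@redin_mono _ S _ G X); rewrite cmpm0 cmpm1 -[LHS]cmp1m -cG.
  exact: redinK.
exact: (chE e n).
Qed.

Lemma lin_mapM F G H (b : G ⟹ H) (a : F ⟹ G) (c : F ⟹ H) X :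
  (forall Y, c Y = b Y ∘ a Y) -> lin_map c X = lin_map b X ∘ lin_map a X.
Proof.
move=> cE; apply: P_mapM => Y; apply: redin_mono.
by rewrite red_mapE cE [RHS]cmpA red_mapE -[RHS]cmpA red_mapE cmpA.
Qed.

Lemma lin_map1 F (a : F ⟹ F) X : (forall Y, a Y = idm _) -> lin_map a X = idm _.
Proof.
move=> a1; apply: P_map1 => Y; apply: redin_mono.
by rewrite red_mapE a1 cmp1m cmpm1.
Qed.

Lemma lin_mapD F G (a b c : F ⟹ G) X :
  (forall Y, c Y = a Y + b Y) -> lin_map c X = lin_map a X + lin_map b X.
Proof.
move=> cE; apply: P_mapD => Y; apply: redin_mono.
by rewrite cmpDr !red_mapE cE cmpDl.
Qed.

Lemma lin_map0 F G (a : F ⟹ G) X : (forall Y, a Y = 0) -> lin_map a X = 0.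
Proof.
move=> a0; apply: P_map0 => Y; apply: redin_mono.
by rewrite red_mapE a0 cmp0m cmpm0.
Qed.

Lemma lin_fbip F G : zz (lin (fbip F G)) (fbip (lin F) (lin G)).
Proof.
have p1N X Y (f : hom X Y) : pr1 ∘ fmor (fbip F G) f = fmor F f ∘ pr1 by exact: pr1_bimap.
have p2N X Y (f : hom X Y) : pr2 ∘ fmor (fbip F G) f = fmor G f ∘ pr2 by exact: pr2_bimap.
have i1N X Y (f : hom X Y) : in1 ∘ fmor F f = fmor (fbip F G) f ∘ in1.
  exact: esym (bimap_in1 _ _).
have i2N X Y (f : hom X Y) : in2 ∘ fmor G f = fmor (fbip F G) f ∘ in2.
  exact: esym (bimap_in2 _ _).
pose p1 : fbip F G ⟹ F := @Nattr _ _ (fbip F G) F (fun X => pr1) p1N.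
pose p2 : fbip F G ⟹ G := @Nattr _ _ (fbip F G) G (fun X => pr2) p2N.
pose i1 : F ⟹ fbip F G := @Nattr _ _ F (fbip F G) (fun X => in1) i1N.
pose i2 : G ⟹ fbip F G := @Nattr _ _ G (fbip F G) (fun X => in2) i2N.
have aN X Y (f : hom X Y) : bpair (lin_map p1 Y) (lin_map p2 Y) ∘ fmor (lin (fbip F G)) f =
    fmor (fbip (lin F) (lin G)) f ∘ bpair (lin_map p1 X) (lin_map p2 X).
  by rewrite [LHS]pair_cmp [RHS]bimap_pair !ntP.
apply: (zz_iso (a := @Nattr _ _ (lin (fbip F G)) (fbip (lin F) (lin G))
  (fun X => bpair (lin_map p1 X) (lin_map p2 X)) aN)
  (i := fun X => bcopair (lin_map i1 X) (lin_map i2 X))) => Y.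
  rewrite -[LHS]/(bcopair (lin_map i1 Y) (lin_map i2 Y) ∘
    bpair (lin_map p1 Y) (lin_map p2 Y)).
  rewrite /bcopair cmpDl -!cmpA pr1_pair pr2_pair.
  rewrite -(lin_mapM (c := ntcomp i1 p1)) // -(lin_mapM (c := ntcomp i2 p2)) //.
  rewrite -(lin_mapD (c := ntid _)); first exact: lin_map1.
  by move=> X; rewrite -[RHS]/(in1 ∘ pr1 + in2 ∘ pr2) bipP.
rewrite -[LHS]/(bpair (lin_map p1 Y) (lin_map p2 Y) ∘
  bcopair (lin_map i1 Y) (lin_map i2 Y)).
apply: cobip_eq; rewrite -cmpA ?copair_in1 ?copair_in2 pair_cmp cmp1m.
  rewrite -(lin_mapM (c := ntcomp p1 i1)) // -(lin_mapM (c := ntcomp p2 i1)) //.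
  rewrite lin_map1 ?lin_map0 /bpair ?cmpm1 ?cmpm0 ?addr0 // => X.
    exact: pr2_in1.
  exact: pr1_in1.
rewrite -(lin_mapM (c := ntcomp p1 i2)) // -(lin_mapM (c := ntcomp p2 i2)) //.
rewrite lin_map0 ?lin_map1 /bpair ?cmpm1 ?cmpm0 ?add0r // => X.
  exact: pr2_in2.
exact: pr1_in2.
Qed.

End Lin.

(** * Linearizations in two coordinates commute *)

Section LinComm.
Variables (E : preadd) (A : kadd).
Implicit Types (S : slot E) (F G H : functor E (Ch A)).

(** Both sides embed in [G] with the same image, the elements killed by [sz S] and by [sz S']. *)
Lemma red_comm S S' G : zz (red S (red S' G)) (red S' (red S G)).
Proof.
have lift T1 T2 X : exists f, ntcomp (redin T1 G) (redin T2 (red T1 G)) X ∘ f =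
    ntcomp (redin T2 G) (redin T1 (red T2 G)) X.
  set y := ntcomp (redin T2 G) (redin T1 (red T2 G)) X.
  have [|u eu] := @red_lift _ T1 _ G X _ y.
    rewrite cmpA -(ntP (redin T2 G)) -cmpA.
    by rewrite redinK cmpm0.
  have [|v ev] := @red_lift _ T2 _ (red T1 G) X _ u.
    apply: redin_mono; rewrite cmpm0 cmpA (ntP (redin T1 G)) -cmpA eu.
    by rewrite cmpA redinK cmp0m.
  by exists v; rewrite -cmpA ev.
have mn T1 T2 X : mono (ntcomp (redin T1 G) (redin T2 (red T1 G)) X).
  by move=> W u v e; do 2!apply: redin_mono; rewrite !cmpA.
apply: (zz_sub (i1 := ntcomp (redin S' G) (redin S (red S' G)))
  (i2 := ntcomp (redin S G) (redin S' (red S G)))) => X.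
- exact: mn.
- exact: mn.
- exact: lift.
- exact: lift.
Qed.

(** The reduced part is the image of the idempotent [1 - sz], and [P S'] preserves this splitting
    because it is additive on natural transformations. *)
Lemma red_P_comm S S' G : (forall X, fmor (dbl S') (sz S X) = sz S (dbl S' X)) ->
  zz (P S' (red S G)) (red S (P S' G)).
Proof.
move=> h; pose i := P_map S' (redin S G); pose r := P_map S' (redret S G).
have ri X : r X ∘ i X = idm _.
  rewrite -(P_mapM S' (c := ntcomp (redret S G) (redin S G))) // P_map1 // => Y.
  exact: redretK.
have ir X : i X ∘ r X = idm _ - fmor (P S' G) (sz S X).
  rewrite -(P_mapM S' (c := ntcomp (redin S G) (redret S G))) //.
  rewrite (P_sz _ _ h).
  rewrite (@P_mapB _ S' _ _ _ (ntid G) (zn S G)); last by move=> Y; apply: redretE.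
  by rewrite P_map1.
apply: (zz_sub (i1 := i) (i2 := redin S (P S' G))) => X.
- by move=> W u v e; rewrite -[u]cmp1m -[v]cmp1m -ri -!cmpA e.
- exact: redin_mono.
- apply: red_lift; rewrite (P_sz _ _ h) -(P_mapM S' (c := ntcomp (zn S G) (redin S G))) //.
  by apply: P_map0 => Y; apply: redinK.
- exists (r X ∘ redin S (P S' G) X); rewrite cmpA ir cmpDl cmpNm redinK.
  by rewrite subr0 cmp1m.
Qed.

Lemma lin_comm S S' (c : com S S') (c' : com S' S) G :
  zz (lin S (lin S' G)) (lin S' (lin S G)).
Proof.
apply: (zz_trans (G := PP S S' (red S (red S' G)))).
  apply: zz_P; apply: zz_sym; apply: red_P_comm; exact: comz c'.
apply: zz_trans (PP_comm c c' _) _.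
apply: (zz_trans (G := PP S' S (red S' (red S G)))).
  by apply/zz_P/zz_P/red_comm.
by apply: zz_P; apply: red_P_comm; apply: comz c.
Qed.

End LinComm.

Lemma lin_smor (E' E : preadd) (S' : slot E') (S : slot E) (L : functor E' E)
    (l : smor S' S L) (A : kadd) (G : functor E (Ch A)) :
  zz (lin S' (fcomp G L)) (fcomp (lin S G) L).
Proof.
apply: (zz_trans (G := P S' (fcomp (red S G) L))); last exact: (zz_nweq (Pl_nweq l _)).
apply: zz_P; apply: (zz_sub (i1 := redin S' (fcomp G L)) (i2 := ntwhisker (redin S G) L)) => X.
- exact: redin_mono.
- exact: redin_mono.
- by apply: red_lift; rewrite (lamz l); apply: (redinK S' (fcomp G L)).
apply: red_lift; rewrite -[fmor _ _]/(fmor G (fmor L (sz S' X))) -(lamz l).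
exact: redinK.
Qed.

(* If [A0 = A1 ⊕ A2] along the slot coordinate, a linear functor splits. *)
Lemma lin_split (D E : preadd) (S : slot E) (A : kadd) (H : functor E (Ch A))
    (A0 A1 A2 : functor D E) (p1 : A0 ⟹ A1) (p2 : A0 ⟹ A2) (i1 : A1 ⟹ A0) (i2 : A2 ⟹ A0)
    (b : forall X, hom (A0 X) (dbl S (A0 X))) :
  reduced S H -> affine S H ->
  (forall X, p1 X ∘ i1 X = idm _) -> (forall X, p2 X ∘ i2 X = idm _) ->
  (forall X, p1 X ∘ i2 X = p1 X ∘ i2 X ∘ sz S _) ->
  (forall X, p2 X ∘ i1 X = p2 X ∘ i1 X ∘ sz S _) ->
  (forall X, sp1 S _ ∘ b X = i1 X ∘ p1 X) -> (forall X, sp2 S _ ∘ b X = i2 X ∘ p2 X) ->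
  (forall X, sm S _ ∘ b X = idm _) ->
  zz (fcomp H A0) (fbip (fcomp H A1) (fcomp H A2)).
Proof.
move=> rH aH p1i1 p2i2 p1i2 p2i1 b1 b2 bm.
have fN X Y (f : hom X Y) :
    bpair (fmor H (p1 Y)) (fmor H (p2 Y)) ∘ fmor (fcomp H A0) f =
    fmor (fbip (fcomp H A1) (fcomp H A2)) f ∘ bpair (fmor H (p1 X)) (fmor H (p2 X)).
  by rewrite [LHS]pair_cmp [RHS]bimap_pair -!(fmorM H) !ntP.
apply: (zz_nweq (a := @Nattr _ _ (fcomp H A0) (fbip (fcomp H A1) (fcomp H A2))
  (fun X => bpair (fmor H (p1 X)) (fmor H (p2 X))) fN)) => X.
pose g : @hom (Ch A) _ _ := bpair (fmor H (p1 X)) (fmor H (p2 X)).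
pose k : @hom (Ch A) _ _ := bcopair (fmor H (i1 X)) (fmor H (i2 X)).
have gk : g ∘ k = idm _.
  apply: cobip_eq; rewrite -cmpA ?copair_in1 ?copair_in2 pair_cmp -!(fmorM H) cmp1m.
    by rewrite p1i1 p2i1 (fmorM H _ (sz S _)) rH fmor1 cmpm0 /bpair cmpm0 cmpm1 addr0.
  by rewrite p2i2 p1i2 (fmorM H _ (sz S _)) rH fmor1 cmpm0 /bpair cmpm0 cmpm1 add0r.
suff w : weq (g : chmap _ _) by exact: w.
split=> [n T x w cx e|n T y cy]; last first.
  exists ((k : chmap _ _) n ∘ y), 0; split; first exact: cyc_map.
  by rewrite cmpm0 addr0 cmpA [X in X ∘ y](chE gk n) [RHS]cmp1m.
(* [k] is a strict right inverse of [g], so this correction by a boundary makes both projections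
   vanish exactly and not only in homology. *)
pose x' := x - (k : chmap _ _) n ∘ (cd _ n ∘ w).
have gx' : (g : chmap _ _) n ∘ x' = 0.
  rewrite /x' cmpDr cmpmN e (cmpA ((g : chmap _ _) n)) [X in _ - X ∘ _](chE gk n).
  by rewrite [X in _ - X]cmp1m subrr.
have cx' : cyc x'.
  by apply: cycD => //; apply/cycN/cyc_map/cyc_cd.
pose B : @hom (Ch A) _ _ := fmor H (b X).
have pg : pr1 ∘ g = fmor H (p1 X) /\ pr2 ∘ g = fmor H (p2 X) by rewrite pr1_pair pr2_pair.
have h1 : (fmor H (p1 X) : chmap _ _) n ∘ x' = 0.
  by rewrite -(chE pg.1 n) -[LHS]cmpA gx' cmpm0.
have h2 : (fmor H (p2 X) : chmap _ _) n ∘ x' = 0.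
  by rewrite -(chE pg.2 n) -[LHS]cmpA gx' cmpm0.
(* Now [b] places [x'] in the acyclic cross effect of [H]; a chain bounding it there is sent by [sm]
   to one that bounds [x']. *)
have [||u eu] := @xlift_ch _ S A H (A0 X) n T ((B : chmap _ _) n ∘ x').
- have q : fmor H (sp1 S (A0 X)) ∘ B = fmor H (i1 X) ∘ fmor H (p1 X).
    by rewrite -!(fmorM H) b1.
  by rewrite cmpA [X in X ∘ x'](chE q n) -[LHS]cmpA h1 cmpm0.
- have q : fmor H (sp2 S (A0 X)) ∘ B = fmor H (i2 X) ∘ fmor H (p2 X).
    by rewrite -!(fmorM H) b2.
  by rewrite cmpA [X in X ∘ x'](chE q n) -[LHS]cmpA h2 cmpm0.
have cu : cyc u.
  case: n T x w cx e x' gx' cx' h1 h2 u eu => [//|n] T x w cx e x' gx' cx' h1 h2 u eu.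
  apply: (@ev_mono _ S A n H (A0 X)).
  by rewrite chm_cd eu -chm_cd [_ ∘ x']cx' !cmpm0.
have [v ev] := aH (A0 X) _ _ _ cu.
have q : fmor H (sm S (A0 X)) ∘ B = idm _ by rewrite -(fmorM H) bm fmor1.
exists ((fmor H (sm S (A0 X)) : chmap _ _) n.+1 ∘ ((xin S H (A0 X) : chmap _ _) n.+1 ∘ v)
  + (k : chmap _ _) n.+1 ∘ w).
rewrite cmpDr -!chm_cd -ev eu.
rewrite (cmpA _ ((B : chmap _ _) n)) [X in X ∘ x'](chE q n) [X in _ = X + _]cmp1m.
by rewrite /x' subrK.
Qed.

(** * Comparison with [nabla] *)

Section ConcreteSlots.
Variables B P' : kadd.
Local Notation E := (prodc B P').
Implicit Types X Y : E.

Let dob X : E := (X.1 ⊕ X.1, X.2).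
Let dmor X Y (f : hom X Y) : hom (dob X) (dob Y) := (bimap f.1 f.1, f.2).

Fact dblL1 X : dmor (idm X) = idm (dob X).
Proof. by congr (_, _); apply: bimap1. Qed.

Fact dblLM X Y Z (g : hom Y Z) (f : hom X Y) : dmor (g ∘ f) = dmor g ∘ dmor f.
Proof. by congr (_, _); apply: bimap_cmp. Qed.

Definition dblL : functor E E := @Functor E E dob dmor dblL1 dblLM.

Let pL1 X : hom (dblL X) X := (pr1, idm _).
Let pL2 X : hom (dblL X) X := (pr2, idm _).
Let mL X : hom (dblL X) X := (bfold _, idm _).
Let iL1 X : hom X (dblL X) := (in1, idm _).
Let iL2 X : hom X (dblL X) := (in2, idm _).
Let zL X : hom X X := (0, idm _).
Let dL X : hom (dblL X) (dblL (dblL X)) := (bimap in1 in2, idm _).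

Lemma prod_eq X Y (f g : hom X Y) : f.1 = g.1 -> f.2 = g.2 -> f = g.
Proof. by case: f g => [f1 f2] [g1 g2] /= -> ->. Qed.

Fact pL1N X Y (f : hom X Y) : pL1 Y ∘ fmor dblL f = f ∘ pL1 X.
Proof. by apply: prod_eq; rewrite /= ?pr1_bimap ?cmp1m ?cmpm1. Qed.
Fact pL2N X Y (f : hom X Y) : pL2 Y ∘ fmor dblL f = f ∘ pL2 X.
Proof. by apply: prod_eq; rewrite /= ?pr2_bimap ?cmp1m ?cmpm1. Qed.
Fact mLN X Y (f : hom X Y) : mL Y ∘ fmor dblL f = f ∘ mL X.
Proof. by apply: prod_eq; rewrite /= -?fold_nat ?cmp1m ?cmpm1. Qed.
Fact iL1N X Y (f : hom X Y) : iL1 Y ∘ f = fmor dblL f ∘ iL1 X.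
Proof. by apply: prod_eq; rewrite /= ?bimap_in1 ?cmp1m ?cmpm1. Qed.
Fact iL2N X Y (f : hom X Y) : iL2 Y ∘ f = fmor dblL f ∘ iL2 X.
Proof. by apply: prod_eq; rewrite /= ?bimap_in2 ?cmp1m ?cmpm1. Qed.
Fact zLN X Y (f : hom X Y) : zL Y ∘ f = f ∘ zL X.
Proof. by apply: prod_eq; rewrite /= ?cmp0m ?cmpm0 ?cmp1m ?cmpm1. Qed.
Fact dLN X Y (f : hom X Y) : dL Y ∘ fmor dblL f = fmor dblL (fmor dblL f) ∘ dL X.
Proof.
by apply: prod_eq; rewrite /= -?bimap_cmp ?bimap_in1 ?bimap_in2 ?cmp1m ?cmpm1.
Qed.
Fact pL1_i1 X : pL1 X ∘ iL1 X = idm X.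
Proof. by apply: prod_eq; rewrite /= ?pr1_in1 ?cmp1m. Qed.
Fact pL2_i2 X : pL2 X ∘ iL2 X = idm X.
Proof. by apply: prod_eq; rewrite /= ?pr2_in2 ?cmp1m. Qed.
Fact pL1_i2 X : pL1 X ∘ iL2 X = zL X.
Proof. by apply: prod_eq; rewrite /= ?pr1_in2 ?cmp1m. Qed.
Fact pL2_i1 X : pL2 X ∘ iL1 X = zL X.
Proof. by apply: prod_eq; rewrite /= ?pr2_in1 ?cmp1m. Qed.
Fact zLz X : zL X ∘ zL X = zL X.
Proof. by apply: prod_eq; rewrite /= ?cmp0m ?cmp1m. Qed.
Fact zLp X : zL X ∘ pL1 X = zL X ∘ pL2 X.
Proof. by apply: prod_eq; rewrite /= ?cmp0m. Qed.
Fact dblLz X : fmor dblL (zL X) = zL (dblL X).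
Proof. by apply: prod_eq; rewrite //= /bimap !cmp0m /bpair !cmpm0 addr0. Qed.
Fact pL1_d X : pL1 (dblL X) ∘ dL X = iL1 X ∘ pL1 X.
Proof. by apply: prod_eq; rewrite /= ?pr1_bimap ?cmp1m. Qed.
Fact pL2_d X : pL2 (dblL X) ∘ dL X = iL2 X ∘ pL2 X.
Proof. by apply: prod_eq; rewrite /= ?pr2_bimap ?cmp1m. Qed.
Fact dblLp1_d X : fmor dblL (pL1 X) ∘ dL X = iL1 X ∘ pL1 X.
Proof.
apply: prod_eq; rewrite /= ?cmp1m // -bimap_cmp pr1_in1 pr1_in2.
by rewrite /bimap cmp0m /bpair cmpm0 addr0 cmp1m.
Qed.
Fact dblLp2_d X : fmor dblL (pL2 X) ∘ dL X = iL2 X ∘ pL2 X.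
Proof.
apply: prod_eq; rewrite /= ?cmp1m // -bimap_cmp pr2_in1 pr2_in2.
by rewrite /bimap cmp0m /bpair cmpm0 add0r cmp1m.
Qed.
Fact mL_d X : mL (dblL X) ∘ dL X = idm (dblL X).
Proof.
apply: prod_eq; rewrite /= ?cmp1m // /bfold /bcopair !cmp1m cmpDl.
by rewrite pr1_bimap pr2_bimap bipP.
Qed.
Fact dblLm_d X : fmor dblL (mL X) ∘ dL X = idm (dblL X).
Proof.
apply: prod_eq; rewrite /= ?cmp1m // -bimap_cmp /bfold.
by rewrite copair_in1 copair_in2 bimap1.
Qed.

Definition slotL : slot E :=
  Slot pL1N pL2N mLN iL1N iL2N zLN dLN pL1_i1 pL2_i2 pL1_i2 pL2_i1 zLz zLp dblLz
    pL1_d pL2_d dblLp1_d dblLp2_d mL_d dblLm_d.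

Variable T : slot P'.

Let robj X : E := (X.1, dbl T X.2).
Let rmor X Y (f : hom X Y) : hom (robj X) (robj Y) := (f.1, fmor (dbl T) f.2).

Fact dblR1 X : rmor (idm X) = idm (robj X).
Proof. by congr (_, _); apply: fmor1. Qed.

Fact dblRM X Y Z (g : hom Y Z) (f : hom X Y) : rmor (g ∘ f) = rmor g ∘ rmor f.
Proof. by congr (_, _); apply: fmorM. Qed.

Definition dblR : functor E E := @Functor E E robj rmor dblR1 dblRM.

Let pR1 X : hom (dblR X) X := (idm _, sp1 T _).
Let pR2 X : hom (dblR X) X := (idm _, sp2 T _).
Let mR X : hom (dblR X) X := (idm _, sm T _).
Let iR1 X : hom X (dblR X) := (idm _, si1 T _).
Let iR2 X : hom X (dblR X) := (idm _, si2 T _).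
Let zR X : hom X X := (idm _, sz T _).
Let dR X : hom (dblR X) (dblR (dblR X)) := (idm _, sd T _).

Fact pR1N X Y (f : hom X Y) : pR1 Y ∘ fmor dblR f = f ∘ pR1 X.
Proof. by apply: prod_eq; rewrite /= ?sp1N ?cmp1m ?cmpm1. Qed.
Fact pR2N X Y (f : hom X Y) : pR2 Y ∘ fmor dblR f = f ∘ pR2 X.
Proof. by apply: prod_eq; rewrite /= ?sp2N ?cmp1m ?cmpm1. Qed.
Fact mRN X Y (f : hom X Y) : mR Y ∘ fmor dblR f = f ∘ mR X.
Proof. by apply: prod_eq; rewrite /= ?smN ?cmp1m ?cmpm1. Qed.
Fact iR1N X Y (f : hom X Y) : iR1 Y ∘ f = fmor dblR f ∘ iR1 X.
Proof. by apply: prod_eq; rewrite /= ?si1N ?cmp1m ?cmpm1. Qed.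
Fact iR2N X Y (f : hom X Y) : iR2 Y ∘ f = fmor dblR f ∘ iR2 X.
Proof. by apply: prod_eq; rewrite /= ?si2N ?cmp1m ?cmpm1. Qed.
Fact zRN X Y (f : hom X Y) : zR Y ∘ f = f ∘ zR X.
Proof. by apply: prod_eq; rewrite /= ?szN ?cmp1m ?cmpm1. Qed.
Fact dRN X Y (f : hom X Y) : dR Y ∘ fmor dblR f = fmor dblR (fmor dblR f) ∘ dR X.
Proof. by apply: prod_eq; rewrite /= ?sdN ?cmp1m ?cmpm1. Qed.
Fact pR1_i1 X : pR1 X ∘ iR1 X = idm X.
Proof. by apply: prod_eq; rewrite /= ?sp1_i1 ?cmp1m. Qed.
Fact pR2_i2 X : pR2 X ∘ iR2 X = idm X.
Proof. by apply: prod_eq; rewrite /= ?sp2_i2 ?cmp1m. Qed.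
Fact pR1_i2 X : pR1 X ∘ iR2 X = zR X.
Proof. by apply: prod_eq; rewrite /= ?sp1_i2 ?cmp1m. Qed.
Fact pR2_i1 X : pR2 X ∘ iR1 X = zR X.
Proof. by apply: prod_eq; rewrite /= ?sp2_i1 ?cmp1m. Qed.
Fact zRz X : zR X ∘ zR X = zR X.
Proof. by apply: prod_eq; rewrite /= ?szz ?cmp1m. Qed.
Fact zRp X : zR X ∘ pR1 X = zR X ∘ pR2 X.
Proof. by apply: prod_eq; rewrite /= ?szp. Qed.
Fact dblRz X : fmor dblR (zR X) = zR (dblR X).
Proof. by apply: prod_eq; rewrite /= ?dblz. Qed.
Fact pR1_d X : pR1 (dblR X) ∘ dR X = iR1 X ∘ pR1 X.
Proof. by apply: prod_eq; rewrite /= ?sp1_d. Qed.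
Fact pR2_d X : pR2 (dblR X) ∘ dR X = iR2 X ∘ pR2 X.
Proof. by apply: prod_eq; rewrite /= ?sp2_d. Qed.
Fact dblRp1_d X : fmor dblR (pR1 X) ∘ dR X = iR1 X ∘ pR1 X.
Proof. by apply: prod_eq; rewrite /= ?dblp1_d. Qed.
Fact dblRp2_d X : fmor dblR (pR2 X) ∘ dR X = iR2 X ∘ pR2 X.
Proof. by apply: prod_eq; rewrite /= ?dblp2_d. Qed.
Fact mR_d X : mR (dblR X) ∘ dR X = idm (dblR X).
Proof. by apply: prod_eq; rewrite /= ?sm_d ?cmp1m. Qed.
Fact dblRm_d X : fmor dblR (mR X) ∘ dR X = idm (dblR X).
Proof. by apply: prod_eq; rewrite /= ?dblm_d ?cmp1m. Qed.

Definition slotR : slot E :=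
  Slot pR1N pR2N mRN iR1N iR2N zRN dRN pR1_i1 pR2_i2 pR1_i2 pR2_i1 zRz zRp dblRz
    pR1_d pR2_d dblRp1_d dblRp2_d mR_d dblRm_d.

(** Doublings in different coordinates commute on the nose, so the comparison maps are
    identities. *)
Definition smorLR : smor slotL slotL (dbl slotR).
Proof.
apply: (@Smor _ _ slotL slotL (dbl slotR) (fun X => idm _) (fun X => idm _)) => *;
  by apply: prod_eq; rewrite /= ?cmp1m ?cmpm1 ?fmor1.
Defined.

Definition comLR : com slotL slotR.
Proof. by apply: (@Com _ slotL slotR smorLR) => *; apply: prod_eq; rewrite /= ?bimap1 ?cmpm1. Defined.

Definition smorRL : smor slotR slotR (dbl slotL).
Proof.
apply: (@Smor _ _ slotR slotR (dbl slotL) (fun X => idm _) (fun X => idm _)) => *;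
  by apply: prod_eq; rewrite /= ?cmp1m ?cmpm1 ?bimap1.
Defined.

Definition comRL : com slotR slotL.
Proof. by apply: (@Com _ slotR slotL smorRL) => *; apply: prod_eq; rewrite /= ?fmor1 ?cmpm1. Defined.

End ConcreteSlots.

(** * From [C2] and [D_1] to doublings *)

Section CrossEffectC2.
Variables B C : kadd.
Implicit Types F G : functor B C.

Lemma C2in_pr F X : fmor F pr1 ∘ C2in F X = 0 /\ fmor F pr2 ∘ C2in F X = 0.
Proof.
have e := kinK (cr2_proj F ((X, X) : prodc B B)).
have e1 : fmor (cr1 F) pr1 ∘ kin (cr2_proj F ((X, X) : prodc B B)) = 0.
  by rewrite -[fmor (cr1 F) _](pr1_pair _ (fmor (cr1 F) pr2)) -cmpA [_ ∘ kin _]e cmpm0.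
have e2 : fmor (cr1 F) pr2 ∘ kin (cr2_proj F ((X, X) : prodc B B)) = 0.
  by rewrite -[fmor (cr1 F) _](pr2_pair (fmor (cr1 F) pr1)) -cmpA [_ ∘ kin _]e cmpm0.
split; rewrite cmpA -[X in X ∘ _](kerf_kin (to_zero F)) -cmpA.
  by rewrite [X in _ ∘ X]e1 cmpm0.
by rewrite [X in _ ∘ X]e2 cmpm0.
Qed.

(** An element killed by [F pr1] is automatically killed by [F 0]. So [C2 F X] is the joint kernel
    of the two projections on the whole of [F], as in the definition of [X2]. *)
Lemma C2_lift F X T (x : hom T (F (X ⊕ X))) :
  fmor F pr1 ∘ x = 0 -> fmor F pr2 ∘ x = 0 -> exists u, C2in F X ∘ u = x.
Proof.
move=> x1 x2; have x0 : to_zero F (X ⊕ X) ∘ x = 0.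
  rewrite /= -[0 : hom (X ⊕ X) zob](cmp0m _ (@pr1 _ X X)) fmorM -cmpA.
  by rewrite x1 cmpm0.
pose y := klift (to_zero F (X ⊕ X)) x.
have ey : kin (to_zero F (X ⊕ X)) ∘ y = x by exact: kin_lift.
exists (klift (cr2_proj F ((X, X) : prodc B B)) y); rewrite -cmpA kin_lift //.
rewrite /= pair_cmp.
have -> : fmor (cr1 F) pr1 ∘ y = 0.
  by apply: kin_mono; rewrite cmpA (kerf_kin (to_zero F)) -cmpA ey x1 cmpm0.
have -> : fmor (cr1 F) pr2 ∘ y = 0.
  by apply: kin_mono; rewrite cmpA (kerf_kin (to_zero F)) -cmpA ey x2 cmpm0.
by rewrite /bpair !cmpm0 addr0.
Qed.

Lemma C2_nbij F G (a : F ⟹ G) : nbij a -> nbij (C2_map a).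
Proof.
move=> ba X T; split=> [x e|y].
  apply: C2in_mono; rewrite cmpm0; apply: (ba _ T).1.
  by rewrite cmpA -C2_mapE -cmpA e cmpm0.
have [x ex] := (ba _ T).2 (C2in G X ∘ y).
have [g1 g2] := C2in_pr G X.
have [||u eu] := C2_lift (x := x).
- apply: (ba _ T).1; rewrite cmpA ntP -cmpA ex cmpA.
  by rewrite g1 cmp0m.
- apply: (ba _ T).1; rewrite cmpA ntP -cmpA ex cmpA.
  by rewrite g2 cmp0m.
by exists u; apply: C2in_mono; rewrite cmpA C2_mapE -cmpA eu.
Qed.

Definition C2m := itm (@C2_map B C).

Definition C2b := itb (@C2_map B C) (@epsilon B C).

Lemma C2b_map F G (a : F ⟹ G) k X : C2b G k X ∘ C2m a k.+1 X = C2m a k X ∘ C2b F k X.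
Proof.
elim: k X => [|k IH] X; first exact: epsilon_nat.
have bS H : C2b H k.+1 X = epsilon (iter k.+1 (@C2 B C) H) X - C2_map (C2b H k) X by [].
rewrite !bS cmpDl cmpDr cmpNm cmpmN.
have -> : C2m a k.+2 X = C2_map (C2m a k.+1) X by [].
rewrite (epsilon_nat (C2m a k.+1)); congr (_ - _).
exact: C2_map_comm.
Qed.

Lemma D1c_bdE F k X : D1c_bd F k.+1 X = C2b F k.+1 X.
Proof.
suff h j Y : \sum_(i < j.+1) face F j i Y *~ (-1) ^+ i = C2b F j Y by exact: h.
elim: j Y => [|j IH] Y; first by rewrite big_ord1 expr0 mulr1z.
by rewrite bdS; congr (_ - _); apply: C2_map_ext.
Qed.

End CrossEffectC2.

Section Bridge.
Variables (B A : kadd) (K : functor B (Ch A)).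
Local Notation E := (prodc B B).
Local Notation S := (slotL B B).

(** Sends [(V, X)] to [X ⊕ V], matching the order of summands in [addf]. *)
Definition sumr : functor E B := fcomp (sumf B) (fpair (sndf B B) (fstf B B)).

Definition inV (Y : B) : functor B E := fpair (idf B) (constf B Y).

Section Columns.
Variable C : kadd.
Implicit Types H : functor E C.

Definition incl_at Y H V : hom (C2 (fcomp H (inV Y)) V) (X2 S H (V, Y)) :=
  @xlift E S C H (V, Y) _ (C2in (fcomp H (inV Y)) V).

Lemma incl_atE Y H V : xin S H (V, Y) ∘ incl_at Y H V = C2in (fcomp H (inV Y)) V.
Proof. by have [h1 h2] := C2in_pr (fcomp H (inV Y)) V; apply: xliftE. Qed.

Fact incl_nat Y H V W (f : hom V W) :
  incl_at Y H W ∘ fmor (C2 (fcomp H (inV Y))) f =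
  fmor (fcomp (X2 S H) (inV Y)) f ∘ incl_at Y H V.
Proof.
have h : C2in (fcomp H (inV Y)) W ∘ fmor (C2 (fcomp H (inV Y))) f =
    fmor (fcomp H (inV Y)) (bimap f f) ∘ C2in (fcomp H (inV Y)) V.
  rewrite /C2in -!cmpA [X in _ ∘ X](kerf_kin (cr2_proj _)
    ((f, f) : hom ((V, V) : prodc B B) (W, W))) cmpA.
  by rewrite [X in X ∘ _](kerf_kin (to_zero _)) -[LHS]cmpA.
apply: xin_mono; rewrite cmpA incl_atE h [RHS]cmpA.
rewrite [X in _ = X ∘ _](@xin_nat E S C H (V, Y) (W, Y) (f, idm Y)).
by rewrite -[RHS]cmpA incl_atE.
Qed.

Definition incl Y H : C2 (fcomp H (inV Y)) ⟹ fcomp (X2 S H) (inV Y) :=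
  @Nattr _ _ (C2 (fcomp H (inV Y))) (fcomp (X2 S H) (inV Y)) (incl_at Y H) (@incl_nat Y H).

Lemma incl_eps Y H V :
  ntwhisker (xeps S H) (inV Y) V ∘ incl Y H V = epsilon (fcomp H (inV Y)) V.
Proof.
rewrite epsilonE -[LHS]/(fmor H (sm S (V, Y)) ∘ xin S H (V, Y) ∘ incl_at Y H V).
by rewrite -cmpA incl_atE.
Qed.

Lemma incl_map Y H H' (a : H ⟹ H') V :
  ntwhisker (X2_map S a) (inV Y) V ∘ incl Y H V =
  incl Y H' V ∘ C2_map (ntwhisker a (inV Y)) V.
Proof.
apply: xin_mono; rewrite -[ntwhisker _ _ V]/(X2_map S a (V, Y)).
rewrite -[nt (incl Y H) V]/(incl_at Y H V) -[nt (incl Y H') V]/(incl_at Y H' V).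
by rewrite cmpA X2_mapE -cmpA incl_atE [RHS]cmpA incl_atE C2_mapE.
Qed.

Lemma incl_bij Y H : nbij (incl Y H).
Proof.
move=> V T; split=> [x e|y].
  apply: C2in_mono; rewrite -incl_atE -!cmpA.
  by rewrite [incl_at Y H V ∘ x]e cmpm0 cmpm0.
have [||u eu] := @C2_lift B C (fcomp H (inV Y)) V T (xin S H (V, Y) ∘ y).
- by rewrite cmpA [X in X ∘ y](xin1 S H) cmp0m.
- by rewrite cmpA [X in X ∘ y](xin2 S H) cmp0m.
by exists u; apply: xin_mono; rewrite cmpA [X in X ∘ _]incl_atE.
Qed.

Definition incln Y :=
  @itt E S C B C (@C2 B C) (@C2_map B C) (fun H => fcomp H (inV Y)) (incl Y).

Lemma incln_b Y H k V :
  xb S H k (V, Y) ∘ incln Y H k.+1 V = incln Y H k V ∘ C2b (fcomp H (inV Y)) k V.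
Proof.
refine (@itt_b E S C B C (@C2 B C) (@C2_map B C) (@epsilon B C)
  _ _ (fun H => fcomp H (inV Y)) (fun F G a => ntwhisker a (inV Y)) _ (incl Y) _ _ H k V).
- by move=> *; apply: C2_map_comm.
- by move=> *; apply: epsilon_nat.
- by [].
- exact: incl_eps.
- exact: incl_map.
Qed.

Lemma incln_bij Y H k : nbij (incln Y H k).
Proof.
refine (@itt_bij E S C B C (@C2 B C) (@C2_map B C) _ (fun H => fcomp H (inV Y)) (incl Y) _ H k).
- by move=> *; apply: C2_nbij.
- exact: incl_bij.
Qed.

Fact parP H Y Z (g : hom Y Z) V W (f : hom V W) :
  fmor H ((idm W, g) : hom ((W, Y) : E) (W, Z)) ∘ fmor (fcomp H (inV Y)) f =
  fmor (fcomp H (inV Z)) f ∘ fmor H ((idm V, g) : hom ((V, Y) : E) (V, Z)).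
Proof.
rewrite -(fmorM H) -[RHS](fmorM H); congr (fmor H _).
by apply: prod_eq; rewrite /= !cmp1m !cmpm1.
Qed.

Definition par H Y Z (g : hom Y Z) : fcomp H (inV Y) ⟹ fcomp H (inV Z) :=
  @Nattr _ _ (fcomp H (inV Y)) (fcomp H (inV Z))
    (fun V => fmor H ((idm V, g) : hom ((V, Y) : E) (V, Z))) (@parP H Y Z g).

Lemma incln_par H Y Z (g : hom Y Z) k V :
  incln Z H k V ∘ C2m (par H g) k V =
  fmor (X2n S H k) ((idm V, g) : hom ((V, Y) : E) (V, Z)) ∘ incln Y H k V.
Proof.
elim: k V => [|k IH] V; first by rewrite cmp1m cmpm1.
have st U : incln U H k.+1 V = incl_at U (X2n S H k) V ∘ C2_map (incln U H k) V by [].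
rewrite !st -[C2m _ k.+1 V]/(C2_map (C2m (par H g) k) V) -[LHS]cmpA.
rewrite (C2_map_comm (b' := par (X2n S H k) g) (a' := incln Y H k)) //.
rewrite !cmpA; congr (_ ∘ _); apply: xin_mono.
rewrite [LHS]cmpA incl_atE C2_mapE [RHS]cmpA xin_nat -[RHS]cmpA incl_atE.
congr (fmor (X2n S H k) _ ∘ _); apply: prod_eq => //=.
by rewrite bimap1.
Qed.

End Columns.
End Bridge.

(** * [nabla] as linearization in the direction variable *)

Section NablaLin.
Variables (B A : kadd) (K : functor B (Ch A)).
Local Notation E := (prodc B B).
Local Notation S := (slotL B B).
Local Notation G := (fcomp K (sumr B)).
Local Notation H := (red S G).
Local Notation R Y := (fcomp H (inV Y)).

Fact jP (Y : B) V W (f : hom V W) :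
  redin S G (W, Y) ∘ fmor (R Y) f = fmor (addF K Y) f ∘ redin S G (V, Y).
Proof. exact: (ntP (redin S G) ((f, idm Y) : hom ((V, Y) : E) (W, Y))). Qed.

Definition jn Y : R Y ⟹ addF K Y :=
  @Nattr _ _ (R Y) (addF K Y) (fun V => redin S G (V, Y)) (@jP Y).

Lemma jn_mono Y V : mono (jn Y V).
Proof. exact: redin_mono. Qed.

Lemma addF_0 Y V W T (x : hom T (addF K Y V)) :
  fmor (addF K Y) (0 : hom V zob) ∘ x = 0 -> fmor (addF K Y) (0 : hom V W) ∘ x = 0.
Proof.
by move=> e; rewrite -[0 : hom V W](cmp0m _ (0 : hom V zob)) fmorM -cmpA e cmpm0.
Qed.

Lemma jn_lift Y V T (x : hom T (addF K Y V)) :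
  fmor (addF K Y) (0 : hom V zob) ∘ x = 0 -> exists u, jn Y V ∘ u = x.
Proof. by move=> e; apply: (@red_lift E S _ G (V, Y)); apply: addF_0 e. Qed.

Lemma jn_zero Y V : to_zero (addF K Y) V ∘ jn Y V = 0.
Proof.
rewrite -[LHS]/(fmor (addF K Y) (0 : hom V zob) ∘ jn Y V).
rewrite -[0 : hom V zob](cmp0m _ (0 : hom V V)) fmorM -cmpA.
by rewrite [X in _ ∘ X](redinK S G (V, Y)) cmpm0.
Qed.

Definition v0 Y V : hom (R Y V) (cr1 (addF K Y) V) := klift (to_zero (addF K Y) V) (jn Y V).

Lemma v0E Y V : kin (to_zero (addF K Y) V) ∘ v0 Y V = jn Y V.
Proof. exact/kin_lift/jn_zero. Qed.

(** Second cross effects do not change under passing to the reduced part, since their elements are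
    already killed by the map to zero. *)
Lemma C2_jn_bij Y : nbij (C2_map (jn Y)).
Proof.
move=> V T; split=> [x e|y].
  apply: C2in_mono; rewrite cmpm0; apply: jn_mono.
  by rewrite cmpA -C2_mapE -cmpA e !cmpm0.
have [g1 g2] := C2in_pr (addF K Y) V.
have [|x ex] := @jn_lift Y (V ⊕ V) T (C2in (addF K Y) V ∘ y).
  rewrite -[0 : hom (V ⊕ V) zob](cmp0m _ pr1) fmorM cmpA -(cmpA _ _ (C2in _ _)) g1.
  by rewrite cmpm0 cmp0m.
have [||u eu] := C2_lift (F := R Y) (x := x).
- by apply: jn_mono; rewrite cmpA ntP -cmpA ex cmpA g1 cmp0m cmpm0.
- by apply: jn_mono; rewrite cmpA ntP -cmpA ex cmpA g2 cmp0m cmpm0.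
by exists u; apply: C2in_mono; rewrite cmpA C2_mapE -cmpA eu.
Qed.

(** Degree 0 is separate because [D_1] starts with [cr1] of the functor but continues with [C2]
    iterates of the unreduced functor, whereas [Pc S H] iterates on the reduced functor
    throughout. *)
Definition vk k Y V : hom (iter k (@C2 B (Ch A)) (R Y) V) (D1c_ob (addF K Y) k V) :=
  match k with 0 => v0 Y V | k'.+1 => C2m (jn Y) k'.+1 V end.

Lemma vk_bd k Y V :
  D1c_bd (addF K Y) k V ∘ vk k.+1 Y V = vk k Y V ∘ C2b (R Y) k V.
Proof.
case: k => [|k]; last by rewrite D1c_bdE; apply: C2b_map.
apply: kin_mono; rewrite cmpA [X in X ∘ _]rho1E cmpA v0E.
exact: epsilon_nat.
Qed.

Lemma vk_inv k Y V : exists i, i ∘ vk k Y V = idm _ /\ vk k Y V ∘ i = idm _.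
Proof.
case: k => [|k]; last first.
  apply: (@nbij_inv _ _ _ _ (C2m (jn Y) k.+1)).
  by elim: k => [|k IH]; [exact: C2_jn_bij | exact: C2_nbij].
have m : mono (v0 Y V).
  move=> W x y e; apply: jn_mono; rewrite -v0E -!cmpA.
  by rewrite e.
have [i ei] : exists i, v0 Y V ∘ i = idm _.
  have [|i ei] := @jn_lift Y V _ (kin (to_zero (addF K Y) V)); first exact: kinK.
  by exists i; apply: kin_mono; rewrite cmpA v0E ei cmpm1.
by exists i; split=> //; apply: m; rewrite cmpA ei cmp1m cmpm1.
Qed.

Definition vinv k Y V := sval (cid (vk_inv k Y V)).

Lemma vinvK k Y V : vinv k Y V ∘ vk k Y V = idm _.
Proof. exact: (svalP (cid (vk_inv k Y V))).1. Qed.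

Lemma vkK k Y V : vk k Y V ∘ vinv k Y V = idm _.
Proof. exact: (svalP (cid (vk_inv k Y V))).2. Qed.

Definition wk k Y V : hom (D1c_ob (addF K Y) k V) (X2n S H k (V, Y)) :=
  incln Y H k V ∘ vinv k Y V.

Lemma wkE k Y V : wk k Y V ∘ vk k Y V = incln Y H k V.
Proof. by rewrite -cmpA vinvK cmpm1. Qed.

(** The inverse of [vk] comes from choice, so identities involving [wk] are tested after
    precomposition with [vk], where the inverse disappears. *)
Lemma vk_epi k Y V : epi (vk k Y V).
Proof.
by move=> Z x y e; rewrite -[x]cmpm1 -[y]cmpm1 -(vkK k Y V) !cmpA e.
Qed.

Fact wk_bd Y V k :
  cd (Pc S H (V, Y)) k ∘ wk k.+1 Y V = wk k Y V ∘ cd (D1c (addF K Y) V : cpx (Ch A)) k.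
Proof.
apply: (@vk_epi k.+1 Y V); rewrite -[LHS]cmpA wkE.
rewrite -[RHS]cmpA [X in _ = _ ∘ X](vk_bd k Y V) [RHS]cmpA wkE.
exact: incln_b.
Qed.

Definition wc Y V : @hom (Ch (Ch A)) (D1c (addF K Y) V) (Pc S H (V, Y)) :=
  @Chmap (Ch A) (D1c (addF K Y) V) (Pc S H (V, Y)) (fun k => wk k Y V) (wk_bd Y V).

Lemma vk_nat k Y V W (f : hom V W) :
  vk k Y W ∘ fmor (iter k (@C2 B (Ch A)) (R Y)) f = fmor (D1c_ob (addF K Y) k) f ∘ vk k Y V.
Proof.
case: k => [|k]; last exact: (ntP (C2m (jn Y) k.+1)).
apply: kin_mono; rewrite cmpA v0E [RHS]cmpA [X in _ = X ∘ _](kerf_kin (to_zero _)).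
by rewrite -[RHS]cmpA v0E; apply: (ntP (jn Y)).
Qed.

Lemma jn_par Y Z (g : hom Y Z) V : jn Z V ∘ par H g V = addF_map K g V ∘ jn Y V.
Proof. exact: (ntP (redin S G) ((idm V, g) : hom ((V, Y) : E) (V, Z))). Qed.

Lemma vk_par k Y Z (g : hom Y Z) V :
  vk k Z V ∘ C2m (par H g) k V = D1c_map_ob (addF_map K g) k V ∘ vk k Y V.
Proof.
case: k => [|k].
  apply: kin_mono; rewrite cmpA v0E [RHS]cmpA cr1_mapE -[RHS]cmpA v0E.
  exact: jn_par.
suff h m W : C2m (jn Z) m W ∘ C2m (par H g) m W = C2n_map (addF_map K g) m W ∘ C2m (jn Y) m W.
  exact: h.
elim: m W => [|m IH] W; first exact: jn_par.
exact: C2_map_comm.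
Qed.

Lemma wc_nat Y Z (g : hom Y Z) V W (f : hom V W) :
  wc Z W ∘ (D1c_map (addF_map K g) W ∘ fmor (D1c (addF K Y)) f) =
  fmor (Pc S H) ((f, g) : hom ((V, Y) : E) (W, Z)) ∘ wc Y V.
Proof.
apply: chmap_eq => k; apply: (@vk_epi k Y V).
have e1 : wk k Z W ∘ (D1c_map_ob (addF_map K g) k W ∘ fmor (D1c_ob (addF K Y) k) f) ∘ vk k Y V
    = incln Z H k W ∘ C2m (par H g) k W ∘ fmor (iter k (@C2 B (Ch A)) (R Y)) f.
  by rewrite -!cmpA -vk_nat (cmpA _ (vk k Y W)) -vk_par !cmpA wkE.
have e2 : fmor (X2n S H k) ((f, g) : hom ((V, Y) : E) (W, Z)) ∘ wk k Y V ∘ vk k Y V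
    = incln Z H k W ∘ C2m (par H g) k W ∘ fmor (iter k (@C2 B (Ch A)) (R Y)) f.
  rewrite -cmpA wkE incln_par -[RHS]cmpA.
  have -> : incln Y H k W ∘ fmor (iter k (@C2 B (Ch A)) (R Y)) f =
      fmor (X2n S H k) ((f, idm Y) : hom ((V, Y) : E) (W, Y)) ∘ incln Y H k V.
    exact: (ntP (incln Y H k) f).
  rewrite [RHS]cmpA -(fmorM (X2n S H k)); congr (fmor (X2n S H k) _ ∘ _).
  by apply: prod_eq; rewrite /= ?cmp1m ?cmpm1.
exact: etrans e1 (esym e2).
Qed.

Definition nabla_lin_at (VX : E) : @hom (Ch A) (nabla K VX) (P S H VX) :=
  match VX as VX return @hom (Ch A) (nabla K VX) (P S H VX) with
  | (V, Y) => fmor (Tot A) (wc Y V)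
  end.

Fact nabla_lin_nat (VX WY : E) (f : hom VX WY) :
  nabla_lin_at WY ∘ fmor (nabla K) f = fmor (P S H) f ∘ nabla_lin_at VX.
Proof.
case: VX WY f => [V Y] [W Z] [f g].
rewrite -[RHS](fmorM (Tot A)) -[fmor (nabla K) _]/(fmor (Tot A) (D1c_map (addF_map K g) W) ∘
  fmor (Tot A) (fmor (D1c (addF K Y)) f)).
by rewrite -(fmorM (Tot A)) -[LHS](fmorM (Tot A)); congr (fmor (Tot A) _); apply: wc_nat.
Qed.

(** The two complexes are isomorphic level by level before totalization, naturally in the direction
    and in the base point; the latter permits differentiating again. *)
Lemma nabla_lin : zz (nabla K) (lin S (fcomp K (sumr B))).
Proof.
apply: (zz_nweq (a := @Nattr _ _ (nabla K) (P S H) nabla_lin_at nabla_lin_nat)) => -[V Y].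
apply: (@totc_weq _ 0) => k.
have [j [ij ji]] := nbij_inv V (incln_bij Y H k).
apply: (weq_iso (g := fun n => ((vk k Y V ∘ j : @hom (Ch A) _ _) : chmap _ _) n)) => n.
  have e : vk k Y V ∘ j ∘ wk k Y V = idm _.
    by rewrite /wk -cmpA (cmpA j) ij cmp1m vkK.
  exact: (chE e n).
have e : wk k Y V ∘ (vk k Y V ∘ j) = idm _ by rewrite cmpA wkE ji.
exact: (chE e n).
Qed.

End NablaLin.

Ltac zz_same :=
  match goal with |- zz ?F ?G =>
    apply: (zz_nweq (a := @Nattr _ _ F G (fun X => idm (F X))
      (fun X Y f => etrans (cmp1m (fmor F f)) (esym (cmpm1 (fmor F f)))))) => ?;
    exact: weq_id
  end.

Ltac smor_id :=
  match goal with |- smor ?S' ?S ?L =>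
    apply: (@Smor _ _ S' S L (fun X => idm _) (fun X => idm _)) => *;
    do ?[apply: prod_eq]; rewrite /= ?cmp1m ?cmpm1 ?bimap1
  end.

Lemma zz_whisk (D E : preadd) (A : kadd) (T : functor E (Ch A)) (L1 L2 : functor D E)
    (q : L1 ⟹ L2) (i : forall X, hom (L2 X) (L1 X)) :
  (forall X, i X ∘ q X = idm _) -> (forall X, q X ∘ i X = idm _) ->
  zz (fcomp T L1) (fcomp T L2).
Proof.
move=> iq qi.
have N X Y (f : hom X Y) : fmor T (q Y) ∘ fmor (fcomp T L1) f =
    fmor (fcomp T L2) f ∘ fmor T (q X).
  by rewrite -[LHS](fmorM T) ntP fmorM.
apply: (zz_iso (a := @Nattr _ _ (fcomp T L1) (fcomp T L2) (fun X => fmor T (q X)) N)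
  (i := fun X => fmor T (i X))) => X.
  by rewrite -[LHS]/(fmor T (i X) ∘ fmor T (q X)) -(fmorM T) iq fmor1.
by rewrite -[LHS]/(fmor T (q X) ∘ fmor T (i X)) -(fmorM T) qi fmor1.
Qed.

Section Nabla.
Variables B A : kadd.
Implicit Types F G K : functor B (Ch A).
Local Notation BB := (prodc B B).
Local Notation slB := (slotL B B).

Lemma zz_nabla F G : zz F G -> zz (nabla F) (nabla G).
Proof.
move=> z; apply: zz_trans (nabla_lin F) _; apply: zz_trans (zz_sym (nabla_lin G)).
exact/zz_lin/zz_pre.
Qed.

Lemma nabla_fbip F G : zz (nabla (fbip F G)) (fbip (nabla F) (nabla G)).
Proof.
apply: zz_trans (nabla_lin _) _.
apply: zz_trans (zz_sym (zz_fbip (nabla_lin F) (nabla_lin G))).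
apply: zz_trans (lin_fbip _ _ _); apply: zz_lin; zz_same.
Qed.

End Nabla.

(** * Substitution of additive functors *)

Section AdditiveFunctor.
Variables (B B' : kadd) (L : functor B B').
Hypothesis LD : forall X Y (f g : hom X Y), fmor L (f + g) = fmor L f + fmor L g.

Lemma fmor_add0 X Y : fmor L (0 : hom X Y) = 0.
Proof. by apply: (addrI (fmor L 0)); rewrite -LD !addr0. Qed.

Definition sqf : functor (prodc B B) (prodc B' B') :=
  fpair (fcomp L (fstf B B)) (fcomp L (sndf B B)).

Lemma add_pairK X Y :
  bcopair (fmor L in1) (fmor L in2) ∘ bpair (fmor L pr1) (fmor L pr2) = idm (L (X ⊕ Y)).
Proof. by rewrite /bcopair cmpDl -!cmpA pr1_pair pr2_pair -!(fmorM L) -LD bipP fmor1. Qed.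

Lemma add_copairK X Y :
  bpair (fmor L pr1) (fmor L pr2) ∘ bcopair (fmor L in1) (fmor L in2) = idm (L X ⊕ L Y).
Proof.
apply: cobip_eq; rewrite -cmpA ?copair_in1 ?copair_in2 pair_cmp -!(fmorM L) cmp1m.
  by rewrite pr1_in1 pr2_in1 fmor_add0 fmor1 /bpair cmpm1 cmpm0 addr0.
by rewrite pr1_in2 pr2_in2 fmor_add0 fmor1 /bpair cmpm1 cmpm0 add0r.
Qed.

Definition sqf_smor : smor (slotL B B) (slotL B' B') sqf.
Proof.
apply: (@Smor _ _ (slotL B B) (slotL B' B') sqf
  (fun X => (bpair (fmor L pr1) (fmor L pr2), idm _))
  (fun X => (bcopair (fmor L in1) (fmor L in2), idm _))) => *; apply: prod_eq;
  rewrite /= ?cmp1m ?cmpm1 ?fmor1 //.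
- by rewrite pair_cmp bimap_pair -!(fmorM L) pr1_bimap pr2_bimap.
- exact: add_pairK.
- exact: add_copairK.
- exact: pr1_pair.
- exact: pr2_pair.
- by rewrite /bfold /bcopair !cmp1m LD cmpDl pr1_pair pr2_pair.
- by rewrite fmor_add0.
Defined.

(** An additive [L] preserves biproducts up to isomorphism, so it respects both the doubling of the
    direction and the sum of point and direction. *)
Lemma nabla_add (A : kadd) (T : functor B' (Ch A)) :
  zz (nabla (fcomp T L)) (fcomp (nabla T) sqf).
Proof.
apply: zz_trans (nabla_lin _) _; apply: zz_trans (zz_pre _ (zz_sym (nabla_lin T))).
apply: zz_trans (lin_smor sqf_smor _); apply: zz_lin.
apply: (zz_trans (G := fcomp T (fcomp L (sumr B)))); first by zz_same.
apply: (zz_trans (G := fcomp T (fcomp (sumr B') sqf))); last by zz_same.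
have N X Y (f : hom X Y) : bpair (fmor L pr1) (fmor L pr2) ∘ fmor (fcomp L (sumr B)) f =
    fmor (fcomp (sumr B') sqf) f ∘ bpair (fmor L pr1) (fmor L pr2).
  by rewrite /= pair_cmp bimap_pair -!(fmorM L) pr1_bimap pr2_bimap.
apply: (zz_whisk T (q := @Nattr _ _ (fcomp L (sumr B)) (fcomp (sumr B') sqf)
  (fun X => bpair (fmor L pr1) (fmor L pr2)) N)
  (i := fun X => bcopair (fmor L in1) (fmor L in2))) => X.
  exact: add_pairK.
exact: add_copairK.
Qed.

End AdditiveFunctor.

Lemma zz_assoc (D E E' : preadd) (A : kadd) (T : functor E' (Ch A)) (L1 : functor E E')
    (L2 : functor D E) : zz (fcomp (fcomp T L1) L2) (fcomp T (fcomp L1 L2)).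
Proof. zz_same. Qed.

Section Exchange.
Variable B : kadd.
Implicit Types x y z : B.

Definition bexch x y z : hom (x ⊕ y ⊕ z) (x ⊕ z ⊕ y) :=
  bpair (bpair (pr1 ∘ pr1) pr2) (pr2 ∘ pr1).

Lemma bexch_nat x y z x' y' z' (f : hom x x') (g : hom y y') (h : hom z z') :
  bexch x' y' z' ∘ bimap (bimap f g) h = bimap (bimap f h) g ∘ bexch x y z.
Proof.
rewrite [LHS]pair_cmp [X in bpair X _ = _]pair_cmp [RHS]bimap_pair.
rewrite [X in _ = bpair X _]bimap_pair -!cmpA pr1_bimap pr2_bimap.
by rewrite !(cmpA _ (bimap _ _)) pr1_bimap pr2_bimap -!cmpA.
Qed.

Lemma bexchK x y z : bexch x z y ∘ bexch x y z = idm _.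
Proof.
rewrite [LHS]pair_cmp [X in bpair X _ = _]pair_cmp -!cmpA !pr1_pair !pr2_pair.
by rewrite pair_eta -[pr1]cmpm1 -[pr2]cmpm1 pair_eta.
Qed.

End Exchange.

(** * Second derivatives *)

Section SecondDerivative.
Variables B A : kadd.
Local Notation BB := (prodc B B).
Local Notation E3 := (prodc B BB).
Local Notation E4 := (prodc BB BB).
Local Notation slB := (slotL B B).
Local Notation s1 := (slotL B BB).
Local Notation s2 := (slotR B slB).
Local Notation sT := (slotL BB BB).

(* [dirn W K] is [X |-> nabla K (W; X)]. *)
Definition dirn (B' : kadd) (W : B') (K : functor B' (Ch A)) : functor B' (Ch A) :=
  fcomp (nabla K) (fpair (constf B' W) (idf B')).

Definition at1 (W : B) : functor BB E3 := fpair (constf BB W) (idf BB).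

(* [n1 (W, (V, X)) = (W, X ⊕ V)] and [n2 (W, (V, X)) = (V, X ⊕ W)] *)
Definition n1 : functor E3 BB := fpair (fstf B BB) (fcomp (sumr B) (sndf B BB)).
Definition n2 : functor E3 BB :=
  fpair (fcomp (fstf B B) (sndf B BB))
    (fcomp (sumf B) (fpair (fcomp (sndf B B) (sndf B BB)) (fstf B BB))).
Definition swp : functor E3 E3 :=
  fpair (fcomp (fstf B B) (sndf B BB))
    (fpair (fstf B BB) (fcomp (sndf B B) (sndf B BB))).

(* [o0 (Y, (V, X)) = (V ⊕ Y, X)] and [o2 (Y, (V, X)) = (Y, X)] *)
Definition o0 : functor E3 BB :=
  fpair (fcomp (sumf B) (fpair (fcomp (fstf B B) (sndf B BB)) (fstf B BB)))
    (fcomp (sndf B B) (sndf B BB)).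
Definition o2 : functor E3 BB := fpair (fstf B BB) (fcomp (sndf B B) (sndf B BB)).

(** [j1] and [j2] insert the partial directions [(Y, 0)] and [(0, W)] of the base category
    [B × B]. *)
Definition j1 : functor E3 E4 := fpair (fpair (fstf B BB) (constf E3 zob)) (sndf B BB).
Definition j2 : functor E3 E4 := fpair (fpair (constf E3 zob) (fstf B BB)) (sndf B BB).

Definition at1_smor W : smor slB s2 (at1 W). Proof. by smor_id. Defined.
Definition n1_smor : smor s1 slB n1. Proof. by smor_id. Defined.
Definition n2_smor : smor s2 slB n2. Proof. by smor_id. Defined.
Definition swp_smor1 : smor s1 s2 swp. Proof. by smor_id. Defined.
Definition swp_smor2 : smor s2 s1 swp. Proof. by smor_id. Defined.
Definition o2_smor : smor s1 slB o2. Proof. by smor_id. Defined.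

Lemma zob2_eq (T : B) (f g : hom T (zob ⊕ zob)) : f = g.
Proof. by apply: bip_eq; apply: homz_eq. Qed.

Definition j1_smor : smor s1 sT j1.
Proof.
apply: (@Smor _ _ s1 sT j1 (fun X => ((idm _, 0), idm _)) (fun X => ((idm _, 0), idm _)))
  => *; do ?[apply: prod_eq];
  rewrite /= /bfold /bcopair ?cmp1m ?cmpm1 //;
  first [exact: homz_eq | exact: zob2_eq].
Defined.

Definition j2_smor : smor s1 sT j2.
Proof.
by apply: (@Smor _ _ s1 sT j2 (fun X => ((0, idm _), idm _)) (fun X => ((0, idm _), idm _)))
  => *; do ?[apply: prod_eq];
  rewrite /= /bfold /bcopair ?cmp1m ?cmpm1 //;
  first [exact: homz_eq | exact: zob2_eq].
Defined.

Variable K : functor B (Ch A).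

(** [J] is [K (X ⊕ V ⊕ W)] as a functor of [(W, (V, X))]. Its linearization [Q] in [W] and [V] is
    the second derivative with both directions kept as variables. *)
Definition J := fcomp (fcomp K (sumr B)) n1.
Definition Q := lin s2 (lin s1 J).

Lemma J_swap : zz J (fcomp (fcomp K (sumr B)) n2).
Proof.
have qN X Y (f : hom X Y) : bexch _ _ _ ∘ fmor (fcomp (sumr B) n1) f =
    fmor (fcomp (sumr B) n2) f ∘ bexch _ _ _ by exact: bexch_nat.
apply: (zz_trans (G := fcomp K (fcomp (sumr B) n1))); first by zz_same.
apply: (zz_trans (G := fcomp K (fcomp (sumr B) n2))); last by zz_same.
by apply: (zz_whisk K (q := @Nattr _ _ (fcomp (sumr B) n1) (fcomp (sumr B) n2)
  (fun X => bexch _ _ _) qN) (i := fun X => bexch _ _ _)) => X; apply: bexchK.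
Qed.

Lemma nabla_dirn W : zz (nabla (dirn W K)) (fcomp Q (at1 W)).
Proof.
apply: zz_trans (nabla_lin _) _.
apply: zz_trans (lin_smor (at1_smor W) _); apply: zz_lin.
apply: (zz_trans (G := fcomp (fcomp (nabla K) n1) (at1 W))); first by zz_same.
apply: zz_pre; apply: zz_trans (zz_pre _ (nabla_lin K)) _.
exact: zz_sym (lin_smor n1_smor _).
Qed.

Lemma Q_comm : zz Q (lin s1 (lin s2 J)).
Proof. exact: lin_comm (comRL B slB) (comLR B slB) J. Qed.

(** Exchanging the directions exchanges the order of the two linearizations, undone by [Q_comm], and
    the order of the summands, undone by [J_swap]. *)
Lemma Q_swap : zz (fcomp Q swp) Q.
Proof.
apply: zz_trans (zz_sym (lin_smor swp_smor1 _)) _.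
apply: zz_trans (zz_sym Q_comm); apply: zz_lin.
apply: zz_trans (zz_sym (lin_smor swp_smor2 _)) _; apply: zz_lin.
apply: zz_trans (zz_sym J_swap); zz_same.
Qed.

Lemma dirn_comm V W : zz (dirn V (dirn W K)) (dirn W (dirn V K)).
Proof.
pose p (V W : B) : functor B E3 := fpair (constf B W) (fpair (constf B V) (idf B)).
have h U U' : zz (dirn U (dirn U' K)) (fcomp Q (p U U')).
  apply: zz_trans (zz_pre _ (nabla_dirn U')) _; zz_same.
apply: zz_trans (h V W) _; apply: zz_sym; apply: zz_trans (h W V) _.
apply: (zz_trans (G := fcomp (fcomp Q swp) (p V W))); first by zz_same.
exact/zz_pre/Q_swap.
Qed.

Local Notation N := (lin slB (fcomp K (sumr B))).

Lemma N_split : zz (fcomp N o0) (fbip (fcomp N (sndf B BB)) (fcomp N o2)).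
Proof.
have p1N X Y (f : hom X Y) : ((pr1, idm _) : hom (o0 Y) (sndf B BB Y)) ∘ fmor o0 f =
    fmor (sndf B BB) f ∘ ((pr1, idm _) : hom (o0 X) (sndf B BB X)).
  by apply: prod_eq; rewrite /= ?pr1_bimap ?cmp1m ?cmpm1.
have p2N X Y (f : hom X Y) : ((pr2, idm _) : hom (o0 Y) (o2 Y)) ∘ fmor o0 f =
    fmor o2 f ∘ ((pr2, idm _) : hom (o0 X) (o2 X)).
  by apply: prod_eq; rewrite /= ?pr2_bimap ?cmp1m ?cmpm1.
have i1N X Y (f : hom X Y) : ((in1, idm _) : hom (sndf B BB Y) (o0 Y)) ∘ fmor (sndf B BB) f =
    fmor o0 f ∘ ((in1, idm _) : hom (sndf B BB X) (o0 X)).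
  by apply: prod_eq; rewrite /= ?bimap_in1 ?cmp1m ?cmpm1.
have i2N X Y (f : hom X Y) : ((in2, idm _) : hom (o2 Y) (o0 Y)) ∘ fmor o2 f =
    fmor o0 f ∘ ((in2, idm _) : hom (o2 X) (o0 X)).
  by apply: prod_eq; rewrite /= ?bimap_in2 ?cmp1m ?cmpm1.
apply: (@lin_split _ _ slB A N o0 (sndf B BB) o2
  (@Nattr _ _ o0 (sndf B BB) (fun X => (pr1, idm _)) p1N)
  (@Nattr _ _ o0 o2 (fun X => (pr2, idm _)) p2N)
  (@Nattr _ _ (sndf B BB) o0 (fun X => (in1, idm _)) i1N)
  (@Nattr _ _ o2 o0 (fun X => (in2, idm _)) i2N)
  (fun X => (bpair (in1 ∘ pr1) (in2 ∘ pr2), idm _))) => [||X|X|X|X|X|X|X];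
  [exact: lin_reduced|exact: lin_affine|..]; apply: prod_eq;
  rewrite /= ?pr1_in1 ?pr2_in2 ?pr1_in2 ?pr2_in1 ?pr1_pair ?pr2_pair ?cmp1m ?cmp0m //.
by rewrite /bfold /bcopair !cmp1m cmpDl pr1_pair pr2_pair bipP.
Qed.

(** [N] is linear in its first variable, so [N (V ⊕ Y, X)] splits into [N (V, X)], which is constant
    in [Y] and dies under linearization, and [N (Y, X)], which is already linear. *)
Lemma lin_o0 : zz (lin s1 (fcomp N o0)) (fcomp N o2).
Proof.
apply: zz_trans (zz_lin _ N_split) _; apply: zz_trans (lin_fbip _ _ _) _.
apply: zz_trans (zz_fbip0 _ _) _; last first.
  by apply: zz_trans (lin_smor o2_smor _) _; apply: zz_pre; apply: lin_lin.
by apply: lin_const => X; apply: fmor1.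
Qed.

(** The derivative is linear in its direction, and [(Y, W)] is the sum of [(Y, 0)] and [(0, W)]. The
    first moves the linear variable of [nabla K], which substitutes [Y] there by [lin_o0]; the
    second moves the base point and gives a second derivative of [K]. *)
Lemma nabla_nabla Y W :
  zz (dirn ((Y, W) : BB) (nabla K)) (fbip (fcomp (dirn Y K) (sndf B B)) (nabla (dirn W K))).
Proof.
pose M := fcomp (nabla K) (sumr BB).
pose H := lin sT M.
pose A0 : functor BB E4 := fpair (constf BB ((Y, W) : BB)) (idf BB).
pose A1 : functor BB E4 := fpair (constf BB ((Y, zob) : BB)) (idf BB).
pose A2 : functor BB E4 := fpair (constf BB ((zob, W) : BB)) (idf BB).
have split : zz (fcomp H A0) (fbip (fcomp H A1) (fcomp H A2)).
  have p1N U V (f : hom U V) : (((idm Y, 0), idm _) : hom (A0 V) (A1 V)) ∘ fmor A0 f =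
      fmor A1 f ∘ (((idm Y, 0), idm _) : hom (A0 U) (A1 U)).
    by do ?[apply: prod_eq]; rewrite /= ?cmp1m ?cmpm1.
  have p2N U V (f : hom U V) : (((0, idm W), idm _) : hom (A0 V) (A2 V)) ∘ fmor A0 f =
      fmor A2 f ∘ (((0, idm W), idm _) : hom (A0 U) (A2 U)).
    by do ?[apply: prod_eq]; rewrite /= ?cmp1m ?cmpm1.
  have i1N U V (f : hom U V) : (((idm Y, 0), idm _) : hom (A1 V) (A0 V)) ∘ fmor A1 f =
      fmor A0 f ∘ (((idm Y, 0), idm _) : hom (A1 U) (A0 U)).
    by do ?[apply: prod_eq]; rewrite /= ?cmp1m ?cmpm1.
  have i2N U V (f : hom U V) : (((0, idm W), idm _) : hom (A2 V) (A0 V)) ∘ fmor A2 f =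
      fmor A0 f ∘ (((0, idm W), idm _) : hom (A2 U) (A0 U)).
    by do ?[apply: prod_eq]; rewrite /= ?cmp1m ?cmpm1.
  apply: (@lin_split _ _ sT A H A0 A1 A2
    (@Nattr _ _ A0 A1 (fun X => ((idm Y, 0), idm _)) p1N)
    (@Nattr _ _ A0 A2 (fun X => ((0, idm W), idm _)) p2N)
    (@Nattr _ _ A1 A0 (fun X => ((idm Y, 0), idm _)) i1N)
    (@Nattr _ _ A2 A0 (fun X => ((0, idm W), idm _)) i2N)
    (fun X => ((in1, in2), idm _))) => [||X|X|X|X|X|X|X];
    [exact: lin_reduced|exact: lin_affine|..]; do ?[apply: prod_eq];
    rewrite /= ?cmp1m ?cmp0m ?cmpm0 ?cmpDl ?pr1_in1 ?pr2_in2 ?pr1_in2 ?pr2_in1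
      ?addr0 ?add0r //; exact: homz_eq.
apply: zz_trans (zz_pre _ (nabla_lin _)) _; apply: zz_trans split _; apply: zz_fbip.
- apply: (zz_trans (G := fcomp (fcomp H j1) (at1 Y))); first by zz_same.
  apply: (zz_trans (G := fcomp (fcomp (nabla K) o2) (at1 Y))); last by zz_same.
  apply: zz_pre; apply: zz_trans (zz_sym (lin_smor j1_smor _)) _.
  apply: zz_trans (zz_sym (zz_pre o2 (nabla_lin K))).
  apply: zz_trans lin_o0; apply: zz_lin; apply: zz_trans (zz_pre o0 (nabla_lin K)).
  have qN U V (f : hom U V) : ((idm _, pr1) : hom (sumr BB (j1 V)) (o0 V)) ∘
      fmor (fcomp (sumr BB) j1) f = fmor o0 f ∘ ((idm _, pr1) : hom (sumr BB (j1 U)) (o0 U)).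
    by apply: prod_eq; rewrite /= ?pr1_bimap ?cmp1m ?cmpm1.
  apply: (zz_trans (G := fcomp (nabla K) (fcomp (sumr BB) j1))); first exact: zz_assoc.
  apply: (zz_whisk (nabla K) (q := @Nattr _ _ (fcomp (sumr BB) j1) o0 (fun X => (idm _, pr1)) qN)
    (i := fun X => (idm _, in1))) => X; apply: prod_eq; rewrite /= ?cmp1m ?pr1_in1 //.
  by rewrite -[RHS]bipP [in2](zhom_eq _ 0) cmp0m addr0.
(* Here [K] is differentiated in the direction [V] before [W], the opposite of the order in [Q];
   this is where symmetry is used. *)
apply: (zz_trans (G := fcomp (fcomp H j2) (at1 W))); first by zz_same.
apply: zz_trans (zz_sym (nabla_dirn W)); apply: zz_pre.
apply: zz_trans (zz_sym (lin_smor j2_smor _)) _.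
apply: zz_trans (zz_sym Q_comm); apply: zz_lin.
apply: (zz_trans (G := fcomp (nabla K) n2)).
  have qN U V (f : hom U V) : ((pr1, idm _) : hom (sumr BB (j2 V)) (n2 V)) ∘
      fmor (fcomp (sumr BB) j2) f = fmor n2 f ∘ ((pr1, idm _) : hom (sumr BB (j2 U)) (n2 U)).
    by apply: prod_eq; rewrite /= ?pr1_bimap ?cmp1m ?cmpm1.
  apply: (zz_trans (G := fcomp (nabla K) (fcomp (sumr BB) j2))); first exact: zz_assoc.
  apply: (zz_whisk (nabla K) (q := @Nattr _ _ (fcomp (sumr BB) j2) n2 (fun X => (pr1, idm _)) qN)
    (i := fun X => (in1, idm _))) => X; apply: prod_eq; rewrite /= ?cmp1m ?pr1_in1 //.
  by rewrite -[RHS]bipP [in2](zhom_eq _ 0) cmp0m addr0.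
apply: zz_trans (zz_pre n2 (nabla_lin K)) _.
apply: zz_trans (zz_sym (lin_smor n2_smor _)) _; apply: zz_lin.
exact: zz_sym J_swap.
Qed.

End SecondDerivative.

(** * Iterated derivatives in fixed directions *)

Section Directions.
Variables B A : kadd.
Implicit Types F G K : functor B (Ch A).

Lemma zz_dirn V F G : zz F G -> zz (dirn V F) (dirn V G).
Proof. by move=> z; apply/zz_pre/zz_nabla. Qed.

Lemma dirn_fbip V F G : zz (dirn V (fbip F G)) (fbip (dirn V F) (dirn V G)).
Proof. by apply: zz_trans (zz_pre _ (nabla_fbip F G)) _; zz_same. Qed.

Lemma zz_fbipCA F G K : zz (fbip F (fbip G K)) (fbip G (fbip F K)).
Proof.
have sN F' G' X Y (f : hom X Y) :
    bpair (pr1 ∘ pr2) (bpair pr1 (pr2 ∘ pr2)) ∘ fmor (fbip F' (fbip G' K)) f =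
    fmor (fbip G' (fbip F' K)) f ∘ bpair (pr1 ∘ pr2) (bpair pr1 (pr2 ∘ pr2)).
  rewrite [LHS]pair_cmp [X in bpair _ X = _]pair_cmp [RHS]bimap_pair.
  rewrite [X in _ = bpair _ X]bimap_pair -!cmpA pr1_bimap pr2_bimap.
  by rewrite !(cmpA _ (bimap _ _)) pr1_bimap pr2_bimap -!cmpA.
have sK (C D E : Ch A) : bpair (pr1 ∘ pr2) (bpair pr1 (pr2 ∘ pr2)) ∘
    bpair (pr1 ∘ pr2) (bpair pr1 (pr2 ∘ pr2)) = idm (C ⊕ (D ⊕ E)).
  rewrite [LHS]pair_cmp [X in bpair _ X = _]pair_cmp -!cmpA !pr1_pair !pr2_pair.
  by rewrite ?pr1_pair ?pr2_pair pair_eta -[pr1]cmpm1 -[pr2]cmpm1 pair_eta.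
apply: (zz_iso (a := @Nattr _ _ (fbip F (fbip G K)) (fbip G (fbip F K))
  (fun X => bpair (pr1 ∘ pr2) (bpair pr1 (pr2 ∘ pr2))) (sN F G))
  (i := fun X => bpair (pr1 ∘ pr2) (bpair pr1 (pr2 ∘ pr2)))) => X; apply: sK.
Qed.

Lemma zz_foldr (T : Type) (f g : T -> functor B (Ch A)) (s : seq T) F G :
  (forall x, zz (f x) (g x)) -> zz F G ->
  zz (foldr (@fbip _ A) F (map f s)) (foldr (@fbip _ A) G (map g s)).
Proof. by move=> fg z; elim: s => //= x s IH; apply: zz_fbip. Qed.

Lemma dirn_foldr V (s : seq (functor B (Ch A))) F :
  zz (dirn V (foldr (@fbip _ A) F s)) (foldr (@fbip _ A) (dirn V F) (map (dirn V) s)).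
Proof.
elim: s => [|G s IH] /=; first exact: zz_refl.
by apply: zz_trans (dirn_fbip _ _ _) _; apply: zz_fbip IH; apply: zz_refl.
Qed.

Lemma foldr_fbip (s : seq (functor B (Ch A))) F G :
  zz (foldr (@fbip _ A) (fbip F G) s) (fbip F (foldr (@fbip _ A) G s)).
Proof.
elim: s => [|K s IH] /=; first exact: zz_refl.
by apply: zz_trans (zz_fbip (zz_refl _) IH) _; apply: zz_fbipCA.
Qed.

Lemma nabla_iter_perm (T : eqType) (f : T -> B) (s t : seq T) F :
  perm_eq s t -> zz (nabla_iter F (map f s)) (nabla_iter F (map f t)).
Proof.
have rem_front (x : T) u : x \in u ->
    zz (nabla_iter F (map f u)) (nabla_iter F (map f (x :: rem x u))).
  elim: u => // y u IH; rewrite inE /= eq_sym; case: (eqVneq y x) => [->|ne] /=.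
    by move=> _; apply: zz_refl.
  move=> /IH z; exact: zz_trans (zz_dirn (f y) z) (dirn_comm _ _ _).
elim: s t => [|x s IH] t st.
  by move: st; rewrite perm_sym => /perm_nilP ->; apply: zz_refl.
have xt : x \in t by rewrite -(perm_mem st) mem_head.
apply: zz_trans (zz_sym (rem_front x t xt)); apply: (zz_dirn (f x)); apply: IH.
by rewrite -(perm_cons x) (perm_trans st) // perm_to_rem.
Qed.

End Directions.

(* One entry for each position, at which [y] is used instead of [w]: derivatives of
   [nabla K] along its linear variable substitute [y] for that variable. *)
Fixpoint bumps (B : Type) (s : seq (B * B)) : seq (seq B) :=
  if s is (y, w) :: s' then (y :: map snd s') :: map (cons w) (bumps s') else [::].

(** Once some [y] has replaced the linear variable, the term is pulled back along [sndf] and no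
    longer depends on that variable. Later directions then act only through their second components,
    so every term uses at most one [y]. *)
Lemma nabla_iter_nabla (B A : kadd) (F : functor B (Ch A)) (s : seq (B * B)) :
  zz (nabla_iter (nabla F) (s : seq (prodc B B)))
     (foldr (@fbip _ A) (nabla (nabla_iter F (map snd s)))
       [seq fcomp (nabla_iter F l) (sndf B B) | l <- bumps s]).
Proof.
elim: s => [|[y w] s IH] /=; first exact: zz_refl.
apply: zz_trans (zz_dirn ((y, w) : prodc B B) IH) _.
apply: zz_trans (dirn_foldr _ _ _) _; rewrite -!map_comp.
apply: zz_trans (zz_foldr _ _ (nabla_nabla _ y w)) _; last first.
  exact: foldr_fbip.
move=> l /=; apply: zz_trans (zz_pre _ (nabla_add (L := sndf B B) _ _)) _; first by [].
by zz_same.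
Qed.

(* [rho n] sends [(V_(n+1), ..., V_1, X)] to
   [((V_(n+1), V_n), ..., (V_2, V_1), (V_1, X))]. *)
Fixpoint rho (B : kadd) n : functor (pow B n.+1) (pow (prodc B B) n) :=
  match n return functor (pow B n.+1) (pow (prodc B B) n) with
  | 0 => idf (prodc B B)
  | n'.+1 => fpair (fpair (fstf B (pow B n'.+1))
                          (fcomp (fstf B (pow B n')) (sndf B (pow B n'.+1))))
                   (fcomp (rho B n') (sndf B (pow B n'.+1)))
  end.

Lemma rho_add (B : kadd) n (X Y : pow B n.+1) (f g : hom X Y) :
  fmor (rho B n) (f + g) = fmor (rho B n) f + fmor (rho B n) g.
Proof. by elim: n X Y f g => [//|n IH] X Y f g; apply: prod_eq => //=; apply: IH. Qed.

Lemma rho_init (B : kadd) n :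
  exists (q : fcomp (rho B n) (powinit B n.+1) ⟹ fcomp (powinit (prodc B B) n) (rho B n.+1))
    (i : forall X, hom (powinit (prodc B B) n (rho B n.+1 X)) (rho B n (powinit B n.+1 X))),
    (forall X, i X ∘ q X = idm _) /\ (forall X, q X ∘ i X = idm _).
Proof.
elim: n => [|n [q [i [iq qi]]]].
  pose L1 := fcomp (rho B 0) (powinit B 1).
  pose L2 := fcomp (powinit (prodc B B) 0) (rho B 1).
  have N X Y (f : hom X Y) : idm (L1 Y) ∘ fmor L1 f = fmor L2 f ∘ idm (L1 X).
    by rewrite cmp1m cmpm1.
  exists (@Nattr _ _ L1 L2 (fun X => idm (L1 X)) N), (fun X => idm (L1 X)).
  by split=> X; apply: (cmp1m (idm (L1 X))).
pose L1 := fcomp (rho B n.+1) (powinit B n.+2).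
pose L2 := fcomp (powinit (prodc B B) n.+1) (rho B n.+2).
pose qq X : hom (L1 X) (L2 X) := (idm _, q X.2).
have N X Y (f : hom X Y) : qq Y ∘ fmor L1 f = fmor L2 f ∘ qq X.
  apply: prod_eq; last exact: (ntP q f.2).
  by do ?[apply: prod_eq]; rewrite /= ?cmp1m ?cmpm1.
exists (@Nattr _ _ L1 L2 qq N), (fun X => (idm _, i X.2)).
split=> X; apply: prod_eq; [exact: (cmp1m (idm _)) | exact: iq |
  exact: (cmp1m (idm _)) | exact: qi].
Qed.

(** [rho n] is additive, so [nabla] passes through it by [nabla_add]. It remains to see that [rho]
    is compatible with dropping the last and the first coordinate of a tuple. *)
Lemma Delta_shift (B A : kadd) (F : functor B (Ch A)) n :
  zz (Delta F n.+1) (fcomp (Delta (nabla F) n) (rho B n)).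
Proof.
elim: n => [|n IH].
  have N X Y (f : hom X Y) :
      idm (fpair (fstf B B) (sndf B B) Y) ∘ fmor (fpair (fstf B B) (sndf B B)) f =
      fmor (idf (prodc B B)) f ∘ idm (fpair (fstf B B) (sndf B B) X).
    by case: f => f1 f2; apply: prod_eq; rewrite /= cmp1m cmpm1.
  apply: (zz_whisk (nabla F) (q := @Nattr _ _ (fpair (fstf B B) (sndf B B)) (idf (prodc B B))
    (fun X => idm (fpair (fstf B B) (sndf B B) X)) N)
    (i := fun X => idm (fpair (fstf B B) (sndf B B) X))) => X;
  exact: cmp1m.
pose L0 := fpair (powinit B n.+1) (powtail B n.+1).
pose L0' := fpair (powinit (prodc B B) n) (powtail (prodc B B) n).
apply: (zz_trans (G := fcomp (nabla (fcomp (Delta (nabla F) n) (rho B n))) L0)).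
  exact/zz_pre/zz_nabla.
apply: zz_trans (zz_pre L0 (nabla_add (@rho_add B n) (Delta (nabla F) n))) _.
apply: zz_trans (zz_assoc _ _ _) _.
apply: (zz_trans (G := fcomp (nabla (Delta (nabla F) n)) (fcomp L0' (rho B n.+1)))); last first.
  exact: zz_sym (zz_assoc _ _ _).
have [q [i [iq qi]]] := rho_init B n.
pose L1 := fcomp (sqf (rho B n)) L0; pose L2 := fcomp L0' (rho B n.+1).
pose qq X : hom (L1 X) (L2 X) := (q X, idm _).
have N X Y (f : hom X Y) : qq Y ∘ fmor L1 f = fmor L2 f ∘ qq X.
  by apply: prod_eq; [exact: (ntP q f) | rewrite /= cmp1m cmpm1].
pose qn : L1 ⟹ L2 := Nattr N.
pose ii X : hom (L2 X) (L1 X) := (i X, idm _).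
have iiq X : ii X ∘ qn X = idm _ by apply: prod_eq; [exact: iq | exact: (cmp1m (idm _))].
have qii X : qn X ∘ ii X = idm _ by apply: prod_eq; [exact: qi | exact: (cmp1m (idm _))].
exact: (zz_whisk (nabla (Delta (nabla F) n)) iiq qii).
Qed.

Lemma rho_tuple (B : kadd) (V : nat -> B) (X : B) n :
  rho B n (tuple_ob V X n.+1) =
  tuple_ob (fun k => (V k.+1, V k) : prodc B B) ((V 1%N, X) : prodc B B) n.
Proof. by elim: n => [//|n IH]; rewrite [RHS]/= -IH. Qed.

(* [parts n] lists the sequences of block sizes of the partitions of an [n]-element
   set: a new element forms a block of its own or joins one of the blocks. *)
Fixpoint bump1 (l : seq nat) : seq (seq nat) :=
  if l is a :: l' then (a.+1 :: l') :: map (cons a) (bump1 l') else [::].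

Fixpoint parts n : seq (seq nat) :=
  if n is n'.+1 then flatten [seq (1%N :: l) :: bump1 l | l <- parts n'] else [:: [::]].

(** * Finite direct sums *)

Section BigSum.
Variable A : kadd.
Implicit Types C D : Ch A.
Local Notation bipc := (@bip (Ch A)).

Lemma wequiv_bip C C' D D' : wequiv (C : cpx A) C' -> wequiv (D : cpx A) D' ->
  wequiv (C ⊕ D : cpx A) (C' ⊕ D').
Proof.
case=> f wf [g wg].
exists (bimap (f : @hom (Ch A) C C') (g : @hom (Ch A) D D')).
exact: (weq_bimap (f := f) (g := g)).
Qed.

Lemma wequiv_iso C D (f : hom C D) (g : hom D C) : g ∘ f = idm _ -> f ∘ g = idm _ ->
  wequiv (C : cpx A) D.
Proof.
move=> gf fg; exists f; apply: (weq_iso (g := fun n => (g : chmap D C) n)) => n.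
  exact: (chE gf n).
exact: (chE fg n).
Qed.

Lemma wequiv_bipA C D K : wequiv (C ⊕ (D ⊕ K) : cpx A) (C ⊕ D ⊕ K).
Proof.
apply: (@wequiv_iso _ _ (bpair (bpair pr1 (pr1 ∘ pr2)) (pr2 ∘ pr2))
  (bpair (pr1 ∘ pr1) (bpair (pr2 ∘ pr1) pr2))).
  rewrite [LHS]pair_cmp [X in bpair _ X = _]pair_cmp -!cmpA !pr1_pair !pr2_pair.
  by rewrite ?pr1_pair ?pr2_pair pair_eta -[pr1]cmpm1 -[pr2]cmpm1 pair_eta.
rewrite [LHS]pair_cmp [X in bpair X _ = _]pair_cmp -!cmpA !pr1_pair !pr2_pair.
by rewrite ?pr1_pair ?pr2_pair pair_eta -[pr1]cmpm1 -[pr2]cmpm1 pair_eta.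
Qed.

Lemma wequiv_bipC C D : wequiv (C ⊕ D : cpx A) (D ⊕ C).
Proof.
apply: (@wequiv_iso _ _ (bpair pr2 pr1) (bpair pr2 pr1)).
  by rewrite pair_cmp pr1_pair pr2_pair -[pr1]cmpm1 -[pr2]cmpm1 pair_eta.
by rewrite pair_cmp pr1_pair pr2_pair -[pr1]cmpm1 -[pr2]cmpm1 pair_eta.
Qed.

Lemma wequiv_bip0 D : wequiv (zob ⊕ D : cpx A) D.
Proof.
apply: (@wequiv_iso _ _ pr2 in2); last exact: pr2_in2.
by rewrite -[RHS]bipP [in1](zhom_eq _ 0) cmp0m add0r.
Qed.

Variable T : eqType.
Implicit Types (g h : T -> Ch A) (s t : seq T).

Lemma big_wequiv g h s : (forall x, x \in s -> wequiv (g x : cpx A) (h x)) ->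
  wequiv (\big[bipc/zob]_(x <- s) g x : cpx A) (\big[bipc/zob]_(x <- s) h x).
Proof.
elim: s => [|x s IH] gh; first by rewrite !big_nil; apply: wequiv_refl.
rewrite !big_cons; apply: wequiv_bip; first exact/gh/mem_head.
by apply: IH => y ys; apply: gh; rewrite inE ys orbT.
Qed.

Lemma big_wequiv_cat g s t :
  wequiv (\big[bipc/zob]_(x <- s) g x ⊕ \big[bipc/zob]_(x <- t) g x : cpx A)
    (\big[bipc/zob]_(x <- s ++ t) g x).
Proof.
elim: s => [|x s IH]; first by rewrite big_nil; apply: wequiv_bip0.
rewrite cat_cons !big_cons; apply: wequiv_trans (wequiv_sym (wequiv_bipA _ _ _)) _.
by apply: wequiv_bip IH; apply: wequiv_refl.
Qed.

Lemma big_wequiv_perm g s t : perm_eq s t ->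
  wequiv (\big[bipc/zob]_(x <- s) g x : cpx A) (\big[bipc/zob]_(x <- t) g x).
Proof.
move=> st; have rem_front x u : x \in u ->
    wequiv (\big[bipc/zob]_(x <- u) g x : cpx A) (\big[bipc/zob]_(y <- x :: rem x u) g y).
  elim: u => // y u IH; rewrite inE /= eq_sym; case: (eqVneq y x) => [->|ne] /=.
    by move=> _; apply: wequiv_refl.
  move=> /IH z; rewrite !big_cons.
  apply: wequiv_trans (wequiv_bip (wequiv_refl _) z) _; rewrite big_cons.
  apply: wequiv_trans (wequiv_bipA _ _ _) _; apply: wequiv_trans (wequiv_sym (wequiv_bipA _ _ _)).
  by apply: wequiv_bip (wequiv_refl _); apply: wequiv_bipC.
elim: s t st => [|x s IH] t st.
  by move: st; rewrite perm_sym => /perm_nilP ->; apply: wequiv_refl.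
have xt : x \in t by rewrite -(perm_mem st) mem_head.
apply: wequiv_trans (wequiv_sym (rem_front x t xt)); rewrite !big_cons.
apply: wequiv_bip; first exact: wequiv_refl.
by apply: IH; rewrite -(perm_cons x) (perm_trans st) // perm_to_rem.
Qed.

Lemma big_wequiv_flatten (U : Type) g (f : U -> seq T) (s : seq U) :
  wequiv (\big[bipc/zob]_(u <- s) \big[bipc/zob]_(x <- f u) g x : cpx A)
    (\big[bipc/zob]_(x <- flatten (map f s)) g x).
Proof.
elim: s => [|u s IH]; first by rewrite !big_nil; apply: wequiv_refl.
rewrite big_cons /=; apply: wequiv_trans (big_wequiv_cat _ _ _).
by apply: wequiv_bip IH; apply: wequiv_refl.
Qed.

End BigSum.

(** * Block sizes of partitions *)

Section PartitionSizes.
Local Open Scope nat_scope.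
Variable T : finType.
Implicit Types (P Q : {set {set T}}) (D U : {set T}) (x : T).

Lemma notin_partition P D U x : partition P D -> x \in U -> x \notin D -> U \notin P.
Proof. by move=> pP xS; apply: contra => /(partitionS pP)/subsetP; apply. Qed.

Lemma partition_swap P D U U' : partition P D -> U \in P -> U' != set0 ->
  [disjoint U' & D :\: U] -> partition (U' |: (P :\ U)) (U' :|: (D :\: U)).
Proof. by move=> pP SP; apply: partitionU1; apply: partitionD1. Qed.

Lemma partition_grow Q D U x : x \in D -> partition Q (D :\ x) -> U \in Q ->
  partition ((x |: U) |: (Q :\ U)) D.
Proof.
move=> xD pQ SQ; have sSD := partitionS pQ SQ.
have -> : D = (x |: U) :|: ((D :\ x) :\: U).
  apply/setP => y; rewrite !inE; case: eqVneq => [->|yx] //=.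
  case yS: (y \in U) => //=; have := subsetP sSD y yS.
  by rewrite !inE => /andP [].
apply: partition_swap => //.
  by apply/set0Pn; exists x; rewrite !inE eqxx.
rewrite disjoints_subset; apply/subsetP => y; rewrite !inE.
by case/orP => [/eqP ->|->]; rewrite ?eqxx ?andbF.
Qed.

Lemma partition_shrink P D U x : partition P D -> U \in P -> x \in U ->
  U != [set x] -> partition ((U :\ x) |: (P :\ U)) (D :\ x).
Proof.
move=> pP SP xS Sx; have sSD := partitionS pP SP.
have -> : D :\ x = (U :\ x) :|: (D :\: U).
  apply/setP => y; rewrite !inE; case: (eqVneq y x) => [->|yx] /=; first by rewrite xS.
  by case yS: (y \in U) => //=; rewrite (subsetP sSD y yS).
apply: partition_swap => //.
  apply: contra Sx; rewrite setD_eq0 => sSx; rewrite eqEsubset sSx /=.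
  by rewrite sub1set.
rewrite disjoints_subset; apply/subsetP => y; rewrite !inE => /andP [_ ->].
by [].
Qed.

Definition sizes P := [seq #|U : {set T}| | U <- enum P].

Lemma perm_sizes_setU1 P U : U \notin P -> perm_eq (sizes (U |: P)) (#|U| :: sizes P).
Proof.
move=> SP; apply: (@perm_map _ _ _ _ (U :: enum P)); apply: uniq_perm.
- exact: enum_uniq.
- by rewrite /= enum_uniq mem_enum SP.
by move=> W; rewrite mem_enum !inE mem_enum.
Qed.

Lemma perm_sizes_setD1 P U : U \in P -> perm_eq (sizes P) (#|U| :: sizes (P :\ U)).
Proof.
move=> SP; rewrite -{1}(setD1K SP); apply: perm_sizes_setU1.
by rewrite !inE eqxx.
Qed.

(** Partitions have no preferred order of blocks while [parts] consists of lists; both are compared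
    by summing weights blind to order. *)
Definition perm_invariant (f : seq nat -> nat) := forall s t, perm_eq s t -> f s = f t.

(** Up to order, enlarging an entry means removing it and putting its successor in front, a
    description that depends only on the multiset. *)
Lemma sum_bump1 f s : perm_invariant f ->
  \sum_(l <- bump1 s) f l = \sum_(a <- s) f (a.+1 :: rem a s).
Proof.
move=> fP; elim: s f fP => [|a s IH] f fP /=; first by rewrite !big_nil.
rewrite !big_cons /= eqxx big_map; congr (_ + _).
rewrite (IH (fun l => f (a :: l))); last first.
  by move=> u v uv; apply: fP; rewrite perm_cons.
rewrite big_seq [RHS]big_seq; apply: eq_bigr => b bs; apply: fP.
have swap u : perm_eq [:: a, b.+1 & u] [:: b.+1, a & u].
  by rewrite (perm_catCA [:: a] [:: b.+1] u).
apply: perm_trans (swap _) _; rewrite perm_cons.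
by case: eqVneq => // e; rewrite perm_sym e perm_to_rem.
Qed.

Lemma sum_bump1_perm f s t : perm_invariant f -> perm_eq s t ->
  \sum_(l <- bump1 s) f l = \sum_(l <- bump1 t) f l.
Proof.
move=> fP st; rewrite !sum_bump1 // (perm_big _ st) /= big_seq [RHS]big_seq.
apply: eq_bigr => a at'; apply: fP; rewrite perm_cons -(perm_cons a).
have as' : a \in s by rewrite (perm_mem st).
by rewrite -(permPl (perm_to_rem as')) (permPl st) perm_to_rem.
Qed.

(** Partitions are sorted by whether [x] forms a block alone, which is removed, or lies in a larger
    block, which shrinks to a marked block of a partition of [D :\ x]. *)
Lemma sum_partitionD1 f D x : perm_invariant f -> x \in D ->
  \sum_(P | partition P D) f (sizes P) =
  \sum_(Q | partition Q (D :\ x))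
     (f (1 :: sizes Q) + \sum_(l <- bump1 (sizes Q)) f l).
Proof.
move=> fP xD; rewrite (bigID (fun P => [set x] \in P)) big_split /=; congr (_ + _).
  rewrite (reindex_onto (fun Q => [set x] |: Q) (fun P => P :\ [set x])) /=; last first.
    by move=> P /andP [_ /setD1K].
  have nx Q : partition Q (D :\ x) -> [set x] \notin Q.
    by move=> pQ; apply: (notin_partition (x := x) pQ); rewrite !inE eqxx.
  apply: eq_big => [Q|Q /andP [/andP [pP _] /eqP e]].
    apply/idP/idP => [/andP [/andP [pP xP] /eqP <-]|pQ]; first exact: partitionD1.
    rewrite setU1K ?nx // eqxx !inE eqxx !andbT -(setD1K xD).
    apply: partitionU1 => //; first by apply/set0Pn; exists x; rewrite inE.
    by rewrite disjoints1 !inE eqxx.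
  apply: fP; apply: perm_trans (perm_sizes_setU1 _) _; last by rewrite cards1.
  by rewrite -e !inE eqxx.
(* [gr] adds [x] to the marked block; [sh] takes [x] out of its block and marks what remains. They
   are inverse to each other because the remainder is nonempty, hence distinct from and disjoint to
   the other blocks. *)
pose gr (p : {set {set T}} * {set T}) := (x |: p.2) |: (p.1 :\ p.2).
pose sh P := ((pblock P x :\ x) |: (P :\ pblock P x), pblock P x :\ x).
pose okP P := partition P D && ([set x] \notin P).
pose okQ p := partition p.1 (D :\ x) && (p.2 \in p.1).
have shP P : okP P -> okQ (sh P) /\ gr (sh P) = P.
  case/andP => pP xP; set U := pblock P x.
  have xc : x \in cover P by rewrite (cover_partition pP).
  have SP : U \in P by apply: pblock_mem.
  have xS : x \in U by rewrite mem_pblock.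
  have nS : U != [set x] by apply: contraNneq xP => <-.
  have pQ := partition_shrink pP SP xS nS.
  split; first by rewrite /okQ /= pQ !inE eqxx.
  rewrite /gr /= setD1K // setU1K ?setD1K //.
  have [y yUx] : exists y, y \in U :\ x.
    apply/set0Pn; apply: contra nS; rewrite setD_eq0 => sUx.
    by rewrite eqEsubset sUx /= sub1set.
  have yU : y \in U by move: yUx; rewrite !inE => /andP [].
  have tP := partition_trivIset pP.
  rewrite !inE; apply/negP => /andP [_ UxP].
  have := def_pblock tP UxP yUx; rewrite (def_pblock tP SP yU) => e.
  by move: xS; rewrite e !inE eqxx.
have grP p : okQ p -> okP (gr p) /\ sh (gr p) = p.
  case: p => Q U /andP [/= pQ UQ]; rewrite /okP /gr /=.
  have pP := partition_grow xD pQ UQ.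
  have xU : x \notin U by apply/negP => /(subsetP (partitionS pQ UQ)); rewrite !inE eqxx.
  have nQ : x |: U \notin Q.
    by apply: (notin_partition (x := x) pQ); rewrite !inE eqxx.
  have pb : pblock ((x |: U) |: Q :\ U) x = x |: U.
    by apply: (def_pblock (partition_trivIset pP)); rewrite !inE eqxx.
  rewrite pP /sh pb /= !setU1K //; last by rewrite !inE (negPf nQ) andbF.
  rewrite setD1K //; split => //; rewrite !inE negb_or negb_and.
  have U0 : U != set0 by apply: partition_neq0 pQ _.
  have [y yU] := set0Pn _ U0.
  have yx : y != x by apply: contraNneq xU => <-.
  apply/andP; split.
    apply/eqP => e; move: yx; rewrite -in_set1 e !inE yU orbT //.
  by apply/orP; right; apply: (notin_partition (x := x) pQ); rewrite !inE eqxx.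
rewrite (reindex_onto gr sh) /=; last by move=> P /shP [].
rewrite (eq_bigl okQ); last first.
  move=> p; apply/idP/idP => [/andP [oP /eqP <-]|oQ]; first by have [] := shP _ oP.
  by have [oP e] := grP _ oQ; rewrite e eqxx andbT.
transitivity (\sum_(Q | partition Q (D :\ x)) \sum_(U in Q) f (sizes (gr (Q, U)))).
  by rewrite pair_big_dep /=; apply: eq_bigr => -[].
apply: eq_bigr => Q pQ; rewrite sum_bump1 // big_map big_enum /=.
apply: eq_bigr => U UQ; apply: fP; rewrite /gr /=.
have nQ : x |: U \notin Q :\ U.
  rewrite !inE negb_and; apply/orP; right.
  by apply: (notin_partition (x := x) pQ); rewrite !inE eqxx.
apply: perm_trans (perm_sizes_setU1 nQ) _; rewrite cardsU1.
have -> : x \notin U by apply/negP => /(subsetP (partitionS pQ UQ)); rewrite !inE eqxx.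
rewrite perm_cons -(perm_cons #|U|) -(permPl (perm_sizes_setD1 UQ)).
by rewrite perm_to_rem // map_f // mem_enum.
Qed.

Lemma sum_partition f D : perm_invariant f ->
  \sum_(P | partition P D) f (sizes P) = \sum_(l <- parts #|D|) f l.
Proof.
move eqn : #|D| => n; elim: n D eqn f => [|n IH] D.
  move/eqP; rewrite cards_eq0 => /eqP -> f _; rewrite (big_pred1 set0); last first.
    by move=> P; rewrite partition_set0.
  by rewrite /= big_seq1 /sizes enum_set0.
move=> Dn f fP; have [x xD] : exists x, x \in D by apply/set0Pn; rewrite -card_gt0 Dn.
have Dx : #|D :\ x| = n by move: Dn; rewrite (cardsD1 x) xD => - [].
pose g l := f (1 :: l) + \sum_(l' <- bump1 l) f l'.
rewrite (sum_partitionD1 fP xD) (IH _ Dx g); last first.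
  move=> s t st; rewrite /g (sum_bump1_perm fP st); congr (_ + _).
  by apply: fP; rewrite perm_cons.
rewrite /= big_flatten big_map /=; apply: eq_bigr => l _.
by rewrite big_cons.
Qed.

(** Two lists are permutations of each other once every predicate [a] has equal counts on them; the
    weight counting [a (sort leq l)] is blind to order, so [sum_partition] applies. *)
Lemma perm_parts D :
  perm_eq [seq sort leq l | l <- parts #|D|]
    [seq sort leq (sizes P) | P <- index_enum {set {set T}} & partition P D].
Proof.
apply/permP => a; rewrite !count_map -!sum1_count big_filter_cond.
pose f l : nat := a (sort leq l).
have fP : perm_invariant f.
  by move=> s t /(perm_sortP leq_total leq_trans anti_leq); rewrite /f => ->.
rewrite [LHS]big_mkcond [RHS]big_mkcondr /=; symmetry.
apply: etrans (etrans _ (sum_partition D fP)) _; apply: eq_bigr => l _.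
  by rewrite /f; case: (a _).
by rewrite /f; case: (a _).
Qed.
End PartitionSizes.

(** * Sum over partitions *)

Lemma bumps_map (B : Type) (V : nat -> B) l :
  bumps [seq (V k.+1, V k) | k <- l] = map (map V) (bump1 l).
Proof.
elim: l => //= a l ->; rewrite -!map_comp; congr (_ :: _).
Qed.

Lemma foldr_fbip_pt (E A : kadd) (G : functor E (Ch A)) (s : seq (functor E (Ch A))) X :
  wequiv (foldr (@fbip _ A) G s X) (G X ⊕ \big[@bip (Ch A)/zob]_(H <- s) H X).
Proof.
elim: s => [|H s IH] /=.
  rewrite big_nil; apply: wequiv_sym.
  exact: wequiv_trans (wequiv_bipC _ _) (wequiv_bip0 _).
rewrite big_cons; apply: wequiv_trans (wequiv_bip (wequiv_refl _) IH) _.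
apply: wequiv_trans (wequiv_bipA _ _ _) _.
apply: wequiv_trans (wequiv_bip (wequiv_bipC _ _) (wequiv_refl _)) _.
exact: wequiv_sym (wequiv_bipA _ _ _).
Qed.

Lemma Delta_parts n (A B : kadd) (F : functor B (Ch A)) (V : nat -> B) (X : B) :
  wequiv (Delta F n (tuple_ob V X n))
    (\big[@bip (Ch A)/zob]_(l <- parts n) nabla_iter F (map V l) X).
Proof.
elim: n B F V X => [|n IH] B F V X.
  rewrite /= big_cons big_nil; apply: wequiv_sym.
  exact: wequiv_trans (wequiv_bipC _ _) (wequiv_bip0 _).
(* In the direction [V' k] the second coordinate keeps a block of size [k] and the first enlarges it
   to [k.+1]. The first coordinate of [X'] is [V 1], the direction of a new singleton block. *)
pose V' k : prodc B B := (V k.+1, V k); pose X' : prodc B B := (V 1%N, X).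
apply: wequiv_trans (zz_pt _ (Delta_shift F n)) _.
have -> : fcomp (Delta (nabla F) n) (rho B n) (tuple_ob V X n.+1) =
    Delta (nabla F) n (tuple_ob V' X' n).
  by rewrite -rho_tuple.
apply: wequiv_trans (IH _ (nabla F) V' X') _.
apply: wequiv_trans (big_wequiv_flatten _ _ _); apply: big_wequiv => l _.
apply: wequiv_trans (zz_pt X' (nabla_iter_nabla F (map V' l))) _.
apply: wequiv_trans (foldr_fbip_pt _ _ _) _.
have -> : map snd (map V' l) = map V l by rewrite -map_comp.
rewrite big_cons bumps_map !big_map; exact: wequiv_refl.
Qed.

(* [V k] is the object V_k, for 1 <= k <= n; the set {1, ..., n} is 'I_n; the
   function [e] chooses the enumeration S_1, ..., S_k of each partition. *)
Theorem theorem7p7 (A B : abelian) (F : functor B (Ch A)) (n : nat)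
    (hn : (1 <= n)%N) (V : nat -> B) (X : B)
    (e : {set {set 'I_n}} -> seq {set 'I_n})
    (he : forall P : {set {set 'I_n}},
       partition P [set: 'I_n] -> perm_eq (e P) (enum P)) :
  homotopy_equivalent
    (Delta F n (tuple_ob V X n))
    (\big[@bip (Ch A) / zob]_(P : {set {set 'I_n}} | partition P [set: 'I_n])
        nabla_iter F [seq V #|Si| | Si : {set 'I_n} <- e P] X).
Proof.
apply: wequiv_homotopy_equivalent; apply: wequiv_trans (Delta_parts _ _ _ _) _.
pose g (l : seq nat) := nabla_iter F (map V l) X : Ch A.
have gP l t : perm_eq l t -> wequiv (g l) (g t).
  by move=> lt; apply: zz_pt; apply: nabla_iter_perm.
(* The two families of size lists agree only up to the order inside each list. Sorting picks
   representatives that agree on the nose, at the price of an equivalence from symmetry of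
   [nabla_iter]. *)
have sorted_big : wequiv (\big[@bip (Ch A)/zob]_(l <- parts n) g l : cpx A)
    (\big[@bip (Ch A)/zob]_(l <- map (sort leq) (parts n)) g l).
  by rewrite big_map; apply: big_wequiv => l _; apply: gP; rewrite perm_sym perm_sort.
apply: wequiv_trans sorted_big _.
have pp := perm_parts [set: 'I_n]; rewrite cardsT card_ord in pp.
apply: wequiv_trans (big_wequiv_perm _ pp) _; rewrite big_map -[X in wequiv _ X]big_filter.
apply: big_wequiv => P; rewrite mem_filter => /andP [pP _].
have -> : [seq V #|Si| | Si : {set 'I_n} <- e P] = map V [seq #|Si| | Si : {set 'I_n} <- e P].
  by rewrite -map_comp.
by apply: gP; rewrite perm_sort perm_sym; apply/perm_map/he.
Qed.
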